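(* Let $1\le k\le n-1$ and let $\mathrm{Gr}(k,n)$ be the real Grassmann manifold of $k$-dimensional subspaces of $\mathbb{R}^n$. Consider the cellular cochain complex with $\mathbb{Z}$-coefficients of the Schubert cell decomposition of $\mathrm{Gr}(k,n)$, with coboundary $\delta\sigma_w=\sum_{w'}[w;w']\,\sigma_{w'}$ (sum over $w'\in S_n^{(k)}$ with $\ell(w')=\ell(w)+1$). Then for all $w,w'\in S_n^{(k)}$ with $\ell(w')=\ell(w)+1$: $$[w;w']=\pm 2 \quad\text{if } w'=s_iw \text{ for some simple reflection } s_i \text{ and } \eta(w)=\eta(w'),$$ and $[w;w']=0$ otherwise. In other words, the graph $\mathsf{G}(k,n)$, with its edges $\Rightarrow$ having incidence number $\pm2$ and all other incidence numbers equal to zero, is the incidence graph $\mathcal{G}(k,n)$ of $\mathrm{Gr}(k,n)$.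
   Context: $S_n$ is the symmetric group with simple reflections $s_i=(i,i+1)$, $1\le i\le n-1$, and length function $\ell$. $S_n^{(k)}$ is the set of minimal length coset representatives $w\in S_n$ modulo $P_k=\langle s_1,\dots,\hat s_k,\dots,s_{n-1}\rangle\cong S_k\times S_{n-k}$ (i.e. $\ell(ws)\ge \ell(w)$ for all $s\in P_k$); equivalently $w(1)<\cdots<w(k)$ and $w(k+1)<\cdots<w(n)$. Schubert cells: for $w\in S_n^{(k)}$, $\Omega_w^\circ\subset \mathrm{Gr}(k,n)$ is the set of $k$-dimensional subspaces $V$ such that $\{i: \dim(V\cap\langle e_1,\dots,e_i\rangle)>\dim(V\cap\langle e_1,\dots,e_{i-1}\rangle)\}=\{w(1),\dots,w(k)\}$ (row spaces of $k\times n$ reduced echelon matrices whose pivots, the last nonzero entries of the rows, are in columns $w(1),\dots,w(k)$). It is a cell of dimension $\ell(w)=\sum_{j=1}^k (w(j)-j)$, and these cells form a CW decomposition of $\mathrm{Gr}(k,n)$. Choosing an orientation of each cell, $\sigma_w$ denotes the cellular cochain dual to $\Omega_w^\circ$; the integer $[w;w']$ is called the incidence number (a change of orientations changes only its sign). The incidence graph $\mathcal{G}(k,n)$ has vertices $\sigma_w$, $w\in S_n^{(k)}$, and an edge $\sigma_w\Rightarrow\sigma_{w'}$ iff $[w;w']=\pm2$. Weights: $Y_w$ is the Young diagram of left-justified boxes contained in the $k\times(n-k)$ rectangle having $\lambda_j=w(j)-j$ boxes in the $j$-th row from the bottom, $j=1,\dots,k$ (so the top row is row $k$ and is the longest). Fill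 the boxes of $Y_w$ with letters $q$ and $1$ in a checkerboard pattern with $q$ in the northwest corner box: the box in the $a$-th row from the top and $b$-th column contains $q$ if $a+b$ is even and $1$ if $a+b$ is odd. Then $\eta(w)$ is the number of $q$'s in $Y_w$. The graph $\mathsf{G}(k,n)$ has vertex set $S_n^{(k)}$ (vertices identified with the diagrams $Y_w$), and an edge $w\Rightarrow w'$ iff $w'=s_iw$ for some $i$, $\ell(w')=\ell(w)+1$ and $\eta(w)=\eta(w')$. *)

(* Defs.v *)
From HB Require Import structures.
From mathcomp Require Import all_boot all_order all_algebra all_fingroup.
From mathcomp Require Import all_classical all_reals all_analysis.
From mathcomp Require Import freeg.

Set Implicit Arguments.
Unset Strict Implicit.
Unset Printing Implicit Defensive.

Import Order.TTheory GRing.Theory Num.Theory.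
Import numFieldNormedType.Exports.

Local Open Scope classical_set_scope.
Local Open Scope ring_scope.

Section SymmetricGroup.
Variable n : nat.

Fact srefl_subproof (i : 'I_n.-1) : (i.+1 < n)%N.
Proof. by rewrite -ltn_predRL. Qed.

(* Indices start at 0: [srefl i] exchanges i and i.+1, so it is the simple
   reflection usually written s_(i+1). *)
Definition srefl (i : 'I_n.-1) : 'S_n :=
  tperm (Ordinal (ltnW (srefl_subproof i))) (Ordinal (srefl_subproof i)).

Definition is_word (w : 'S_n) (m : nat) : bool :=
  [exists t : m.-tuple 'I_n.-1, w == (\prod_(i <- t) srefl i)%g].

Lemma is_word_cat (u v : 'S_n) (l m : nat) :
  is_word u l -> is_word v m -> is_word (u * v)%g (l + m).
Proof.
move=> /existsP[s /eqP ->] /existsP[t /eqP ->].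
by apply/existsP; exists [tuple of s ++ t]; rewrite big_cat.
Qed.

Lemma is_word_tperm (d : nat) (i j : 'I_n) : (i + d.+1)%N = j ->
  exists m, is_word (tperm i j) m.
Proof.
elim: d j => [|d IHd] j ij.
  have lt_i : (i < n.-1)%N by rewrite ltn_predRL -addn1 [X in (X < _)%N]ij.
  exists 1; apply/existsP; exists [tuple Ordinal lt_i].
  rewrite big_seq1; apply/eqP; congr tperm; apply: val_inj => //=.
  by rewrite -ij addn1.
have lt_p : ((i + d.+1).+1 < n)%N by rewrite -addnS [X in (X < _)%N]ij.
have lt_q : (i + d.+1 < n.-1)%N by rewrite ltn_predRL.
set p := Ordinal (ltnW lt_p); have [m wm] := IHd p erefl.
have ws : is_word (srefl (Ordinal lt_q)) 1.
  by apply/existsP; exists [tuple Ordinal lt_q]; rewrite big_seq1.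
have sE : srefl (Ordinal lt_q) = tperm p j.
  by congr tperm; apply: val_inj; rewrite /= -?ij ?addnS.
exists (1 + (m + 1))%N.
have -> : tperm i j = (srefl (Ordinal lt_q) * (tperm i p * srefl (Ordinal lt_q)))%g.
  rewrite sE; have -> : tperm i j = (tperm i p ^ tperm p j)%g.
    rewrite tpermJ tpermL tpermD //.
      by rewrite -val_eqE /= -[X in _ == X]addn0 eqn_add2l.
    by rewrite -val_eqE /= -ij -[X in _ == X]addn0 eqn_add2l.
  by rewrite conjgE tpermV.
by apply: is_word_cat => //; apply: is_word_cat.
Qed.

Lemma is_word_ex (w : 'S_n) : exists m, is_word w m.
Proof.
have [ts -> _] := prod_tpermP w; elim: ts => [|[x y] ts [m wm]].
  by exists 0; apply/existsP; exists [tuple]; rewrite !big_nil.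
have [l wl] : exists l, is_word (tperm x y) l.
  have [xy|yx|xy] := ltngtP x y.
  - by apply: (@is_word_tperm (y - x).-1); rewrite prednK ?subn_gt0// subnKC// ltnW.
  - rewrite tpermC.
    by apply: (@is_word_tperm (x - y).-1); rewrite prednK ?subn_gt0// subnKC// ltnW.
  - exists 0; apply/existsP; exists [tuple].
    by rewrite big_nil (val_inj xy) tperm1.
by exists (l + m)%N; rewrite big_cons; apply: is_word_cat.
Qed.

Definition ell (w : 'S_n) : nat := ex_minn (is_word_ex w).

Definition parabolic (k : nat) : {group 'S_n} :=
  <<[set srefl i | i : 'I_n.-1 & i.+1 != k]>>%G.

(* In MathComp [(u * w) x = w (u x)], so the product written w u in the
   convention (w u)(x) = w(u(x)) is [u * w] here, and s_i w is [w * srefl i]. *)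
Definition minrep (k : nat) : {set 'S_n} :=
  [set w : 'S_n | [forall u in parabolic k, (ell w <= ell (u * w)%g)%N]].

(* The box [(j, b)] is in row j counted from the bottom and column b, both
   counted from 0. *)
Definition young (k : nat) (w : 'S_n) : {set 'I_n * 'I_n} :=
  [set x : 'I_n * 'I_n | (x.1 < k)%N && (x.2 < w x.1 - x.1)%N].

(* Row j from the bottom is row k.-1 - j from the top. *)
Definition eta (k : nat) (w : 'S_n) : nat :=
  #|[set x in young k w | ~~ odd ((k.-1 - x.1) + x.2)]|.

Definition weak_edge (k : nat) (w w' : 'S_n) : Prop :=
  (exists i : 'I_n.-1, w' = (w * srefl i)%g) /\ eta k w = eta k w'.

Definition graph_G (k : nat) (w w' : 'S_n) : Prop :=
  [/\ w \in minrep k, w' \in minrep k, ell w' = (ell w).+1 & weak_edge k w w'].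

End SymmetricGroup.

Section SingularChains.
Variables (R : realType) (X : topologicalType).

Definition stdsimplex (d : nat) : set 'rV[R]_d.+1 :=
  [set x | (forall i, 0 <= x 0 i) /\ \sum_i x 0 i = 1].
Arguments stdsimplex : clear implicits.

Definition insert0 (d : nat) (i : 'I_d.+2) (x : 'rV[R]_d.+1) : 'rV[R]_d.+2 :=
  \row_j if unlift i j is Some j' then x 0 j' else 0.

Fact face_subproof (d : nat) (i : 'I_d.+2) (x : stdsimplex d) :
  insert0 i (set_val x) \in stdsimplex d.+1.
Proof.
have [x_ge0 x_sum1] : stdsimplex d (set_val x) by exact: set_valP.
apply/mem_set; split=> [j|].
  by rewrite mxE; case: unliftP => [j' _|_] //; exact: x_ge0.
rewrite (bigD1_ord i) //= mxE unlift_none add0r -x_sum1.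
by apply: eq_bigr => j _; rewrite mxE liftK.
Qed.

Definition face (d : nat) (i : 'I_d.+2) (x : stdsimplex d) : stdsimplex d.+1 :=
  SigSub (face_subproof i x).

(* The generators are all functions from the standard simplex to X; the
   singular chains of a subset A of X are the chains satisfying [chain_in A]. *)
Definition chain (d : nat) := {freeg (stdsimplex d -> X) / int}.

Definition chain_in (A : set X) (d : nat) (c : chain d) : Prop :=
  forall s : stdsimplex d -> X, s \in dom c ->
    continuous s /\ (forall x, A (s x)).

Definition bd (d : nat) : chain d.+1 -> chain d :=
  fglift (fun s : stdsimplex d.+1 -> X =>
    \sum_(i < d.+2) << (-1) ^+ i *g (s \o face i) >>).

(* Relative cycles, and the relation of being relatively homologous, for the
   pair (A, B) with B a subset of A: the former modulo the latter is
   H_d(A, B; Z). *)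
Definition rel_cycle (A B : set X) (d : nat) : chain d -> Prop :=
  match d with
  | 0 => fun c => chain_in A c
  | d'.+1 => fun c => chain_in A c /\ chain_in B (bd c)
  end.

Definition rel_homologous (A B : set X) (d : nat) (c c' : chain d) : Prop :=
  exists (b : chain d.+1) (a : chain d),
    [/\ chain_in A b, chain_in B a & c - c' = bd b + a].

Definition rel_generator (A B : set X) (d : nat) (c : chain d) : Prop :=
  rel_cycle A B c /\
  forall c', rel_cycle A B c' ->
    exists m : int, rel_homologous A B c' (c *~ m).

(* Additive maps H_d(A, B; Z) -> Z; only the values of f on relative cycles
   matter. *)
Definition rel_cochain (A B : set X) (d : nat) (f : chain d -> int) : Prop :=
  (forall c c', rel_cycle A B c -> rel_cycle A B c' ->
     f (c + c') = f c + f c') /\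
  (forall c c', rel_cycle A B c -> rel_cycle A B c' ->
     rel_homologous A B c c' -> f c = f c').

End SingularChains.

Section Grassmannian.
Variables (R : realType) (k n : nat).

Definition Gr : Type := {V : {vspace 'rV[R]_n} | \dim V == k}.

HB.instance Definition _ := Choice.on Gr.

Definition rowspan (A : 'M[R]_(k, n)) : {vspace 'rV[R]_n} :=
  span [seq row i A | i : 'I_k].

(* The quotient topology from the space of k x n matrices of rank k, itself a
   subspace of the space of all k x n matrices: the matrices A occurring below
   are exactly those of rank k, and O is an open set of matrices whose trace on
   them is the preimage of U. *)
Definition gr_open (U : set Gr) : Prop :=
  exists2 O : set 'M[R]_(k, n), open O &
    forall (A : 'M[R]_(k, n)) (V : Gr), val V = rowspan A -> O A <-> U V.

Lemma gr_openT : gr_open setT.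
Proof. by exists setT => //; exact: openT. Qed.

Lemma gr_openI : setI_closed gr_open.
Proof.
move=> U1 U2 [W1 oW1 h1] [W2 oW2 h2]; exists (W1 `&` W2); first exact: openI.
by move=> A V VA; rewrite /setI /= (h1 _ _ VA) (h2 _ _ VA).
Qed.

Lemma gr_open_bigU (I : Type) (f : I -> set Gr) :
  (forall i, gr_open (f i)) -> gr_open (\bigcup_i f i).
Proof.
move=> hf; pose P i (O : set 'M[R]_(k, n)) := open O /\
  forall (A : 'M[R]_(k, n)) (V : Gr), val V = rowspan A -> O A <-> f i V.
exists (\bigcup_(O in [set O | exists i, P i O]) O).
  by apply: bigcup_open => O [i []].
move=> A V VA; split=> [[W [i [_ hO]] OA]|[i _ fiV]].
  by exists i => //; apply/(hO _ _ VA).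
have [W oW hW] := hf i; exists W; first by exists i; split.
exact/(hW _ _ VA).
Qed.

HB.instance Definition _ :=
  isOpenTopological.Build Gr gr_openT gr_openI gr_open_bigU.

Definition flag (i : nat) : {vspace 'rV[R]_n} :=
  span [seq delta_mx 0 j | j : 'I_n <- enum 'I_n & (j < i)%N].

Definition schubert_cell (w : 'S_n) : set Gr :=
  [set V : Gr |
    [set i : 'I_n | (\dim (val V :&: flag i) < \dim (val V :&: flag i.+1))%N]%SET
    = [set w j | j : 'I_n & (j < k)%N]%SET].

(* The union of the cells of dimension < d, so that the d-skeleton is
   [skel_lt d.+1] and [skel_lt 0] is empty. *)
Definition skel_lt (d : nat) : set Gr :=
  [set V : Gr | exists w : 'S_n,
    [/\ w \in minrep n k, (ell w < d)%N & schubert_cell w V]].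

Local Notation chainGr d := (chain R Gr d).

(* An orientation of the cell e is a generator of H_d(closure e, closure e \ e),
   an infinite cyclic group. *)
Definition cell_orientation (o : forall w : 'S_n, chainGr (ell w)) : Prop :=
  forall w, w \in minrep n k ->
    rel_generator (closure (schubert_cell w))
      (closure (schubert_cell w) `\` schubert_cell w) (o w).

(* The cellular d-cochains form the group Hom(H_d(X^d, X^(d-1)), Z), where X^d
   is the d-skeleton. *)
Definition cellular_cochain (d : nat) (f : chainGr d -> int) : Prop :=
  rel_cochain (skel_lt d.+1) (skel_lt d) f.

Definition eq_cochain (d : nat) (f g : chainGr d -> int) : Prop :=
  forall c, rel_cycle (skel_lt d.+1) (skel_lt d) c -> f c = g c.

Definition coboundary (d : nat) (f : chainGr d -> int) : chainGr d.+1 -> int :=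
  fun c => f (bd c).

(* [sigma w d] is only meaningful for d = ell w; the extra argument makes
   cochains attached to different cells of the same dimension have the same
   type. *)
Definition dual_cochains (o : forall w : 'S_n, chainGr (ell w))
    (sigma : 'S_n -> forall d : nat, chainGr d -> int) : Prop :=
  forall w, w \in minrep n k ->
    cellular_cochain (sigma w (ell w)) /\
    forall w', w' \in minrep n k -> ell w' = ell w ->
      sigma w (ell w') (o w') = (w' == w)%:R.

Definition incidence_numbers
    (sigma : 'S_n -> forall d : nat, chainGr d -> int)
    (inc : 'S_n -> 'S_n -> int) : Prop :=
  forall w, w \in minrep n k ->
    eq_cochain (coboundary (sigma w (ell w)))
      (fun c => \sum_(w' in minrep n k | ell w' == (ell w).+1)
                  inc w w' * sigma w' (ell w).+1 c).

Definition incidence_graph (inc : 'S_n -> 'S_n -> int) (w w' : 'S_n) : Prop :=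
  [/\ w \in minrep n k, w' \in minrep n k, ell w' = (ell w).+1 &
      inc w w' = 2 \/ inc w w' = - 2].

End Grassmannian.

(* Main.v *)
(** A reduced word i_1 ... i_d of a minimal representative w gives a cube map
    Phi(t_1, ..., t_d) = g_{i_1}(t_1) ... g_{i_d}(t_d) <e_1, ..., e_k>, where
    g_i(t) is a rotation in the plane (e_i, e_{i+1}) running from 1 to -1. It maps
    the open cube bijectively to the cell of w, so its closure is the image of the
    closed cube and Phi is a relative cycle. On a face t_j = 0 or t_j = 1 the
    letter i_j disappears: g is 1, or a sign change, which moves to the right by
    flipping t_l to 1 - t_l for some later letters. The faces with j > 1 do not
    see the cell of s_{i_1} w, while the faces t_1 = 0 and t_1 = 1 both cover it and
    their difference is 1 - (-1)^f up to sign, f being the number of flips. Counting flips as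
    pairs gives f = i + k - 1 mod 2 (i counted from 0), which is odd exactly
    when the box added to the Young diagram contains a 1.

    It remains to see that Phi generates the homology of its cell up to sign. The
    given generator o satisfies Phi ~ m o for some m, so it suffices to find an
    integral functional with value 1 on Phi which vanishes on boundaries and
    on the boundary of the cell. Colour the cell as in Sperner's lemma and
    count rainbow simplices with sign after N barycentric subdivisions: for N
    large no simplex of a boundary meets all colours, by Lebesgue's number, so that
    the count vanishes there, and on the cube it is 1 by induction on the dimension. *)

From HB Require Import structures.
Require Import Defs.
From mathcomp Require Import all_boot all_order all_algebra all_fingroup.
From mathcomp Require Import all_classical all_reals all_analysis.
From mathcomp Require Import freeg ring lra zify.

Set Implicit Arguments.
Unset Strict Implicit.
Unset Printing Implicit Defensive.

Import Order.TTheory GRing.Theory Num.Theory.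
Import numFieldNormedType.Exports.

Local Open Scope classical_set_scope.
Local Open Scope ring_scope.

(** Cochains are evaluated on cubes only. A cube mapped into one closed cell, with its boundary in
    the boundary of that cell, is homologous to a multiple of the given generator, and duality fixes
    the value of [sigma] there. The geometry is controlled by the sum of the pivots: up to a
    constant it is the dimension of the cell, a letter raises it by at most one, and a letter with
    parameter 0 or 1 leaves it fixed. Hence proper faces, and whole cubes of words that are not
    reduced, fall into lower skeleta. If w' = s_i w, the word of w' is i followed by a word of w.
    Otherwise any reduced word serves, since a face covering the cell of w would make the two
    diagrams differ by one box. The sign (-1)^f appears because a relative cochain changes sign when
    one coordinate of a cube is reversed. The colours 0, ..., d live on a core strictly inside the
    cell and everything else has the uncounted colour d + 1: near the boundary of the cell [Phi] is
    not injective, so no colouring by cube coordinates could descend there. *)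

(** * Free abelian groups and supports of chains *)

Section FreeGroup.
Variables (K : choiceType).
Implicit Types (c : {freeg K / int}) (s : K).

Lemma fgliftB (M : lmodType int) (f : K -> M) c c' :
  fglift f (c - c') = fglift f c - fglift f c'.
Proof. exact: lift_is_additive. Qed.

Lemma fglift0 (M : lmodType int) (f : K -> M) : fglift f 0 = 0.
Proof. by rewrite -[X in fglift f X](subrr 0) fgliftB subrr. Qed.

Lemma fgliftN (M : lmodType int) (f : K -> M) c : fglift f (- c) = - fglift f c.
Proof. by rewrite -sub0r fgliftB fglift0 sub0r. Qed.

Lemma fgliftD (M : lmodType int) (f : K -> M) c c' :
  fglift f (c + c') = fglift f c + fglift f c'.
Proof. by rewrite -[in LHS](opprK c') fgliftB fgliftN opprK. Qed.

Lemma fgliftU (M : lmodType int) (f : K -> M) s : fglift f << s >> = f s.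
Proof. by rewrite liftU scale1r. Qed.

Lemma fglift_sum (M : lmodType int) (f : K -> M) (I : Type) (r : seq I)
    (P : pred I) (F : I -> {freeg K / int}) :
  fglift f (\sum_(i <- r | P i) F i) = \sum_(i <- r | P i) fglift f (F i).
Proof. exact: (big_morph _ (fgliftD f) (fglift0 f)). Qed.

Lemma freegU_mulrz (k : int) s : << k *g s >> = << s >> *~ k :> {freeg K / int}.
Proof. by rewrite freegU_mulz intz. Qed.

Lemma fglift_mulz (M : lmodType int) (f : K -> M) c m :
  fglift f (c *~ m) = fglift f c *~ m.
Proof.
case: m => n; rewrite /intmul.
  by elim: n => [|n IH]; rewrite ?mulr0n ?fglift0// !mulrS fgliftD IH.
rewrite fgliftN; congr (- _).
by elim: n.+1 => [|m IH]; rewrite ?mulr0n ?fglift0// !mulrS fgliftD IH.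
Qed.

Lemma fgliftE (M : lmodType int) (f : K -> M) c :
  fglift f c = \sum_(s <- dom c) f s *~ coeff s c.
Proof.
rewrite -{1}(freeg_sumE c) fglift_sum; apply: eq_bigr => s _.
by rewrite freegU_mulrz fglift_mulz fgliftU.
Qed.

(** Turns a composite of additive operations into a lift, so that two of them can be compared on
    generators. *)
Lemma fglift_additiveE (M : lmodType int) (h : {freeg K / int} -> M) c :
  (forall c c', h (c - c') = h c - h c') -> h c = fglift (fun s => h << s >>) c.
Proof.
move=> hB; have h0 : h 0 = 0 by rewrite -(subrr 0) hB subrr.
have hN d : h (- d) = - h d by rewrite -sub0r hB h0 sub0r.
have hD d d' : h (d + d') = h d + h d' by rewrite -{1}[d']opprK hB hN opprK.
rewrite fgliftE -{1}(freeg_sumE c) (big_morph _ hD h0).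
apply: eq_bigr => s _; rewrite freegU_mulrz.
have hn d n : h (d *+ n) = h d *+ n.
  by elim: n => [|n IH]; rewrite ?mulr0n// !mulrS hD IH.
by case: (coeff s c) => n; rewrite /intmul ?hN hn.
Qed.

(** Dimension, position of the vertices, mesh and [chain_in] are all conditions of this shape, which
    lifts transport by [supp_lift]. *)
Definition supp (Q : K -> Prop) c := forall s, s \in dom c -> Q s.

Lemma suppS (Q Q' : K -> Prop) c : (forall s, Q s -> Q' s) -> supp Q c -> supp Q' c.
Proof. by move=> H h s /h/H. Qed.

Lemma supp0 Q : supp Q 0. Proof. by move=> s; rewrite dom0 in_nil. Qed.

Lemma suppN Q c : supp Q c -> supp Q (- c).
Proof. by move=> h s; rewrite domN; apply: h. Qed.

Lemma suppD Q c c' : supp Q c -> supp Q c' -> supp Q (c + c').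
Proof. by move=> h h' s /domD_subset; rewrite mem_cat => /orP[/h|/h']. Qed.

Lemma suppB Q c c' : supp Q c -> supp Q c' -> supp Q (c - c').
Proof. by move=> h h'; apply: suppD => //; apply: suppN. Qed.

Lemma supp_mulz Q c m : supp Q c -> supp Q (c *~ m).
Proof.
move=> h; have hn n : supp Q (c *+ n).
  by elim: n => [|n IH]; [rewrite mulr0n; apply: supp0|rewrite mulrS; apply: suppD].
by case: m => n; rewrite /intmul; [exact: hn|apply: suppN; exact: hn].
Qed.

Lemma suppU (Q : K -> Prop) s : Q s -> supp Q << s >>.
Proof. by move=> h s'; rewrite domU1 inE => /eqP->. Qed.

Lemma supp_sum Q (I : Type) (r : seq I) (P : pred I) (F : I -> {freeg K / int}) :
  (forall i, P i -> supp Q (F i)) -> supp Q (\sum_(i <- r | P i) F i).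
Proof. by move=> h; apply: (big_ind (supp Q)) => //; [exact: supp0|exact: suppD]. Qed.

End FreeGroup.

Lemma supp_lift (K K' : choiceType) (Q : K -> Prop) (Q' : K' -> Prop)
    (f : K -> {freeg K' / int}) c :
  (forall s, Q s -> supp Q' (f s)) -> supp Q c -> supp Q' (fglift f c).
Proof.
move=> h hc; rewrite fgliftE big_seq.
by apply: supp_sum => s /hc/h; apply: supp_mulz.
Qed.

Lemma fglift_supp (K : choiceType) (M : lmodType int) (Q : K -> Prop) (f g : K -> M) c :
  (forall s, Q s -> f s = g s) -> supp Q c -> fglift f c = fglift g c.
Proof.
by move=> h hc; rewrite !fgliftE !big_seq; apply: eq_bigr => s /hc/h ->.
Qed.

Lemma fglift_ext (K : choiceType) (M : lmodType int) (f g : K -> M) c :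
  f =1 g -> fglift f c = fglift g c.
Proof. by move=> /funext ->. Qed.

Lemma fglift_comp (K K' : choiceType) (M : lmodType int) (f : K -> {freeg K' / int})
    (g : K' -> M) c : fglift g (fglift f c) = fglift (fun s => fglift g (f s)) c.
Proof.
rewrite [LHS](@fglift_additiveE _ M (fun c => fglift g (fglift f c))); last first.
  by move=> d d'; rewrite !fgliftB.
by apply: fglift_ext => s /=; rewrite fgliftU.
Qed.

Lemma fglift_id (K : choiceType) (c : {freeg K / int}) : fglift (fun s => << s >>) c = c.
Proof. by symmetry; apply: (@fglift_additiveE _ _ id). Qed.

Lemma fglift_opB (K : choiceType) (M : lmodType int) (f g : K -> M) c :
  fglift (fun s => f s - g s) c = fglift f c - fglift g c.
Proof. by rewrite !fgliftE -sumrB; apply: eq_bigr => s _; rewrite mulrzBl. Qed.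

Lemma fglift_cst0 (K : choiceType) (M : lmodType int) c : fglift (fun _ : K => 0 : M) c = 0.
Proof. by rewrite fgliftE big1 // => s _; rewrite mul0rz. Qed.

(** * Linear chains *)

Section LinearChains.
Variable V : choiceType.
Local Notation lc := {freeg (seq V) / int}.
Implicit Types (s : seq V) (c : lc) (v b : V).

Definition cone v c : lc := fglift (fun s => << v :: s >> : lc) c.

(* [dl] is the augmented boundary: a vertex is mapped to the empty sequence,
   so that the cone formula [dl_cone] has no exception in degree 0. *)
Fixpoint dseq s : lc := if s is v :: s' then << s' >> - cone v (dseq s') else 0.

Definition dl c : lc := fglift dseq c.

Lemma coneB v c c' : cone v (c - c') = cone v c - cone v c'.
Proof. exact: fgliftB. Qed.
Lemma coneU v s : cone v << s >> = << v :: s >>.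
Proof. exact: fgliftU. Qed.
Lemma cone0 v : cone v 0 = 0.
Proof. exact: fglift0. Qed.
Lemma dlB c c' : dl (c - c') = dl c - dl c'.
Proof. exact: fgliftB. Qed.
Lemma dlU s : dl << s >> = dseq s.
Proof. exact: fgliftU. Qed.

Lemma dl_cone v c : dl (cone v c) = c - cone v (dl c).
Proof.
rewrite /dl /cone fglift_comp.
transitivity (fglift (fun s => << s >> - cone v (dseq s)) c).
  by apply: fglift_ext => s; rewrite fgliftU.
by rewrite fglift_opB fglift_id fglift_comp.
Qed.

Lemma dl_dseq s : dl (dseq s) = 0.
Proof.
elim: s => [|v s IH]; first by rewrite /= /dl fglift0.
by rewrite /= dlB dlU dl_cone IH cone0 subr0 subrr.
Qed.

Definition hom m c := supp (fun s => size s = m) c.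

Lemma hom_cone m v c : hom m c -> hom m.+1 (cone v c).
Proof. by apply: supp_lift => s <-; apply: suppU. Qed.

Lemma hom_dseq s : hom (size s).-1 (dseq s).
Proof.
elim: s => [|v s IH] /=; first exact: supp0.
apply: suppB; first exact: suppU.
case: s IH => [_|w s /= IH]; first by rewrite /= cone0; apply: supp0.
exact: (@hom_cone (size s) v _ IH).
Qed.

Definition delat i s := take i s ++ drop i.+1 s.

(** The recursion in [dseq] suits inductions through cones; the alternating sum is what matches the
    singular boundary [bd]. *)
Lemma dseqE s : dseq s = \sum_(i < size s) << (-1) ^+ i *g delat i s >>.
Proof.
elim: s => [|v s IH]; first by rewrite big_ord0.
rewrite /= big_ord_recl /= /delat /= drop0 expr0; congr (_ + _).
rewrite IH /cone fglift_sum -sumrN; apply: eq_bigr => i _.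
rewrite liftU exprS mulN1r -freegUN [in RHS]freegU_mulrz.
by rewrite -[X in X *: _]intz scaler_int.
Qed.

Variable bar : seq V -> V.

(** Barycentric subdivision: the cone from the barycentre over the subdivided boundary. The fuel [m]
    is needed because the faces of [s] are not subterms; [sd] supplies the length, and [sdU] is the
    recursion without fuel. *)
Fixpoint sdn m s : lc :=
  if m is m'.+1 then cone (bar s) (fglift (sdn m') (dseq s)) else << s >>.

Definition sd c := fglift (fun s => sdn (size s) s) c.

(* [td] is the chain homotopy between [sd] and the identity. *)
Fixpoint tdn m s : lc :=
  if m is m'.+1 then cone (bar s) (<< s >> - fglift (tdn m') (dseq s)) else 0.

Definition td c := fglift (fun s => tdn (size s) s) c.

Lemma sdU s : sd << s >> = if s is [::] then << s >> else cone (bar s) (sd (dseq s)).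
Proof.
rewrite /sd fgliftU; case: s => [//|v s] /=; congr cone.
by apply: fglift_supp (@hom_dseq (v :: s)) => s' /= ->.
Qed.

Lemma tdU s : td << s >> = if s is [::] then 0 else cone (bar s) (<< s >> - td (dseq s)).
Proof.
rewrite /td fgliftU; case: s => [//|v s] /=; congr cone; congr (_ - _).
by apply: fglift_supp (@hom_dseq (v :: s)) => s' /= ->.
Qed.

Lemma sdB c c' : sd (c - c') = sd c - sd c'.
Proof. exact: fgliftB. Qed.
Lemma tdB c c' : td (c - c') = td c - td c'.
Proof. exact: fgliftB. Qed.

Lemma lc_ext (M : lmodType int) (f g : lc -> M) c :
  (forall c c', f (c - c') = f c - f c') -> (forall c c', g (c - c') = g c - g c') ->
  (forall s, f << s >> = g << s >>) -> f c = g c.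
Proof.
move=> fB gB fg; rewrite (fglift_additiveE c fB) (fglift_additiveE c gB).
exact: fglift_ext.
Qed.

(** Induction on the dimension for identities between additive maps: the faces of a simplex have one
    vertex fewer, so the identity may be assumed on its boundary. *)
Lemma lc_ind (M : lmodType int) (f g : lc -> M) c :
  (forall c c', f (c - c') = f c - f c') -> (forall c c', g (c - c') = g c - g c') ->
  f << [::] >> = g << [::] >> ->
  (forall v s, f (dseq (v :: s)) = g (dseq (v :: s)) -> f << v :: s >> = g << v :: s >>) ->
  f c = g c.
Proof.
move=> fB gB fg0 fgS.
have main m d : hom m d -> f d = g d.
  elim: m d => [|m IH] d hd; rewrite (fglift_additiveE d fB) (fglift_additiveE d gB);
    apply: fglift_supp hd => -[|v s] //= [es].
  by apply/fgS/IH; have := @hom_dseq (v :: s); rewrite /= es.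
by apply: lc_ext => // s; apply: (main (size s)); exact: suppU.
Qed.

Lemma hom_sd m c : hom m c -> hom m (sd c).
Proof.
elim: m c => [|m IH] c; apply: supp_lift => s es; rewrite es; first exact: suppU.
rewrite /=; apply: hom_cone; have := hom_dseq (s := s); rewrite es /= => h.
have -> : fglift (sdn m) (dseq s) = sd (dseq s).
  by apply: (@fglift_supp _ _ _ _ _ _ _ h) => s' /= ->.
exact: IH.
Qed.

Lemma dl_sd c : dl (sd c) = sd (dl c).
Proof.
apply: (@lc_ind _ (fun c => dl (sd c)) (fun c => sd (dl c))) => [d d'|d d'||v s IH].
- by rewrite sdB dlB.
- by rewrite dlB sdB.
- by rewrite sdU /dl fgliftU /= /sd fglift0.
- by rewrite sdU dl_cone IH dl_dseq /sd fglift0 cone0 subr0 dlU.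
Qed.

Lemma dl_td c : dl (td c) + td (dl c) = c - sd c.
Proof.
apply: (@lc_ind _ (fun c => dl (td c) + td (dl c)) (fun c => c - sd c))
  => [d d'|d d'||v s].
- by rewrite tdB !dlB tdB addrACA opprD.
- by rewrite sdB !opprB addrACA [RHS]addrACA [- d' + _]addrC.
- by rewrite sdU tdU /dl fglift0 fgliftU /= /td fglift0 addr0 subrr.
rewrite dlU tdU sdU; set s' := v :: s.
rewrite -/(dl _) dl_dseq {2}/td fglift0 addr0 => E.
by rewrite dl_cone dlB dlU E subKr addrAC subrK.
Qed.

End LinearChains.

(** * Induced maps, prisms and the triangulated cube *)

Section Maps.
Variables V W : choiceType.
Local Notation lc V := {freeg (seq V) / int}.
Variables f i0 i1 : V -> W.

Definition lmap (c : lc V) : lc W := fglift (fun s => << map f s >> : lc W) c.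

Lemma lmapB c c' : lmap (c - c') = lmap c - lmap c'. Proof. exact: fgliftB. Qed.
Lemma lmapU s : lmap << s >> = << map f s >>. Proof. exact: fgliftU. Qed.

Lemma lmap_cone v c : lmap (cone v c) = cone (f v) (lmap c).
Proof.
rewrite /lmap /cone !fglift_comp; apply: fglift_ext => s.
by rewrite !fgliftU.
Qed.

Lemma dl_lmap c : dl (lmap c) = lmap (dl c).
Proof.
apply: (@lc_ext _ _ (fun c => dl (lmap c)) (fun c => lmap (dl c)))
  => [d d'|d d'|]; [by rewrite lmapB dlB|by rewrite dlB lmapB|].
elim=> [|v s IH]; first by rewrite lmapU /dl !fgliftU /lmap fglift0.
rewrite -coneU lmap_cone !dl_cone lmapB lmap_cone; congr (_ - _).
by rewrite IH.
Qed.

Lemma sd_lmap (bV : seq V -> V) (bW : seq W -> W) c :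
  (forall s, s != [::] -> bW (map f s) = f (bV s)) ->
  sd bW (lmap c) = lmap (sd bV c).
Proof.
move=> fb.
apply: (@lc_ind _ _ (fun c => sd bW (lmap c)) (fun c => lmap (sd bV c)))
  => [d d'|d d'||v s IH].
- by rewrite lmapB sdB.
- by rewrite sdB lmapB.
- by rewrite !(lmapU, sdU).
rewrite lmapU !sdU lmap_cone -IH -fb //.
by rewrite -[in RHS]dlU -dl_lmap lmapU dlU.
Qed.

(** The prism operator, the alternating sum of [i0 v_0, ..., i0 v_j, i1 v_j, ..., i1 v_m], unrolled
    from the left. *)
Fixpoint prseq s : lc W :=
  if s is v :: s' then << i0 v :: i1 v :: map i1 s' >> - cone (i0 v) (prseq s') else 0.

Definition prism (c : lc V) : lc W := fglift prseq c.

Lemma prismB c c' : prism (c - c') = prism c - prism c'. Proof. exact: fgliftB. Qed.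
Lemma prismU s : prism << s >> = prseq s. Proof. exact: fgliftU. Qed.

End Maps.

Lemma zmodB3 (M : zmodType) (a a' b b' c c' : M) :
  a - a' - (b - b') - (c - c') = a - b - c - (a' - b' - c').
Proof. by rewrite !opprB !addrA [LHS](AC 6 (1*4*6*5*3*2))/=. Qed.

Section Prism.
Variables V W : choiceType.
Local Notation lc V := {freeg (seq V) / int}.

Lemma prism_cone (i0 i1 : V -> W) v c : prism i0 i1 (cone v c) =
  cone (i0 v) (cone (i1 v) (lmap i1 c)) - cone (i0 v) (prism i0 i1 c).
Proof.
rewrite /prism /cone /lmap !fglift_comp -fglift_opB.
by apply: fglift_ext => s; rewrite !fgliftU /=.
Qed.

Lemma dl_prism (i0 i1 : V -> W) c :
  dl (prism i0 i1 c) = lmap i1 c - lmap i0 c - prism i0 i1 (dl c).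
Proof.
apply: (@lc_ext _ _ (fun c => dl (prism i0 i1 c))
   (fun c => lmap i1 c - lmap i0 c - prism i0 i1 (dl c)))
  => [d d'|d d'|]; [by rewrite prismB dlB| |].
  by rewrite dlB prismB !lmapB zmodB3.
elim=> [|v s IH].
  by rewrite prismU !lmapU dlU /= /dl /prism !fglift0 !subrr ?subr0.
have {}IH : dl (prism i0 i1 << s >>) = lmap i1 << s >> - lmap i0 << s >> - prism i0 i1 (dl << s >>) := IH.
rewrite -coneU prism_cone !lmap_cone dlB !dl_cone dl_lmap IH prismB prism_cone !coneB.
move: (lmap i1 << s >>) (lmap i0 << s >>) (prism i0 i1 << s >>) => A B C.
set E := cone _ (cone _ (lmap _ _)); set F := cone (i0 v) (prism _ _ _).
by rewrite !opprB !addrA [LHS](AC 7 (1*5*2*6*7*(3*4)))/= addNr addr0.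
Qed.

End Prism.

Lemma prism_lmap (V V' W W' : choiceType) (i0 i1 : V -> W) (j0 j1 : V' -> W')
    (f : V -> V') (g : W -> W') c :
  (forall v, g (i0 v) = j0 (f v)) -> (forall v, g (i1 v) = j1 (f v)) ->
  lmap g (prism i0 i1 c) = prism j0 j1 (lmap f c).
Proof.
move=> h0 h1.
apply: (@lc_ext _ _ (fun c => lmap g (prism i0 i1 c)) (fun c => prism j0 j1 (lmap f c)))
  => [d d'|d d'|]; [by rewrite prismB lmapB|by rewrite lmapB prismB|].
elim=> [|v s IH]; first by rewrite lmapU !prismU /lmap fglift0.
rewrite lmapU !prismU /= lmapB lmapU lmap_cone /= !h0 h1; congr (<< _ >> - cone _ _).
  by congr [:: _, _ & _]; rewrite -!map_comp; apply: eq_map => x /=.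
by have := IH; rewrite lmapU !prismU.
Qed.

Section Cube.
Variable R : realType.
Notation pt := (nat -> R).

(** Points of all dimensions share the type [nat -> R], which avoids casts. With e = 0 or 1 this is
    the inclusion of a face of the cube; with e = 0 it is also that of a face of the standard
    simplex. *)
Definition ins (j : nat) (e : R) (v : pt) : pt :=
  fun i => if (i < j)%N then v i else if i == j then e else v i.-1.

(** The Kuhn triangulation of the cube, as an iterated prism in the first coordinate; its boundary
    then comes from [dl_prism]. *)
Fixpoint kuhn (d : nat) : {freeg (seq pt) / int} :=
  if d is d'.+1 then prism (ins 0 0) (ins 0 1) (kuhn d') else << [:: fun=> 0] >>.

Lemma insS j e e' v : ins j.+1 e (ins 0 e' v) = ins 0 e' (ins j e v).
Proof.
apply/funext => -[|i]; rewrite /ins //= ltnS eqSS.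
by case: (ltngtP i j) => //; case: i.
Qed.

Lemma kuhnS d : kuhn d.+1 = prism (ins 0 0) (ins 0 1) (kuhn d).
Proof. by []. Qed.

(** The two ends of the prism are the faces in direction 0. The prism over a face in direction j is
    the face in direction j + 1, by [insS], and the minus sign in [dl_prism] shifts the sign
    accordingly. *)
Lemma dl_kuhn d : dl (kuhn d.+1) =
  \sum_(j < d.+1) (lmap (ins j 1) (kuhn d) - lmap (ins j 0) (kuhn d)) *~ (-1) ^+ j.
Proof.
elim: d => [|d IH].
  rewrite big_ord1 expr0 /= dl_prism dlU /= /prism.
  by rewrite cone0 subr0 fgliftU /= subr0.
rewrite kuhnS dl_prism big_ord_recl expr0 IH; congr (_ + _).
rewrite /prism fglift_sum -sumrN; apply: eq_bigr => j _.
rewrite fglift_mulz fgliftB exprS mulN1r mulrNz; congr (- (_ *~ _)).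
by congr (_ - _); rewrite kuhnS; symmetry; apply: prism_lmap => v; exact: insS.
Qed.

Lemma hom_prseq (V W : choiceType) (i0 i1 : V -> W) s :
  supp (fun s' => size s' = (size s).+1) (prseq i0 i1 s).
Proof.
elim: s => [|v s IH] /=; first exact: supp0.
by apply: suppB; [apply: suppU; rewrite /= size_map|exact: hom_cone].
Qed.

Lemma hom_kuhn d : hom d.+1 (kuhn d).
Proof.
elim: d => [|d IH]; first exact: suppU.
by apply: supp_lift IH => s es; have := @hom_prseq _ _ (ins 0 0) (ins 0 1) s; rewrite es.
Qed.

End Cube.

Definition allin (V : choiceType) (Q : V -> Prop) (c : {freeg (seq V) / int}) :=
  supp (fun s : seq V => forall v, v \in s -> Q v) c.

Section AllIn.
Variables (V W : choiceType).
Implicit Types (c : {freeg (seq V) / int}).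

Lemma allin_cone (Q : V -> Prop) v c : Q v -> allin Q c -> allin Q (cone v c).
Proof.
move=> Qv; apply: supp_lift => s Qs; apply: suppU => x.
by rewrite inE => /orP[/eqP->|/Qs].
Qed.

End AllIn.

Section AllInMaps.
Variables (V W : choiceType).
Implicit Types (c : {freeg (seq V) / int}).

Lemma allin_dseq (Q : V -> Prop) s : (forall v, v \in s -> Q v) -> allin Q (dseq s).
Proof.
elim: s => [|v s IH] Qs /=; first exact: supp0.
have Qs' x : x \in s -> Q x by move=> xs; apply: Qs; rewrite inE xs orbT.
apply: suppB; first exact: suppU.
by apply: (@allin_cone _ Q); [apply: Qs; rewrite mem_head|exact: IH].
Qed.

Lemma allin_lmap (Q : V -> Prop) (Q' : W -> Prop) (f : V -> W) c :
  (forall v, Q v -> Q' (f v)) -> allin Q c -> allin Q' (lmap f c).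
Proof.
by move=> h; apply: supp_lift => s Qs; apply: suppU => _ /mapP[v /Qs/h ? ->].
Qed.

Lemma allin_prism (Q : V -> Prop) (Q' : W -> Prop) (i0 i1 : V -> W) c :
  (forall v, Q v -> Q' (i0 v)) -> (forall v, Q v -> Q' (i1 v)) ->
  allin Q c -> allin Q' (prism i0 i1 c).
Proof.
move=> h0 h1; apply: supp_lift; elim=> [|v s IH] Qs /=; first exact: supp0.
have Qs' x : x \in s -> Q x by move=> xs; apply: Qs; rewrite inE xs orbT.
have Qv : Q v by apply: Qs; rewrite mem_head.
apply: suppB; last by apply: (@allin_cone _ Q'); [exact: h0|exact: IH].
apply: suppU => x; rewrite 2!inE => /orP[/eqP->|/orP[/eqP->|/mapP[y /Qs' ? ->]]].
- exact: h0.
- exact: h1.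
- exact: h1.
Qed.

Variables (Q : V -> Prop) (bar : seq V -> V).
Hypothesis Qbar : forall s, s != [::] -> (forall v, v \in s -> Q v) -> Q (bar s).

(** Both operators create only barycentres as new vertices. *)
Lemma allin_sdtd c : allin Q c -> allin Q (sd bar c) /\ allin Q (td bar c).
Proof.
suff main (s : seq V) : (forall v, v \in s -> Q v) -> allin Q (sd bar << s >>) /\ allin Q (td bar << s >>).
  by move=> Qc; split; apply: (supp_lift _ Qc) => s /main[]; rewrite /sd /td !fgliftU.
elim: {s}(size s) {-2}s (erefl (size s)) => [|n IH] s es Qs.
  by move/size0nil: es => ->; rewrite sdU tdU; split; [exact: suppU|exact: supp0].
have Qd : allin Q (dseq s) by exact: allin_dseq.
have hd : hom n (dseq s) by have := @hom_dseq _ s; rewrite es.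
have [Qsd Qtd] : allin Q (sd bar (dseq s)) /\ allin Q (td bar (dseq s)).
  have Qhd : supp (fun s : seq V => size s = n /\ forall v, v \in s -> Q v) (dseq s).
    by move=> x xs; split; [exact: hd|exact: Qd].
  by split; apply: (supp_lift _ Qhd) => x [ex Qx];
    have [] := IH x ex Qx; rewrite /sd /td !fgliftU.
rewrite sdU tdU; case: s es Qs Qd hd Qsd Qtd => // v s es Qs Qd hd Qsd Qtd.
split; apply: allin_cone => //; [exact: Qbar|exact: Qbar|].
by apply: suppB => //; exact: suppU.
Qed.

End AllInMaps.

(** * Mesh of iterated subdivisions *)

Section Mesh.
Variable R : realType.
Notation pt := (nat -> R).

Definition bar (s : seq pt) : pt := fun i => (\sum_(v <- s) v i) / (size s)%:R.

(** Convexity tested on barycentres with equal weights, the only combinations produced by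
    subdivision. *)
Definition cvx (Q : pt -> Prop) :=
  forall s : seq pt, s != [::] -> (forall v, v \in s -> Q v) -> Q (bar s).

Lemma cvxI (Q Q' : pt -> Prop) : cvx Q -> cvx Q' -> cvx (fun v => Q v /\ Q' v).
Proof.
by move=> h h' s s0 Qs; split; [apply: h|apply: h'] => // v /Qs[].
Qed.

Lemma cvx_forall (I : Type) (D : I -> Prop) (Q : I -> pt -> Prop) :
  (forall j, D j -> cvx (Q j)) -> cvx (fun v => forall j, D j -> Q j v).
Proof. by move=> h s s0 Qs j Dj; apply: h => // v /Qs; apply. Qed.

Lemma size_gt0R (s : seq pt) : s != [::] -> 0 < (size s)%:R :> R.
Proof. by case: s => // v s _; rewrite ltr0n. Qed.

Lemma cvx_le i r : cvx (fun v => v i <= r).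
Proof.
move=> s s0 h; rewrite /bar ler_pdivrMr ?size_gt0R//.
rewrite -sum1_size natr_sum mulr_sumr big_seq [leRHS]big_seq.
by apply: ler_sum => v /h; rewrite mulr1.
Qed.

Lemma cvx_ge i r : cvx (fun v => r <= v i).
Proof.
move=> s s0 h; rewrite /bar ler_pdivlMr ?size_gt0R//.
rewrite -sum1_size natr_sum mulr_sumr big_seq [leRHS]big_seq.
by apply: ler_sum => v /h; rewrite mulr1.
Qed.

Lemma cvx_sum1 d : cvx (fun v => \sum_(i < d) v i = 1).
Proof.
move=> s s0 h; rewrite /bar -mulr_suml exchange_big /= big_seq.
rewrite (eq_bigr (fun=> 1)); last by move=> v /h.
by rewrite -big_seq big_const_seq count_predT iter_addr_0 mulfV // gt_eqF ?size_gt0R.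
Qed.

Lemma cvx_near i (r : R) (v0 : pt) : cvx (fun v => `|v0 i - v i| <= r).
Proof.
move=> s s0 h; rewrite ler_norml; apply/andP; split.
- have : v0 i + r >= bar s i.
    by apply: cvx_le => // v /h; rewrite ler_norml => /andP[? ?]; lra.
  lra.
- have : v0 i - r <= bar s i.
    by apply: cvx_ge => // v /h; rewrite ler_norml => /andP[? ?]; lra.
  lra.
Qed.

Lemma bar_map_linear (f : pt -> pt) (s : seq pt) :
  (forall u v i, f (fun j => u j + v j) i = f u i + f v i) ->
  (forall (a : R) v i, f (fun j => v j * a) i = f v i * a) ->
  bar (map f s) = f (bar s).
Proof.
move=> fD fM; apply/funext => i; rewrite /bar fM size_map big_map; congr (_ / _).
elim: s => [|v s IH].
  have f0 : f (fun=> 0 * 0) i = 0 by rewrite fM mulr0.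
  rewrite big_nil -[LHS]f0.
  congr (f _ i).
  by apply/funext => j; rewrite big_nil mulr0.
rewrite big_cons IH -fD; congr (f _ i); apply/funext => j.
by rewrite big_cons.
Qed.

Lemma bar_ins (j : nat) (s : seq pt) : bar (map (ins j 0) s) = ins j 0 (bar s).
Proof.
apply: bar_map_linear => [u v|a v] i; rewrite /ins;
  by case: ifP => // _; case: ifP => // _; rewrite ?addr0 ?mul0r.
Qed.

Definition lin (d : nat) (p : seq pt) (v : pt) : pt :=
  fun i => \sum_(a < d) v a * (nth (fun=> 0) p a : pt) i.

Lemma bar_lin d p (s : seq pt) : bar (map (lin d p) s) = lin d p (bar s).
Proof.
apply: bar_map_linear => [u v|a v] i; rewrite /lin.
  by rewrite -big_split /=; apply: eq_bigr => j _; rewrite mulrDl.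
by rewrite mulr_suml; apply: eq_bigr => j _; rewrite mulrAC.
Qed.

Definition mesh_le (r : R) (s : seq pt) :=
  forall v v' : pt, v \in s -> v' \in s -> forall i, `|v i - v' i| <= r.

(** In the mean of the differences w i - v i the term of [v] itself vanishes. For m + 1 points this
    leaves the factor m / (m + 1), which increases with m. *)
Lemma mesh_le_bar D r (s : seq pt) (v : pt) i : 0 <= r -> (size s <= D.+1)%N ->
  mesh_le r s -> v \in s -> `|bar s i - v i| <= D%:R / D.+1%:R * r.
Proof.
move=> r0 sD fs vs; have s0 : s != [::] by case: s vs {sD fs}.
have ns := size_gt0R s0.
have -> : bar s i - v i = (\sum_(w <- s) (w i - v i)) / (size s)%:R.
  rewrite sumrB mulrBl; congr (_ - _).
  by rewrite big_const_seq count_predT iter_addr_0 -[_ *+ _]mulr_natr mulfK ?gt_eqF.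
have : `|\sum_(w <- s) (w i - v i)| <= (size s).-1%:R * r.
  rewrite (perm_big _ (perm_to_rem vs)) big_cons /= subrr add0r.
  rewrite -(size_rem vs) -sum1_size natr_sum mulr_suml.
  apply: (le_trans (ler_norm_sum _ _ _)); rewrite big_seq [leRHS]big_seq.
  by apply: ler_sum => w /mem_rem ws; rewrite mul1r; exact: fs.
rewrite normrM normfV normr_nat ler_pdivrMr // => /le_trans; apply.
rewrite mulrAC; apply: ler_wpM2r => //.
have [m es] : exists m, size s = m.+1 by case: (s) s0 => // ? t _; exists (size t).
rewrite es in sD *; rewrite /= ltnS in sD *.
rewrite mulrAC ler_pdivlMr ?ltr0n// -!natrM ler_nat; lia.
Qed.

(** Two vertices on the subdivided boundary are close by induction. The apex is close to the
    vertices of [s] by [mesh_le_bar], hence to all their barycentres. [D] only bounds the dimension,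
    so that one factor serves throughout the induction. *)
Lemma mesh_le_sdseq D r (s : seq pt) : 0 <= r -> (size s <= D.+1)%N ->
  mesh_le r s -> supp (mesh_le (D%:R / D.+1%:R * r)) (sd bar << s >>).
Proof.
move=> r0; elim: {s}(size s) {-2}s (erefl (size s)) => [|n IH] s es sD fs.
  by move/size0nil: es => ->; rewrite sdU; apply: suppU.
have hd : hom n (dseq s) by have := @hom_dseq _ s; rewrite es.
have sub : allin (fun v => v \in s) (dseq s) by exact: allin_dseq.
have Qhd : supp (fun s' : seq pt => size s' = n /\ mesh_le r s') (dseq s).
  move=> x xs; split; first exact: hd.
  by move=> v v' /(sub _ xs) vs /(sub _ xs) vs'; apply: fs.
have F : supp (mesh_le (D%:R / D.+1%:R * r)) (sd bar (dseq s)).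
  apply: (supp_lift _ Qhd) => x [ex fx].
  have := IH x ex _ fx; rewrite /sd fgliftU ex; apply.
  by rewrite ltnW// -es.
pose Q v := forall i, True -> `|bar s i - v i| <= D%:R / D.+1%:R * r.
have cQ : cvx Q by apply: cvx_forall => i _; exact: cvx_near.
have N : allin Q (sd bar (dseq s)).
  have S : allin Q (dseq s) by apply: suppS sub => s' h v /h vs i _; exact: mesh_le_bar.
  by case: (allin_sdtd cQ S).
rewrite sdU; rewrite /Q in N; clear IH sD fs Qhd sub hd cQ Q.
case: s es F N => // w s _; set b := bar _ => F N.
have FN : supp (fun s' : seq pt => mesh_le (D%:R / D.+1%:R * r) s' /\
   forall v, v \in s' -> forall i, `|b i - v i| <= D%:R / D.+1%:R * r) (sd bar (dseq (w :: s))).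
  by move=> s' h; split; [exact: F|move=> v /(N _ h) H i; exact: H].
apply: (supp_lift _ FN) => s' [f1 f2]; apply: suppU => v v'.
rewrite !inE => /orP[/eqP->|vs] /orP[/eqP->|vs'] i.
- by rewrite subrr normr0; apply: mulr_ge0.
- exact: f2.
- by rewrite distrC; exact: f2.
- exact: f1.
Qed.

Lemma hom_iter_sd m c N : hom m c -> hom m (iter N (sd bar) c).
Proof. by move=> h; elim: N => //= N; exact: hom_sd. Qed.

Lemma allin_iter_sd (Q : pt -> Prop) c N : cvx Q -> allin Q c ->
  allin Q (iter N (sd bar) c).
Proof.
by move=> cQ h; elim: N => //= N IH; have [] := @allin_sdtd _ Q bar cQ _ IH.
Qed.

Lemma mesh_le_iter_sd D r c N : 0 <= r -> hom D.+1 c -> supp (mesh_le r) c ->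
  supp (mesh_le ((D%:R / D.+1%:R) ^+ N * r)) (iter N (sd bar) c).
Proof.
move=> r0 hc fc; elim: N => [|N IH]; first by rewrite expr0 mul1r.
have F : supp (fun s : seq pt => size s = D.+1 /\ mesh_le ((D%:R / D.+1%:R) ^+ N * r) s)
    (iter N (sd bar) c).
  by move=> s hs; split; [exact: (hom_iter_sd hc hs)|exact: IH].
rewrite iterS; apply: (supp_lift _ F) => s [es fs].
have := @mesh_le_sdseq D _ s _ _ fs; rewrite /sd fgliftU exprS mulrA; apply.
  by rewrite mulr_ge0// exprn_ge0// divr_ge0.
by rewrite es.
Qed.

Lemma mesh_to0 D r e : 0 <= r -> 0 < e ->
  exists N0, forall N, (N0 <= N)%N -> (D%:R / D.+1%:R : R) ^+ N * r <= e.
Proof.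
move=> r0 e0.
have q1 : `|D%:R / D.+1%:R : R| < 1.
  by rewrite ger0_norm ?divr_ge0// ltr_pdivrMr ?ltr0n// mul1r ltr_nat.
have /cvgrPdist_le/(_ (e / (r + 1))) := cvg_expr q1.
have r1 : 0 < r + 1 by lra.
move=> /(_ (divr_gt0 e0 r1)) [N0 _ h]; exists N0 => N /h /=.
rewrite sub0r normrN ger0_norm ?exprn_ge0 ?divr_ge0// ler_pdivlMr// => h'.
apply: le_trans h'; apply: ler_wpM2l; last by lra.
by rewrite exprn_ge0// divr_ge0.
Qed.

Lemma dl_iter_sd c N : dl (iter N (sd bar) c) = iter N (sd bar) (dl c).
Proof. by elim: N => //= N IH; rewrite dl_sd IH. Qed.

Lemma iter_sdB c c' N :
  iter N (sd bar) (c - c') = iter N (sd bar) c - iter N (sd bar) c'.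
Proof. by elim: N => //= N ->; rewrite sdB. Qed.

Lemma iter_sd_lmap (f : pt -> pt) c N : (forall s, bar (map f s) = f (bar s)) ->
  iter N (sd bar) (lmap f c) = lmap f (iter N (sd bar) c).
Proof. by move=> fb; elim: N => //= N ->; apply: sd_lmap. Qed.

End Mesh.

(** * Singular cubes *)

Section Singular.
Variables (R : realType) (X : topologicalType).
Notation pt := (nat -> R).
Notation splx d := (@stdsimplex R d).
Notation chn d := (chain R X d).

(** Continuity tested along maps with continuous coordinates, so that [nat -> R] carries no topology
    of its own. *)
Definition ccont (Psi : pt -> X) := forall (T : topologicalType) (f : T -> pt),
  (forall i, continuous (fun x => f x i)) -> continuous (fun x => Psi (f x)).

Definition vec (d : nat) (x : 'rV[R]_d.+1) : pt :=
  fun i => if (i < d.+1)%N then x 0 (inord i) else 0.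

Definition simp (d : nat) (Psi : pt -> X) (s : seq pt) : splx d -> X :=
  fun x => Psi (lin d.+1 s (vec (set_val x))).

Definition sing (d : nat) (Psi : pt -> X) (c : {freeg (seq pt) / int}) : chn d :=
  fglift (fun s => << simp Psi s >> : chn d) c.

Lemma set_val_continuous (T : topologicalType) (A : set T) :
  continuous (set_val : A -> T).
Proof. exact: initial_continuous. Qed.

Lemma contD (T : topologicalType) (f g : T -> R) :
  continuous f -> continuous g -> continuous (fun x => f x + g x).
Proof. by move=> hf hg x; exact: (cvgD (hf x) (hg x)). Qed.

Lemma contB (T : topologicalType) (f g : T -> R) :
  continuous f -> continuous g -> continuous (fun x => f x - g x).
Proof. by move=> hf hg x; exact: (cvgB (hf x) (hg x)). Qed.

Lemma contM (T : topologicalType) (f g : T -> R) :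
  continuous f -> continuous g -> continuous (fun x => f x * g x).
Proof. by move=> hf hg x; exact: (cvgM (hf x) (hg x)). Qed.

Lemma continuous_sumR (T : topologicalType) (I : Type) (r : seq I) (F : I -> T -> R) :
  (forall i, continuous (F i)) -> continuous (fun x => \sum_(i <- r) F i x).
Proof.
move=> h; elim: r => [|i r IH].
  by under eq_fun do rewrite big_nil; exact: cst_continuous.
under eq_fun do rewrite big_cons.
exact: contD.
Qed.

Lemma vec_continuous d i : continuous (fun x : splx d => vec (set_val x) i).
Proof.
rewrite /vec; case: (ltnP i d.+1) => _; last exact: cst_continuous.
move=> x; apply: (@continuous_comp (splx d) 'rV[R]_d.+1 R set_val (fun M => M 0 (inord i))).
  exact: set_val_continuous.
exact: coord_continuous.
Qed.

Lemma simp_continuous d Psi s : ccont Psi -> continuous (@simp d Psi s).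
Proof.
move=> h; apply: h => i; rewrite /lin; apply: continuous_sumR => j.
by apply: contM; [exact: vec_continuous|exact: cst_continuous].
Qed.

Lemma vec_face d (i : 'I_d.+2) (x : splx d) :
  vec (set_val (face i x)) = ins i 0 (vec (set_val x)).
Proof.
apply/funext => a; rewrite /vec /ins [set_val (face i x)]/=.
have -> : set_val (face i x) = insert0 i (set_val x) by [].
have li := ltn_ord i.
case: (ltnP a d.+2) => ha; last first.
  have -> : (a < i)%N = false by lia.
  have -> : (a == i) = false by lia.
  by have -> : (a.-1 < d.+1)%N = false by lia.
rewrite mxE; case: unliftP => [j|] /(congr1 val) /=; rewrite inordK// => ->; last first.
  by rewrite ltnn eqxx.
have lj := ltn_ord j; rewrite /bump; case: (leqP i j) => ij; rewrite ?add1n ?add0n.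
  have -> : (j.+1 < i)%N = false by lia.
  have -> : (j.+1 == i) = false by lia.
  by rewrite /= lj; congr (set_val x _ _); apply: val_inj; rewrite /= inordK.
by rewrite ij lj; congr (set_val x _ _); apply: val_inj; rewrite /= inordK.
Qed.

Lemma lin_ins d (i : 'I_d.+1) (s : seq pt) v : size s = d.+1 ->
  lin d.+1 s (ins i 0 v) = lin d (delat i s) v.
Proof.
move=> es; apply/funext => a; rewrite /lin (bigD1_ord i) //= /ins ltnn eqxx mul0r add0r.
apply: eq_bigr => j _; rewrite /delat nth_cat size_take es ltn_ord /bump.
have lj := ltn_ord j; case: (leqP i j) => ij; rewrite ?add1n ?add0n.
  have -> : (j.+1 < i)%N = false by lia.
  have -> : (j.+1 == i) = false by lia.
  rewrite nth_drop; congr (_ * (nth _ _ _ : pt) _); lia.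
by rewrite ij nth_take.
Qed.

Lemma simp_face d Psi (s : seq pt) (i : 'I_d.+2) : size s = d.+2 ->
  simp Psi s \o face i = simp Psi (delat i s) :> (splx d -> X).
Proof.
by move=> es; apply/funext => x; rewrite /simp /= vec_face lin_ins.
Qed.

Lemma bd_sing d Psi c : hom d.+2 c -> bd (sing d.+1 Psi c) = sing d Psi (dl c).
Proof.
move=> hc; rewrite /bd /sing /dl !fglift_comp.
apply: fglift_supp hc => s es; rewrite fgliftU dseqE es fglift_sum.
apply: eq_bigr => i _; rewrite simp_face// freegU_mulrz [in RHS]freegU_mulrz.
by rewrite fglift_mulz fgliftU.
Qed.

Lemma bdB d (c c' : chn d.+1) : bd (c - c') = bd c - bd c'.
Proof. exact: fgliftB. Qed.

Lemma chain_in_supp (A : set X) d (c : chn d) : chain_in A c <->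
  supp (fun s : splx d -> X => continuous s /\ forall x, A (s x)) c.
Proof. by []. Qed.

Lemma stdsimplex_vec d (x : splx d) :
  (forall i, 0 <= vec (set_val x) i) /\ \sum_(a < d.+1) vec (set_val x) a = 1.
Proof.
have [x_ge0 x1] : @stdsimplex R d (set_val x) by exact: set_valP.
split=> [i|]; first by rewrite /vec; case: ifP => // _; exact: x_ge0.
rewrite -[RHS]x1; apply: eq_bigr => i _; rewrite /vec ltn_ord.
by congr (set_val x _ _); apply: val_inj; rewrite /= inordK.
Qed.

Lemma lin_map_ins d j e (s : seq pt) (v : pt) : size s = d -> \sum_(a < d) v a = 1 ->
  lin d (map (ins j e) s) v = ins j e (lin d s v).
Proof.
move=> es v1; apply/funext => i; rewrite /lin /ins.
have H a : (a < d)%N -> nth (fun=> 0) (map (ins j e) s) a = ins j e (nth (fun=> 0) s a).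
  by move=> ad; rewrite (nth_map (fun=> 0)) ?es.
case: ifP => ij; [|case: ifP => ij'].
- by apply: eq_bigr => a _; rewrite H// /ins ij.
- rewrite -[RHS]mul1r -v1 mulr_suml.
  by apply: eq_bigr => a _; rewrite H// /ins ij ij'.
- by apply: eq_bigr => a _; rewrite H// /ins ij ij'.
Qed.

Lemma sing_ins d j e Psi c : hom d.+1 c ->
  sing d Psi (lmap (ins j e) c) = sing d (Psi \o ins j e) c.
Proof.
move=> hc; rewrite /sing /lmap fglift_comp; apply: fglift_supp hc => s es.
rewrite fgliftU; congr (<< _ >>); apply/funext => x; rewrite /simp /=.
by rewrite lin_map_ins//; have [] := stdsimplex_vec x.
Qed.

Definition cube (d : nat) (v : pt) := forall i, (i < d)%N -> 0 <= v i <= 1.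

Definition cubebd (d : nat) (v : pt) :=
  cube d v /\ exists2 i, (i < d)%N & v i = 0 \/ v i = 1.

Lemma lin_cube m d (s : seq pt) (v : pt) : (forall i, 0 <= v i) -> \sum_(a < m) v a = 1 ->
  size s = m -> (forall w, w \in s -> cube d w) -> cube d (lin m s v).
Proof.
move=> v0 v1 es Cs i id.
have H (a : 'I_m) : 0 <= (nth (fun=> 0) s a : pt) i <= 1.
  by apply: Cs => //; apply: mem_nth; rewrite es.
apply/andP; split; rewrite /lin.
  by apply: sumr_ge0 => a _; apply: mulr_ge0 => //; case/andP: (H a).
rewrite -v1; apply: ler_sum => a _; apply: ler_piMr => //; by case/andP: (H a).
Qed.

Lemma cube_ins j e d v : 0 <= e <= 1 -> (j <= d)%N -> cube d v -> cube d.+1 (ins j e v).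
Proof.
move=> e01 jd cv i; rewrite ltnS /ins => id.
case: ifP => [ij|/negbT]; first by apply: cv; exact: (leq_trans ij).
rewrite -leqNgt => ij; case: ifP => // /negbT ij'; apply: cv; lia.
Qed.

Lemma cubebd_ins j e d v : e = 0 \/ e = 1 -> (j <= d)%N -> cube d v ->
  cubebd d.+1 (ins j e v).
Proof.
move=> e01 jd cv; split; first by apply: cube_ins => //; case: e01 => ->; lra.
by exists j => //; rewrite /ins ltnn eqxx.
Qed.

(** Here [m] is independent of [d]: coordinates beyond the dimension are bounded as well, because
    [mesh_le] refers to all coordinates. *)
Lemma cube_kuhn_all m d : allin (cube m) (kuhn R d).
Proof.
elim: d m => [|d IH] m.
  by apply: suppU => v; rewrite inE => /eqP-> i _; rewrite lexx ler01.
rewrite kuhnS; case: m => [|m].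
  by apply: (allin_prism (Q := fun=> True)) => // s _ v _.
by apply: allin_prism (IH m) => v; apply: cube_ins => //; lra.
Qed.

Lemma cube_kuhn d : allin (cube d) (kuhn R d).
Proof. exact: cube_kuhn_all. Qed.

Lemma chain_in_sing (A : set X) m d Psi c : ccont Psi -> hom m.+1 c ->
  allin (cube d) c -> (forall v, cube d v -> A (Psi v)) -> chain_in A (sing m Psi c).
Proof.
move=> cP hc cc h; apply/chain_in_supp.
have F : supp (fun s : seq pt => size s = m.+1 /\ forall v, v \in s -> cube d v) c.
  by move=> s hs; split; [exact: hc|exact: cc].
apply: (supp_lift _ F) => s [es Cs]; apply: suppU; split; first exact: simp_continuous.
move=> x; apply: h; have [] := stdsimplex_vec x => v0 v1.
exact: lin_cube.
Qed.

Lemma chain_inD (A : set X) d (c c' : chn d) :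
  chain_in A c -> chain_in A c' -> chain_in A (c + c').
Proof. by move=> /chain_in_supp h /chain_in_supp h'; apply/chain_in_supp; exact: suppD. Qed.

Lemma chain_inN (A : set X) d (c : chn d) : chain_in A c -> chain_in A (- c).
Proof. by move=> /chain_in_supp h; apply/chain_in_supp; exact: suppN. Qed.

Lemma chain_in_sum (A : set X) d (I : Type) (r : seq I) (P : pred I) (F : I -> chn d) :
  (forall i, P i -> chain_in A (F i)) -> chain_in A (\sum_(i <- r | P i) F i).
Proof. by move=> h; apply/chain_in_supp; apply: supp_sum => i /h/chain_in_supp. Qed.

Lemma chain_in_mulz (A : set X) d (c : chn d) m : chain_in A c -> chain_in A (c *~ m).
Proof. by move=> /chain_in_supp h; apply/chain_in_supp; exact: supp_mulz. Qed.

Lemma chain_inS (A B : set X) d (c : chn d) : A `<=` B -> chain_in A c -> chain_in B c.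
Proof. by move=> AB h s /h[? h']; split=> // x; apply: AB. Qed.

Definition cubechain d (Psi : pt -> X) : chn d := sing d Psi (kuhn R d).

Lemma bd_cubechain d Psi : bd (cubechain d.+1 Psi) =
  \sum_(j < d.+1) (cubechain d (Psi \o ins j 1) - cubechain d (Psi \o ins j 0)) *~ (-1) ^+ j.
Proof.
rewrite bd_sing; last exact: hom_kuhn.
rewrite dl_kuhn /sing fglift_sum; apply: eq_bigr => j _.
by rewrite fglift_mulz fgliftB -!/(sing d _ _) !sing_ins //; exact: hom_kuhn.
Qed.

Lemma ccont_ins j e Psi : ccont Psi -> ccont (Psi \o ins j e).
Proof.
move=> h T f hf; apply: (h T (fun x => ins j e (f x))) => i; rewrite /ins.
case: (ltnP i j) => _; first exact: hf.
by case: (i == j); [exact: cst_continuous|exact: hf].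
Qed.

Lemma chain_in_cubechain (A : set X) d Psi : ccont Psi ->
  (forall v, cube d v -> A (Psi v)) -> chain_in A (cubechain d Psi).
Proof. by move=> cP h; apply: (chain_in_sing cP _ (@cube_kuhn d)) => //; exact: hom_kuhn. Qed.

Lemma rel_cycle_cubechain (A B : set X) d Psi : ccont Psi ->
  (forall v, cube d v -> A (Psi v)) -> (forall v, cubebd d v -> B (Psi v)) ->
  rel_cycle A B (cubechain d Psi).
Proof.
move=> cP hA hB; case: d hA hB => [|d] hA hB; first exact: chain_in_cubechain.
split; first exact: chain_in_cubechain.
rewrite bd_cubechain; apply: chain_in_sum => j _; apply: chain_in_mulz.
have F e : e = 0 \/ e = 1 -> chain_in B (cubechain d (Psi \o ins j e)).
  move=> e01; apply: chain_in_cubechain; first exact: ccont_ins.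
  by move=> v cv; apply/hB/cubebd_ins => //; rewrite -ltnS.
by apply: chain_inD; [|apply: chain_inN]; apply: F; [right|left].
Qed.

Lemma rel_homologousS (A A' B B' : set X) d (c c' : chn d) :
  A `<=` A' -> B `<=` B' -> rel_homologous A B c c' -> rel_homologous A' B' c c'.
Proof.
move=> AA BB [b [a [hb ha e]]]; exists b, a; split => //.
  exact: chain_inS hb.
exact: chain_inS ha.
Qed.

End Singular.

(** * Degree of a cube *)

Section ColourCocycle.

(* The signed indicator of rainbow simplices: [cs] lists the colours of the
   vertices, and [phi m cs] is the sign of [cs] if it is a permutation of
   0, ..., m.-1 and 0 otherwise. *)
Definition phi (m : nat) (cs : seq nat) : int :=
  \det (\matrix_(i < m, j < m) (nth 0%N cs j == i)%:R : 'M[int]_m).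

Lemma phi_missing m cs a : size cs = m -> (a < m)%N -> a \notin cs -> phi m cs = 0.
Proof.
move=> sm am acs; rewrite /phi (expand_det_row _ (Ordinal am)) big1 // => j _.
rewrite mxE; case: eqP => [E|_]; last by rewrite mul0r.
by case/negP: acs; rewrite -[X in X \in _]E mem_nth // sm.
Qed.

Lemma phi_eq01 m a cs : phi m.+2 (a :: a :: cs) = 0.
Proof.
rewrite /phi -det_tr.
rewrite (determinant_alternate (i1 := 0) (i2 := 1)) // => j.
by rewrite !mxE.
Qed.

Lemma phi_cons m cs : size cs = m -> phi m.+1 (0%N :: map S cs) = phi m cs.
Proof.
move=> sm; rewrite /phi (expand_det_col _ 0) big_ord_recl big1 ?addr0; last first.
  by move=> i _; rewrite mxE /= mul0r.
rewrite mxE /= mul1r /cofactor addn0 expr0 mul1r; congr (\det _).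
apply/matrixP => i j; rewrite !mxE /= /bump /= !add1n /=.
by rewrite (nth_map 0%N) ?sm ?eqSS // add0n; exact: ltn_ord.
Qed.

(** A missing colour below m kills every summand; the case where m itself is missing is linear
    algebra. If all colours 0, ..., m occurred, the sum would be 1 or -1, which is why simplices
    must first be made small. *)
Lemma phi_cocycle m cs : size cs = m.+1 -> (forall a, a \in cs -> (a <= m)%N) ->
  (exists2 a, (a <= m)%N & a \notin cs) ->
  \sum_(i < m.+1) phi m (delat i cs) *~ (-1) ^+ i = 0.
Proof.
move=> scs csm [a am acs].
have sdel (i : 'I_m.+1) : size (delat i cs) = m.
  rewrite size_cat size_take size_drop scs ltn_ord; have := ltn_ord i; lia.
have [{}am|] := ltnP a m.
  apply: big1 => i _; rewrite (phi_missing (sdel i) am) ?mul0rz//.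
  rewrite mem_cat negb_or; apply/andP; split; apply: contra acs;
    by [apply: mem_take|apply: mem_drop].
move=> ma; have {ma}ea : a = m by apply/eqP; rewrite eqn_leq am ma.
subst a.
(* The sum is the expansion along the added row of ones; no column has the
   colour [m], so this row is the sum of the others. *)
pose M : 'M[int]_m.+1 := \matrix_(i, j)
  if unlift 0 i is Some i' then (nth 0%N cs j == i')%:R else 1.
have <- : \det M = \sum_(i < m.+1) phi m (delat i cs) *~ (-1) ^+ i.
  rewrite (expand_det_row _ 0); apply: eq_bigr => j _.
  rewrite mxE unlift_none mul1r /cofactor add0n mulrzz mulrC; congr (\det _ * _).
  apply/matrixP => i l; rewrite !mxE liftK /delat nth_cat size_take scs ltn_ord.
  rewrite /= /bump; have := ltn_ord l; case: (leqP j l) => jl lm; rewrite ?add1n ?add0n.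
    by rewrite nth_drop; congr (nth _ _ _ == _)%:R; rewrite addSn subnKC.
  by rewrite ?jl nth_take.
pose u : 'rV[int]_m.+1 := \row_i (if unlift 0 i is Some _ then -1 else 1).
have uM : u *m M = 0.
  apply/rowP => j; rewrite !mxE big_ord_recl !mxE unlift_none mul1r.
  have cj : (nth 0%N cs j < m)%N.
    have jc : nth 0%N cs j \in cs by rewrite mem_nth // scs.
    by rewrite ltn_neqAle csm// andbT; apply: contraNneq acs => <-.
  rewrite (bigD1 (Ordinal cj)) //= big1; last first.
    move=> i /negbTE ij; rewrite !mxE !liftK.
    by rewrite -val_eqE /= eq_sym in ij; rewrite ij mulr0.
  by rewrite !mxE !liftK eqxx mulr1 addr0 subrr.
have := congr1 (fun v => (v *m \adj M) 0 0) uM.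
rewrite -mulmxA mul_mx_adj mul0mx !mxE (bigD1 0) //= big1 => [|i /negbTE i0].
  by rewrite !mxE unlift_none eqxx mul1r addr0.
by rewrite !mxE i0 mulr0n mulr0.
Qed.

Variable V : choiceType.
Local Notation lc := {freeg (seq V) / int}.

Definition phig (m : nat) (g : V -> nat) (c : lc) : int :=
  fglift (fun s => phi m (map g s) : int^o) c.

Lemma phigB m g c c' : phig m g (c - c') = phig m g c - phig m g c'.
Proof. exact: (@fgliftB (seq V : choiceType) int^o (fun s => phi m (map g s))). Qed.

Lemma phig_eq0 m g c (Q : seq V -> Prop) : supp Q c ->
  (forall s, Q s -> phi m (map g s) = 0) -> phig m g c = 0.
Proof.
move=> hc h; rewrite /phig (@fglift_supp _ _ Q _ (fun=> 0) c) ?fglift_cst0 //.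
Qed.

Lemma phig_missing m g c a : hom m c -> (a < m)%N ->
  allin (fun v => g v <> a) c -> phig m g c = 0.
Proof.
move=> hc am ac.
apply: (@phig_eq0 _ _ _ (fun s => size s = m /\ forall v, v \in s -> g v <> a)).
  by move=> s hs; split; [exact: hc|exact: ac].
move=> s [sm sa]; apply: (phi_missing (a := a)) => //; first by rewrite size_map.
by apply/mapP => -[v /sa h /esym].
Qed.

Lemma phig_dl m g c (Q : seq V -> Prop) : hom m.+1 c -> supp Q c ->
  (forall v, (g v <= m)%N) ->
  (forall s, Q s -> exists2 a, (a <= m)%N & forall v, v \in s -> g v <> a) ->
  phig m g (dl c) = 0.
Proof.
move=> hc Qc gm h; rewrite /phig /dl fglift_comp.
rewrite (@fglift_supp _ _ (fun s => size s = m.+1 /\ Q s) _ (fun=> 0)) ?fglift_cst0 //.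
  move=> s [es /h[a am sa]]; rewrite dseqE es fglift_sum.
  rewrite -[RHS](@phi_cocycle m (map g s)); last 3 first.
  - by rewrite size_map.
  - by move=> _ /mapP[v _ ->].
  - by exists a => //; apply/mapP => -[v /sa ga /esym].
  apply: eq_bigr => i _; rewrite freegU_mulrz fglift_mulz fgliftU.
  by rewrite /delat map_cat map_take map_drop.
by move=> s hs; split; [exact: hc|exact: Qc].
Qed.

End ColourCocycle.

Lemma phig_lmap (V W : choiceType) m (g : W -> nat) (f : V -> W) c :
  phig m g (lmap f c) = phig m (g \o f) c.
Proof.
rewrite /phig /lmap fglift_comp; apply: (@fglift_ext (seq V : choiceType) int^o) => s.
by rewrite fgliftU map_comp.
Qed.

Lemma hom_td (V : choiceType) (b : seq V -> V) m c : hom m c -> hom m.+1 (td b c).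
Proof.
have main n : forall s, size s = n -> hom n.+1 (td b << s >>).
  elim: n => [|n IH] s es.
    by move/size0nil: es => ->; rewrite tdU; exact: supp0.
  have hd : hom n (dseq s) by have := @hom_dseq _ s; rewrite es.
  have htd : hom n.+1 (td b (dseq s)).
    by apply: (supp_lift _ hd) => x ex; have := IH x ex; rewrite /td fgliftU.
  rewrite tdU; case: s es hd htd => // v s es hd htd.
  by apply: hom_cone; apply: suppB => //; exact: suppU.
by move=> hc; apply: (supp_lift _ hc) => s es; have := main m s es; rewrite /td fgliftU.
Qed.

(** * The coloured cube *)

Section CubeModel.
Variable R : realType.
Notation pt := (nat -> R).

Definition core (d : nat) (v : pt) := forall i, (i < d)%N -> 1/4 <= v i <= 3/4.

(** A Sperner colouring: the first index whose coordinate is at most 1/2, and d if there is none.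
    Where coordinate j exceeds 1/2 the colour j is missing; where it does not, the colour d is
    missing. *)
Fixpoint colour (d : nat) (v : pt) : nat :=
  if d is d'.+1 then
    if v 0%N <= 1/2 then 0%N else (colour d' (fun i => v i.+1)).+1
  else 0%N.

Lemma colour_le d v : (colour d v <= d)%N.
Proof. by elim: d v => //= d IH v; case: ifP => // _; rewrite ltnS. Qed.

Lemma colour_last d v j : (j < d)%N -> v j <= 1/2 -> colour d v <> d.
Proof.
elim: d v j => //= d IH v [|j] jd vj; first by rewrite vj.
by case: ifP => // _ [] E; apply: (IH (fun i => v i.+1) j).
Qed.

Lemma colour_neq d v j : (j < d)%N -> 1/2 < v j -> colour d v <> j.
Proof.
elim: d v j => //= d IH v [|j] jd vj; first by rewrite leNgt vj.
by case: ifP => // _ [] E; apply: (IH (fun i => v i.+1) j).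
Qed.

Lemma colour_lt d v : (colour d v < d)%N -> v (colour d v) <= 1/2.
Proof. by elim: d v => //= d IH v; case: ifP => //= _ /IH. Qed.

Lemma colour_last_gt d v : colour d v = d -> forall j, (j < d)%N -> 1/2 < v j.
Proof.
elim: d v => //= d IH v; case: ifP => //= /negbT; rewrite -ltNge => v0 [] E [|j] //= jd.
exact: (IH (fun i => v i.+1)).
Qed.

Definition shrink (v : pt) : pt := fun i => 1/4 + v i / 2.

(** In each coordinate [shrink] is increasing and fixes the threshold 1/2. *)
Lemma colour_shrink d v : colour d (shrink v) = colour d v.
Proof.
elim: d v => //= d IH v; rewrite -[X in (X d _).+1]/colour.
rewrite -(IH (fun i => v i.+1)); congr (if _ then _ else _).
by rewrite /shrink; apply/idP/idP; lra.
Qed.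

(** Vertices in the bottom of the prism have colour 0, those in the top have their colour in the
    base plus one. Only the simplices with a single bottom vertex count; all others begin with the
    colours 0, 0. *)
Lemma phig_kuhn_colour d : phig d.+1 (colour d) (kuhn R d) = 1.
Proof.
elim: d => [|d IH].
  by rewrite /phig /= (@fgliftU _ int^o) /phi /= det_mx11 mxE.
rewrite -[RHS]IH /phig kuhnS /prism fglift_comp.
apply: (fglift_supp (M := int^o) _ (@hom_kuhn R d)) => s es.
case: s es => // v s [es]; rewrite /= (@fgliftB _ int^o) (@fgliftU _ int^o).
rewrite /=.
have c0 (w : pt) : colour d.+1 (ins 0 0 w) = 0%N.
  by rewrite /= /ins /= ifT //; lra.
have c1 (w : pt) : colour d.+1 (ins 0 1 w) = (colour d w).+1.
  by rewrite /= /ins /= ifF; [congr (_ .+1)|apply/negbTE; rewrite -ltNge; lra].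
rewrite -!/(colour d.+1 _) c0 c1.
have -> : [seq colour d.+1 i | i <- [seq ins 0 1 i | i <- s]] = [seq (colour d i).+1 | i <- s].
  by rewrite -map_comp; apply: eq_map => w /=; exact: c1.
have -> : phi d.+2 [:: 0%N, (colour d v).+1 & [seq (colour d i).+1 | i <- s]] =
    phi d.+1 (colour d v :: [seq colour d i | i <- s]).
  by rewrite -(@phi_cons d.+1) /= ?size_map ?es // -map_comp.
rewrite -[RHS]subr0; congr (_ - _).
rewrite /cone fglift_comp; case: s es => [|w s] es.
  by rewrite /= fglift0.
rewrite /= fgliftB !(@fgliftU _ int^o) /=.
rewrite -!/(colour d.+1 _) !c0 phi_eq01 sub0r /cone fglift_comp.
apply/eqP; rewrite oppr_eq0; apply/eqP; rewrite -[RHS](@fglift_cst0 _ int^o (prseq (ins 0 0) (ins 0 1) s)).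
apply: (@fglift_ext _ int^o) => s'; rewrite !(@fgliftU _ int^o) /=.
by rewrite -!/(colour d.+1 _) !c0 phi_eq01.
Qed.

End CubeModel.

Section CubeDegree.
Variable R : realType.
Notation pt := (nat -> R).
Variables (d : nat) (g : pt -> nat).
(** In the application [g] is the colouring of the closed cell pulled back to the cube. The colour d
    + 1 outside the core is not among those counted by [phi d.+1]. *)
Hypothesis g_core : forall v, cube d v -> core d v -> g v = colour d v.
Hypothesis g_out : forall v, cube d v -> ~ core d v -> g v = d.+1.
Hypothesis g_le : forall v, (g v <= d.+1)%N.

Lemma cvx_cube : cvx (@cube R d).
Proof.
apply: cvx_forall => i _ s s0 h; apply/andP; split.
  by apply: cvx_ge => // v /h/andP[].
by apply: cvx_le => // v /h/andP[].
Qed.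

Lemma cvx_core : cvx (@core R d).
Proof.
apply: cvx_forall => i _ s s0 h; apply/andP; split.
  by apply: cvx_ge => // v /h/andP[].
by apply: cvx_le => // v /h/andP[].
Qed.

Lemma core_cube (v : pt) : core d v -> cube d v.
Proof. by move=> h i /h/andP[? ?]; lra. Qed.

Lemma not_core (v : pt) : ~ core d v -> exists2 i, (i < d)%N & v i < 1/4 \/ 3/4 < v i.
Proof.
move=> h; apply: contrapT => H; apply: h => i id; apply/negPn/negP.
rewrite negb_and -!ltNge => /orP h; apply: H; exists i => //; exact: h.
Qed.

Lemma g_low j v : (j < d)%N -> cube d v -> v j <= 1/4 -> g v <> d.
Proof.
move=> jd cv vj; have [/(g_core cv)->|/(g_out cv)->] := pselect (core d v).
  by apply: (colour_last jd); lra.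
by move/eqP; rewrite gtn_eqF.
Qed.

Lemma g_high j v : (j < d)%N -> cube d v -> 3/4 <= v j -> g v <> j.
Proof.
move=> jd cv vj; have [/(g_core cv)->|/(g_out cv)->] := pselect (core d v).
  by apply: (colour_neq jd); lra.
by move/eqP; rewrite gtn_eqF // ltnW.
Qed.

(** Either all vertices are in the core and d + 1 is missing, or some coordinate of one vertex is
    below 1/4 or above 3/4. Then all vertices stay on the same side of 1/2 in this coordinate, as
    1/16 is less than 1/4, and d or the coordinate's index is missing. *)
Lemma mesh_le_missing (s : seq pt) : (forall v, v \in s -> cube d v) -> mesh_le (1/16) s ->
  exists2 a, (a <= d.+1)%N & forall v, v \in s -> g v <> a.
Proof.
move=> sc fs.
have [[w ws nw]|h] := pselect (exists2 w, w \in s & ~ core d w); last first.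
  exists d.+1 => // v vs; have [cv|ncv] := pselect (core d v).
    by rewrite (g_core (sc _ vs) cv); have := colour_le d v => ? ?; lia.
  by case: h; exists v.
have [i id wi] := not_core nw.
have near v : v \in s -> w i - 1/16 <= v i <= w i + 1/16.
  by move=> vs; have := fs _ _ ws vs i; rewrite ler_norml => /andP[? ?]; lra.
case: wi => wi.
  exists d => // v vs; have [cv|ncv] := pselect (core d v).
    by rewrite (g_core (sc _ vs) cv); apply: (colour_last id); have := near v vs; lra.
  by rewrite (g_out (sc _ vs) ncv) => /eqP; rewrite gtn_eqF.
exists i; first by rewrite ltnW// ltnW.
move=> v vs; have [cv|ncv] := pselect (core d v).
  by rewrite (g_core (sc _ vs) cv); apply: (colour_neq id); have := near v vs; lra.
by rewrite (g_out (sc _ vs) ncv) => /eqP; rewrite gtn_eqF// ltnW.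
Qed.

(** The colour d + 1 does not occur in the core, so the count vanishes on the boundary of the
    homotopy [td] for any mesh; what remains is the homotopy term on the boundary of [c]. *)
Lemma phig_core_sd c : hom d.+1 c -> allin (core d) c ->
  (forall N, phig d.+1 g (td (@bar R) (iter N (sd (@bar R)) (dl c))) = 0) ->
  forall N, phig d.+1 g (iter N (sd (@bar R)) c) = phig d.+1 g c.
Proof.
move=> hc cc hb; elim=> //= N IH; rewrite -IH.
apply/eqP; rewrite eq_sym -subr_eq0 -phigB -dl_td; apply/eqP.
rewrite -[X in _ + X]opprK phigB.
have -> : phig d.+1 g (- td (@bar R) (dl (iter N (sd (@bar R)) c))) = 0.
  by rewrite -sub0r phigB dl_iter_sd hb subr0 -(subrr 0) phigB subrr.
rewrite subr0.
have h1 := @hom_iter_sd R _ _ N hc; have h2 := @allin_iter_sd R _ _ N cvx_core cc.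
have [_ h3] := allin_sdtd cvx_core h2.
apply: (phig_dl (hom_td h1) h3) => // s cs; exists d.+1 => // v vs.
rewrite g_core ?core_cube//; try exact: cs.
  by have := colour_le d v => ? ?; lia.
by apply/core_cube/cs.
Qed.

Lemma phig_ext_in (V : choiceType) m (g1 g2 : V -> nat) c (Q : V -> Prop) : allin Q c ->
  (forall v, Q v -> g1 v = g2 v) -> phig m g1 c = phig m g2 c.
Proof.
move=> Qc h; apply: (fglift_supp (M := int^o) _ Qc) => s Qs; congr phi.
by apply/eq_in_map => v /Qs/h.
Qed.

(* A homotopy from the identity of the cube to [shrink]. *)
Definition squeeze (v : pt) : pt :=
  fun i => (1 - v 0%N) * v i.+1 + v 0%N * (1/4 + v i.+1 / 2).

Lemma cube_squeeze m v : cube m.+1 v -> cube m (squeeze v).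
Proof.
move=> cv i id; have := cv 0%N isT; have := cv i.+1 id; rewrite /squeeze.
set t := v 0%N; set x := v i.+1 => hx ht; apply/andP; split; nra.
Qed.

Lemma squeeze_ins0 e v : squeeze (ins 0 e v) = fun i => (1 - e) * v i + e * (1/4 + v i / 2).
Proof. by []. Qed.

Lemma squeeze_insS j e v : squeeze (ins j.+1 e v) j = (1 - v 0%N) * e + v 0%N * (1/4 + e / 2).
Proof. by rewrite /squeeze /ins /= ltnn eqxx. Qed.

(** The cube is deformed into its core by [squeeze]. Once fine, the deformation contributes nothing
    on its sides, so the count equals that of the shrunken cube. There subdivision is irrelevant,
    and [phig_kuhn_colour] gives 1. *)
Lemma phig_kuhn_iter : exists N0, forall N, (N0 <= N)%N ->
  phig d.+1 g (iter N (sd (@bar R)) (kuhn R d)) = 1.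
Proof.
have [N0 hN0] := @mesh_to0 R d.+1 1 (1/16) ler01 (ltac:(lra)).
exists N0 => N /hN0 hN.
pose Q := lmap squeeze (kuhn R d.+1).
have hQ : hom d.+2 Q.
  by apply: (supp_lift _ (@hom_kuhn R d.+1)) => s es; apply: suppU; rewrite size_map.
have cQ : allin (cube d) Q by apply: allin_lmap (@cube_kuhn R d.+1); exact: cube_squeeze.
have cQa : allin (fun v : pt => forall i, True -> 0 <= v i <= 1) Q.
  apply: (allin_lmap _ (Q := fun v : pt => forall i, True -> 0 <= v i <= 1)).
    move=> v hv i _; apply: (@cube_squeeze i.+1 v) => // j _; exact: hv.
  by move=> s hs v vs i _; apply: (@cube_kuhn_all R i.+1 d.+1 s hs v vs).
have fQ : supp (mesh_le 1) Q.
  move=> s /cQa hs v v' /hs/(_ _ I) hv /hs/(_ _ I) hv' i.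
  by have := hv i; have := hv' i; rewrite ler_norml; lra.
(* [Q] is the track of the deformation, of dimension d + 1; its fine simplices each miss a
   colour. *)
have lhs0 : phig d.+1 g (dl (iter N (sd (@bar R)) Q)) = 0.
  have F : supp (fun s : seq pt => (forall v, v \in s -> cube d v) /\ mesh_le (1/16) s)
      (iter N (sd (@bar R)) Q).
    move=> s hs; split; first exact: (@allin_iter_sd R _ _ N cvx_cube cQ).
    have := @mesh_le_iter_sd R _ _ _ N ler01 hQ fQ _ hs; rewrite mulr1 => h v v' vs vs' i.
    by apply: le_trans (h _ _ vs vs' i) _; rewrite mulr1 in hN.
  by apply: (phig_dl (@hom_iter_sd R _ _ N hQ) F g_le) => s [sc fs]; exact: mesh_le_missing.
pose G c : int := phig d.+1 g (iter N (sd (@bar R)) (lmap squeeze c)).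
have GE c : G c = fglift (fun s => G << s >> : int^o) c.
  by apply: (@fglift_additiveE _ int^o G) => c' c''; rewrite /G lmapB iter_sdB phigB.
have Gins j e c : G (lmap (ins j e) c) =
    phig d.+1 g (iter N (sd (@bar R)) (lmap (squeeze \o ins j e) c)).
  rewrite /G /lmap fglift_comp; congr (phig _ _ (iter _ _ _)).
  by apply: fglift_ext => s; rewrite fgliftU map_comp.
(* On the track of the face e = 0 the coordinate j stays at most 1/4, so the colour d is missing; on
   that of e = 1 it stays at least 3/4, and j is missing. *)
have side j e : (j < d)%N -> e = 0 \/ e = 1 -> G (lmap (ins j.+1 e) (kuhn R d)) = 0.
  move=> jd e01; rewrite Gins.
  have hh : hom d.+1 (lmap (squeeze \o ins j.+1 e) (kuhn R d)).
    by apply: (supp_lift _ (@hom_kuhn R d)) => s es; apply: suppU; rewrite size_map.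
  have cs (v : pt) : cube d v -> cube d (squeeze (ins j.+1 e v)).
    move=> cv; apply/cube_squeeze/cube_ins => //.
    by case: e01 => ->; lra.
  have cz (v : pt) : cube d v -> 0 <= v 0%N <= 1.
    by move=> cv; apply: cv; exact: leq_ltn_trans jd.
  case: e01 => e01.
    have Qh : allin (fun v => cube d v /\ v j <= 1/4) (lmap (squeeze \o ins j.+1 e) (kuhn R d)).
      apply: allin_lmap (@cube_kuhn R d) => v cv; split; first exact: cs.
      by rewrite /= squeeze_insS e01; have := cz v cv; lra.
    apply: (phig_missing (a := d) (@hom_iter_sd R _ _ N hh)) => //.
    apply: suppS (@allin_iter_sd R _ _ N (cvxI cvx_cube (@cvx_le R j _)) Qh) => s h v /h[cv vj].
    exact: (g_low jd).
  have Qh : allin (fun v => cube d v /\ 3/4 <= v j) (lmap (squeeze \o ins j.+1 e) (kuhn R d)).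
    apply: allin_lmap (@cube_kuhn R d) => v cv; split; first exact: cs.
    by rewrite /= squeeze_insS e01; have := cz v cv; lra.
  apply: (phig_missing (a := j) (@hom_iter_sd R _ _ N hh)); first by rewrite ltnW.
  apply: suppS (@allin_iter_sd R _ _ N (cvxI cvx_cube (@cvx_ge R j _)) Qh) => s h v /h[cv vj].
  exact: (g_high jd).
move: lhs0; rewrite dl_iter_sd dl_lmap dl_kuhn -/(G _) GE (@fglift_sum _ int^o) big_ord_recl.
rewrite big1 ?addr0; last first.
  move=> i _; rewrite (@fglift_mulz _ int^o) (@fgliftB _ int^o) -!GE !side //; [|by left|by right].
  by rewrite subrr mul0rz.
rewrite expr0 (@fglift_mulz _ int^o) (@fgliftB _ int^o) -!GE => /eqP.
rewrite mulr1z subr_eq0 => /eqP E.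
have -> : phig d.+1 g (iter N (sd (@bar R)) (kuhn R d)) = G (lmap (ins 0 0) (kuhn R d)).
  rewrite Gins; congr (phig _ _ (iter _ _ _)).
  rewrite -[LHS]fglift_id; apply: fglift_ext => s; congr (<< _ >>).
  rewrite -[LHS]map_id; apply: eq_map => v; apply/funext => i.
  by rewrite /= squeeze_ins0 /id; lra.
rewrite -E Gins.
have shrinkE : squeeze \o ins 0 1 = @shrink R.
  by apply/funext => v; apply/funext => i; rewrite /= squeeze_ins0 /shrink; lra.
rewrite shrinkE.
have coreS (v : pt) : cube d v -> core d (shrink v).
  by move=> cv i /cv /andP[? ?]; rewrite /shrink; apply/andP; split; lra.
have cS : allin (core d) (lmap (@shrink R) (kuhn R d)).
  exact: (allin_lmap coreS (@cube_kuhn R d)).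
have hS : hom d.+1 (lmap (@shrink R) (kuhn R d)).
  by apply: (supp_lift _ (@hom_kuhn R d)) => s es; apply: suppU; rewrite size_map.
rewrite phig_core_sd //.
  apply: (etrans (phig_lmap _ _ _ _)).
  rewrite -[RHS](phig_kuhn_colour R d).
  have := @phig_ext_in _ d.+1 (g \o @shrink R) (colour d) _ _ (@cube_kuhn R d).
  apply => v cv /=.
  rewrite g_core ?colour_shrink //; last exact: coreS.
  by apply/core_cube/coreS.
move=> N'; rewrite dl_lmap.
pose F c : int := phig d.+1 g (td (@bar R) (iter N' (sd (@bar R)) (lmap (@shrink R) c))).
have FE c : F c = fglift (fun s => F << s >> : int^o) c.
  by apply: (@fglift_additiveE _ int^o F) => c' c''; rewrite /F lmapB iter_sdB tdB phigB.
(* The faces of the shrunken cube lie on the hyperplanes 1/4 and 3/4, where again d or j is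
   missing. *)
have Fside j e : (j < d)%N -> e = 0 \/ e = 1 -> F (lmap (ins j e) (kuhn R d.-1)) = 0.
  move=> jd e01; pose Q' (v : pt) := core d v /\ (if e == 0 then v j <= 1/4 else 3/4 <= v j).
  have cQ' : cvx Q'.
    rewrite /Q'; case: (e == 0); first exact: cvxI cvx_core (@cvx_le R j _).
    exact: cvxI cvx_core (@cvx_ge R j _).
  have d1 : d.-1.+1 = d by rewrite prednK// (leq_ltn_trans _ jd).
  have hQ' : allin Q' (lmap (@shrink R) (lmap (ins j e) (kuhn R d.-1))).
    apply: (allin_lmap (Q := fun v => cube d v /\ v j = e)).
      move=> v [cv vj]; split; first exact: coreS.
      by rewrite /shrink vj; case: e01 => ->; rewrite ?eqxx ?oner_eq0; lra.
    apply: allin_lmap (@cube_kuhn R d.-1) => v cv; split.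
      by rewrite -d1; apply: cube_ins => //; [case: e01 => ->; lra|rewrite -ltnS d1].
    by rewrite /ins ltnn eqxx.
  have hh : hom d.+1 (td (@bar R) (iter N' (sd (@bar R)) (lmap (@shrink R) (lmap (ins j e) (kuhn R d.-1))))).
    apply: hom_td; apply: hom_iter_sd; rewrite -d1.
    have h0 := @hom_kuhn R d.-1; rewrite d1 in h0 *.
    apply: (supp_lift (Q := fun s : seq pt => size s = d)) => [s es|].
      by apply: suppU; rewrite size_map.
    by apply: (supp_lift _ h0) => s es; apply: suppU; rewrite size_map.
  have [_ hA] := allin_sdtd cQ' (@allin_iter_sd R _ _ N' cQ' hQ').
  case: (eqVneq e 0) => e0.
    apply: (phig_missing (a := d) hh) => //.
    apply: suppS hA => s h v /h[cv]; rewrite e0 eqxx => vj.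
    exact: (g_low jd (core_cube cv)).
  apply: (phig_missing (a := j) hh); first by rewrite ltnW.
  apply: suppS hA => s h v /h[cv]; rewrite (negbTE e0) => vj.
  exact: (g_high jd (core_cube cv)).
(* In dimension 0 the augmented boundary is the empty simplex, on which the homotopy vanishes. *)
have [d0|d0] := posnP d.
  have -> : dl (kuhn R d) = << [::] >> by rewrite d0 /= dlU /= cone0 subr0.
  rewrite lmapU /=.
  have -> : iter N' (sd (@bar R)) << [::] >> = << [::] >>.
    by elim: (N') => //= n ->; rewrite sdU.
  by rewrite tdU /phig (@fglift0 _ int^o).
have -> : dl (kuhn R d) = dl (kuhn R d.-1.+1) by rewrite prednK.
rewrite dl_kuhn -/(F _) FE (@fglift_sum _ int^o); apply: big1 => i _.
have id : (i < d)%N by rewrite -[X in (_ < X)%N](prednK d0).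
rewrite (@fglift_mulz _ int^o) (@fgliftB _ int^o) -!FE !Fside //; [|by left|by right].
by rewrite subrr mul0rz.
Qed.

End CubeDegree.

(** * The colour count on singular chains *)

Section Degree.
Variables (R : realType) (X : topologicalType).
Notation pt := (nat -> R).
Notation splx d := (@stdsimplex R d).
Notation chn d := (chain R X d).

Definition stdpt (d : nat) (v : pt) :=
  (forall i, (i < d.+1)%N -> 0 <= v i) /\ \sum_(i < d.+1) v i = 1.

Lemma cvx_stdpt d : cvx (stdpt d).
Proof.
apply: cvxI; last exact: cvx_sum1.
by apply: cvx_forall => i _; exact: cvx_ge.
Qed.

Definition rowof (d : nat) (v : pt) : 'rV[R]_d.+1 := \row_i v i.

Lemma rowof_std d v : stdpt d v -> rowof d v \in @stdsimplex R d.
Proof.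
move=> [v0 v1]; apply/mem_set; split=> [i|]; first by rewrite mxE; exact: v0.
by rewrite -[RHS]v1; apply: eq_bigr => i _; rewrite mxE.
Qed.

Lemma e0_std d : rowof d (fun i => (i == 0%N)%:R) \in @stdsimplex R d.
Proof.
apply: rowof_std; split=> [i _|]; first exact: ler0n.
by rewrite big_ord_recl eqxx big1 ?addr0.
Qed.

(** Points off the simplex are sent to its first vertex. Colours are compared only at points
    satisfying [stdpt], which subdivision preserves. *)
Definition tosplx (d : nat) (v : pt) : splx d :=
  insubd (SigSub (e0_std d) : splx d) (rowof d v).

Lemma tosplxK d v : stdpt d v -> set_val (tosplx d v) = rowof d v.
Proof.
by move=> /rowof_std h; rewrite set_valE /= val_insubd h.
Qed.

Definition verts (d : nat) : seq pt := [seq (fun i => (i == j)%:R) | j <- iota 0 d.+1].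

Lemma size_verts d : size (verts d) = d.+1.
Proof. by rewrite size_map size_iota. Qed.

Lemma stdpt_verts d v : v \in verts d -> stdpt d v.
Proof.
move=> /mapP[j]; rewrite mem_iota add0n => /andP[_ jd] ->; split=> [i _|]; first exact: ler0n.
rewrite (bigD1 (Ordinal jd)) //= eqxx big1 ?addr0 // => i /negbTE.
by rewrite -val_eqE /= => ->.
Qed.

Lemma nth_verts d j : (j < d.+1)%N -> nth (fun=> 0) (verts d) j = (fun i => (i == j)%:R).
Proof. by move=> jd; rewrite (nth_map 0%N) ?size_iota // nth_iota. Qed.

Lemma lin_verts d (s : seq pt) : size s = d.+1 -> map (lin d.+1 s) (verts d) = s.
Proof.
move=> es; apply: (@eq_from_nth _ (fun=> 0)); rewrite size_map size_verts // => j jd.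
rewrite (nth_map (fun=> 0)) ?size_verts // nth_verts //; apply/funext => i.
rewrite /lin (bigD1 (Ordinal jd)) //= eqxx mul1r big1 ?addr0 // => a /negbTE.
by rewrite -val_eqE /= => ->; rewrite mul0r.
Qed.

Lemma delat_verts d (i : 'I_d.+2) : delat i (verts d.+1) = map (ins i 0) (verts d).
Proof.
apply: (@eq_from_nth _ (fun=> 0)).
  by rewrite size_map size_cat size_take size_drop !size_verts ltn_ord; have := ltn_ord i; lia.
rewrite size_cat size_take size_drop !size_verts ltn_ord => j.
have := ltn_ord i => li; rewrite subSS subnKC; last by rewrite -ltnS.
move=> jd; rewrite (nth_map (fun=> 0)) ?size_verts // nth_verts //.
rewrite nth_cat size_take size_verts li; case: ltnP => ij.
  rewrite nth_take // nth_verts; last by lia.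
  apply/funext => a; rewrite /ins; case: (ltnP a i) => // ai.
  have [->|ai'] := eqVneq a i; first by rewrite gtn_eqF.
  by congr ((nat_of_bool _)%:R); apply/idP/idP; lia.
rewrite nth_drop nth_verts; last by lia.
apply/funext => a; rewrite /ins; case: (ltnP a i) => // ai.
  by congr ((nat_of_bool _)%:R); apply/idP/idP; lia.
have [->|ai'] := eqVneq a i.
  by have -> : (i == (i.+1 + (j - i))%N :> nat) = false by lia.
by congr ((nat_of_bool _)%:R); apply/idP/idP; lia.
Qed.

Variable col : X -> nat.

Definition ext d (s : splx d -> X) (v : pt) : nat := col (s (tosplx d v)).

Definition sdcount (N d : nat) (s : splx d -> X) : int :=
  phig d.+1 (ext s) (iter N (sd (@bar R)) << verts d >>).

(** For fixed N this need not vanish on boundaries. It does on any given boundary in [Y] once N is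
    large, which suffices to compare two given chains. *)
Definition degN (N d : nat) (c : chn d) : int := fglift (fun s => sdcount N s : int^o) c.

Lemma allin_verts d N : allin (stdpt d) (iter N (sd (@bar R)) << verts d >>).
Proof. by apply: allin_iter_sd; [exact: cvx_stdpt|apply: suppU => v /stdpt_verts]. Qed.

Lemma vec_tosplx d v i : stdpt d v -> (i < d.+1)%N -> vec (set_val (tosplx d v)) i = v i.
Proof. by move=> sv id; rewrite /vec id tosplxK // mxE inordK. Qed.

Lemma sdcount_simp N d Psi (s : seq pt) : size s = d.+1 ->
  sdcount N (@simp R X d Psi s) = phig d.+1 (col \o Psi) (iter N (sd (@bar R)) << s >>).
Proof.
move=> es; rewrite -[in RHS](lin_verts es) -lmapU iter_sd_lmap; last exact: bar_lin.
rewrite phig_lmap; apply: (phig_ext_in _ (@allin_verts d N)) => v sv.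
rewrite /ext /simp /=; congr (col (Psi _)).
apply/funext => i; rewrite /lin; apply: eq_bigr => a _.
by rewrite vec_tosplx.
Qed.

Lemma degN_cubechain N d Psi : degN N (@cubechain R X d Psi) =
  phig d.+1 (col \o Psi) (iter N (sd (@bar R)) (kuhn R d)).
Proof.
pose G c : int := phig d.+1 (col \o Psi) (iter N (sd (@bar R)) c).
have GE c : G c = fglift (fun s => G << s >> : int^o) c.
  by apply: (@fglift_additiveE _ int^o G) => c' c''; rewrite /G iter_sdB phigB.
rewrite -/(G _) GE /degN /cubechain /sing fglift_comp.
apply: (fglift_supp (M := int^o) _ (@hom_kuhn R d)) => s es.
by rewrite (@fgliftU _ int^o) sdcount_simp.
Qed.

Lemma ins_stdpt d (i : 'I_d.+2) v : stdpt d v -> stdpt d.+1 (ins i 0 v).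
Proof.
move=> [v0 v1]; split=> [a ad|].
  have li := ltn_ord i; rewrite /ins; case: ltnP => ai; first by apply: v0; lia.
  by case: eqP => // ?; apply: v0; lia.
rewrite (bigD1_ord i) //= /ins ltnn eqxx add0r -[RHS]v1; apply: eq_bigr => j _.
rewrite /= /bump; case: (leqP i j) => ij; rewrite ?add1n ?add0n ?ij //.
have -> : (j.+1 < i)%N = false by apply/negbTE; rewrite -leqNgt ltnW.
by rewrite gtn_eqF.
Qed.

Lemma face_tosplx d (i : 'I_d.+2) v : stdpt d v ->
  face i (tosplx d v) = tosplx d.+1 (ins i 0 v).
Proof.
move=> sv; apply: val_inj; rewrite -[LHS]/(insert0 i (set_val (tosplx d v))).
rewrite tosplxK // -[RHS]/(set_val (tosplx d.+1 (ins i 0 v))) tosplxK; last exact: ins_stdpt.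
apply/rowP => j; rewrite !mxE /ins; case: unliftP => [k|] ->; last by rewrite ltnn eqxx.
rewrite mxE /= /bump; case: (leqP i k) => ik; rewrite ?add1n ?add0n ?ik //.
have -> : (k.+1 < i)%N = false by apply/negbTE; rewrite -leqNgt ltnW.
by rewrite gtn_eqF.
Qed.

Lemma degN_bd N d (t : splx d.+1 -> X) : degN N (bd << t >> : chn d) =
  phig d.+1 (ext t) (dl (iter N (sd (@bar R)) << verts d.+1 >>)).
Proof.
pose G c : int := phig d.+1 (ext t) (iter N (sd (@bar R)) c).
have GE c : G c = fglift (fun s => G << s >> : int^o) c.
  by apply: (@fglift_additiveE _ int^o G) => c' c''; rewrite /G iter_sdB phigB.
rewrite dl_iter_sd -/(G _) GE dlU dseqE size_verts /bd fgliftU.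
rewrite /degN !(@fglift_sum _ int^o); apply: eq_bigr => i _.
rewrite freegU_mulrz [in RHS]freegU_mulrz !(@fglift_mulz _ int^o) !(@fgliftU _ int^o).
congr (_ *~ _); rewrite delat_verts -lmapU /G iter_sd_lmap; last by move=> s; exact: bar_ins.
rewrite phig_lmap; apply: (phig_ext_in _ (@allin_verts d N)) => v sv.
by rewrite /ext /= face_tosplx.
Qed.

Lemma degNB N d (c c' : chn d) : degN N (c - c') = degN N c - degN N c'.
Proof. exact: (@fgliftB _ int^o (fun s => sdcount N s)). Qed.
Lemma degND N d (c c' : chn d) : degN N (c + c') = degN N c + degN N c'.
Proof. exact: (@fgliftD _ int^o (fun s => sdcount N s)). Qed.
Lemma degN_mulz N d (c : chn d) m : degN N (c *~ m) = degN N c *~ m.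
Proof. exact: (@fglift_mulz _ int^o (fun s => sdcount N s)). Qed.

Variables (d : nat) (Y B : set X) (D : nat -> set X).
Hypothesis col_le : forall x, (col x <= d.+1)%N.
Hypothesis col_B : forall x, B x -> col x = d.+1.
(** The colour classes are not closed. Enlarging them within [Y] to closed sets without a common
    point makes the complements an open cover of [Y]. *)
Hypothesis D_closed : forall a, closed (D a).
Hypothesis col_D : forall x, Y x -> D (col x) x.
Hypothesis D_empty : forall x, Y x -> exists2 a, (a <= d.+1)%N & ~ D a x.

Lemma degN_in_B N (c : chn d) : chain_in B c -> degN N c = 0.
Proof.
move=> /chain_in_supp cB.
rewrite /degN (fglift_supp (M := int^o) (g := fun=> 0) _ cB) ?fglift_cst0 // => s [_ sB].
rewrite /sdcount (phig_missing (a := 0%N)) //.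
  by apply: hom_iter_sd; apply: suppU; exact: size_verts.
by apply: suppS (@allin_verts d N) => s' _ v _; rewrite /ext col_B.
Qed.

Lemma compact_stdsimplex e : compact (@stdsimplex R e).
Proof.
apply: (@subclosed_compact _ _ [set x : 'rV[R]_e.+1 | forall i, `[0, 1]%classic (x 0 i)]).
- have -> : @stdsimplex R e =\bigcap_(i in [set: 'I_e.+1]) [set x | 0 <= x 0 i] `&`
    [set x | \sum_i x 0 i = 1].
  by apply/seteqP; split => x [h1 h2]; split => // i; [move=> _; exact: h1|exact: h1].
apply: closedI.
  apply: closed_bigI => i _.
  apply: (@closed_comp _ _ (fun x : 'rV[R]_e.+1 => x 0 i) [set y | 0 <= y]).
    by move=> x _; exact: coord_continuous.
  exact: closed_ge.
apply: (@closed_comp _ _ (fun x : 'rV[R]_e.+1 => \sum_i x 0 i) [set y | y = 1]).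
  move=> x _; apply: (@continuous_sumR R 'rV[R]_e.+1 _ _ (fun i x => x 0 i)) => i.
  exact: coord_continuous.
exact: closed_eq.
- by apply: (@rV_compact R e.+1 (fun=> `[0, 1]%classic)) => _; exact: segment_compact.
- move=> x [x0 x1] i; rewrite /= in_itv /= x0 /= -x1 (bigD1 i) //= lerDl.
  by apply: sumr_ge0 => ? _; exact: x0.
Qed.

(** The complements of the [D a] pull back to an open cover of the compact simplex. Points within a
    Lebesgue number of each other all avoid one [D a], hence the colour a. *)
Lemma lebesgue_colour e (t : splx e -> X) : continuous t -> (forall x, Y (t x)) ->
  exists2 r, 0 < r & forall s : seq pt, (forall v, v \in s -> stdpt e v) -> mesh_le r s ->
    exists2 a, (a <= d.+1)%N & forall v, v \in s -> ext t v <> a.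
Proof.
move=> ct tY.
pose sp (y : 'rV[R]_e.+1) : splx e := insubd (SigSub (e0_std e) : splx e) y.
have spK y : @stdsimplex R e y -> set_val (sp y) = y.
  by move=> /mem_set ey; rewrite set_valE /= val_insubd ey.
pose P (r : R) (x : 'rV[R]_e.+1) := exists2 a, (a <= d.+1)%N &
  forall y, @stdsimplex R e y -> ball x r y -> ~ D a (t (sp y)).
have : \forall r \near 0^'+, @stdsimplex R e `<=` P r.
  move/compact_near_coveringP: (@compact_stdsimplex e); apply => x xK.
  have [a ad nD] := D_empty (tY (sp x)).
  have : nbhs (sp x) (t @^-1` (~` D a)).
    by apply: ct; apply: open_nbhs_nbhs; split => //; exact: closed_openC.
  rewrite nbhsE => -[W [[Z oZ OW] Wx] WU].
  have : nbhs x Z.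
    by apply: open_nbhs_nbhs; split => //; rewrite -(spK x xK); rewrite -OW in Wx.
  move=> /nbhs_ballP[r /= r0 rZ].
  (* The radius is halved so that a small ball about a point near x stays in the ball of radius r
     about x. *)
  have r2 : 0 < r / 2 by rewrite divr_gt0.
  exists (ball x (r / 2), [set s | s < r / 2]).
    by split; [exact: nbhsx_ballx|exact: nbhs_right_lt].
  case=> x' s /= [bx sr]; exists a => // y yK by'.
  apply: (WU (sp y)); rewrite -OW /= spK //; apply: rZ.
  rewrite [r]splitr; apply: ball_triangle bx _.
  by apply: le_ball by'; exact: ltW.
move=> h.
have [r [r0 hr]] : exists r : R, 0 < r /\ @stdsimplex R e `<=` P r.
  have [r []] := @filter_ex _ _ (at_right_proper_filter (0 : R)) _ (filterI h (nbhs_right_gt 0)).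
  by move=> hr r0; exists r.
exists (r / 2) => [|s ss fs]; first by rewrite divr_gt0.
case: s ss fs => [|v s] ss fs; first by exists 0%N.
have sv : stdpt e v by apply: ss; rewrite mem_head.
have [a ad ha] := hr (rowof e v) (set_mem (rowof_std sv)).
exists a => // w ws E; apply: (ha (rowof e w) (set_mem (rowof_std (ss _ ws)))).
  split=> [|i j]; first exact: r0.
  rewrite !mxE /ball /=; apply: le_lt_trans (fs _ _ (mem_head _ _) ws j) _.
  by rewrite ltr_pdivrMr // mulr_natr mulr2n ltrDl.
by rewrite -E; apply: col_D.
Qed.

(** The depth given by Lebesgue's number depends on the singular simplex; a chain has finitely many,
    so a maximum exists. *)
Lemma degN_bd_eq0 (b : chn d.+1) : chain_in Y b ->
  exists N0, forall N, (N0 <= N)%N -> degN N (bd b) = 0.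
Proof.
move=> /chain_in_supp bY.
have one (t : splx d.+1 -> X) : continuous t -> (forall x, Y (t x)) ->
    exists N0, forall N, (N0 <= N)%N -> degN N (bd << t >> : chn d) = 0.
  move=> ct tY; have [r r0 hr] := lebesgue_colour ct tY.
  have [N0 hN0] := @mesh_to0 R d.+1 1 r ler01 r0.
  exists N0 => N /hN0 hN; rewrite degN_bd.
  have fv : supp (mesh_le (1 : R)) << verts d.+1 >>.
    apply: suppU => v v' /mapP[j _ ->] /mapP[j' _ ->] i.
    by case: (i == j); case: (i == j');
      rewrite ?subrr ?subr0 ?sub0r ?normrN ?normr1 ?normr0.
  have hv : hom d.+2 << verts d.+1 >> by apply: suppU; exact: size_verts.
  have F : supp (fun s : seq pt => (forall v, v \in s -> stdpt d.+1 v) /\ mesh_le r s)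
      (iter N (sd (@bar R)) << verts d.+1 >>).
    move=> s hs; split; first exact: (@allin_verts d.+1 N s hs).
    move=> v v' vs vs' i; apply: le_trans hN.
    exact: (@mesh_le_iter_sd R _ _ _ N ler01 hv fv s hs).
  apply: (phig_dl (@hom_iter_sd R _ _ N hv) F) => [v|s [ss fs]]; first exact: col_le.
  exact: hr.
have many (r : seq (splx d.+1 -> X)) : (forall t, t \in r -> continuous t /\ forall x, Y (t x)) ->
    exists N0, forall N, (N0 <= N)%N -> forall t, t \in r -> degN N (bd << t >> : chn d) = 0.
  elim: r => [|t r IH] hr; first by exists 0%N.
  have [ct tY] := hr t (mem_head _ _).
  have [N1 h1] := one t ct tY.
  have [N2 h2] : exists N0, forall N, (N0 <= N)%N ->
      forall t, t \in r -> degN N (bd << t >> : chn d) = 0.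
    by apply: IH => t' t'r; apply: hr; rewrite inE t'r orbT.
  exists (maxn N1 N2) => N; rewrite geq_max => /andP[/h1 g1 /h2 g2] t'.
  by rewrite inE => /orP[/eqP->|/g2].
have [N0 hN0] := many (dom b) bY; exists N0 => N /hN0 h.
pose G (c : chn d.+1) : int := degN N (bd c).
have GE c : G c = fglift (fun s => G << s >> : int^o) c.
  by apply: (@fglift_additiveE _ int^o G) => c' c''; rewrite /G bdB degNB.
rewrite -/(G b) GE (fglift_supp (M := int^o) (Q := fun s => s \in dom b) (g := fun=> 0)) ?fglift_cst0 //.
Qed.

(* The value of [degN] on the cubechain is 1, so [m] divides 1. *)
Theorem cubechain_primitive (Psi : pt -> X) (o : chn d) m :
  (forall v, cube d v -> core d v -> col (Psi v) = colour d v) ->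
  (forall v, cube d v -> ~ core d v -> col (Psi v) = d.+1) ->
  rel_homologous Y B (cubechain d Psi) (o *~ m) -> m = 1 \/ m = -1.
Proof.
move=> hc ho [b [a [bY aB E]]].
have [N1 h1] := @phig_kuhn_iter R d (col \o Psi) hc ho (fun v => col_le _).
have [N2 h2] := degN_bd_eq0 bY.
have := congr1 (@degN (maxn N1 N2) d) E.
rewrite degNB degND (h2 _ (leq_maxr _ _)) (degN_in_B _ aB) degN_cubechain.
rewrite (h1 _ (leq_maxl _ _)) addr0 degN_mulz => /eqP; rewrite subr_eq0 => /eqP.
rewrite mulrzz => /esym/eqP H.
have : (degN (maxn N1 N2) o * m \is a GRing.unit) by move/eqP: H => ->; exact: unitr1.
rewrite unitrM => /andP[_]; rewrite qualifE /= => /orP[/eqP|/eqP]; [by left|by right].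
Qed.

End Degree.

(** * Pivots and rotations *)

Section Rotation.
Variables (R : realType) (n : nat).
Implicit Types (V : {vspace 'rV[R]_n}) (i : 'I_n.-1) (c s : R).

Definition lo i : 'I_n := Ordinal (ltnW (srefl_subproof i)).
Definition hi i : 'I_n := Ordinal (srefl_subproof i).

Lemma hi_lo i : (hi i == lo i) = false.
Proof. by apply/negbTE; rewrite -val_eqE /= gtn_eqF. Qed.
Lemma sreflE i : srefl i = tperm (lo i) (hi i).
Proof. by []. Qed.

Definition rot m i c s (A : 'M[R]_(m, n)) : 'M[R]_(m, n) :=
  \matrix_(p, q) if q == lo i then A p (lo i) * c - A p (hi i) * s
                 else if q == hi i then A p (lo i) * s + A p (hi i) * c else A p q.

Lemma rot_is_linear m i c s : linear (@rot m i c s).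
Proof.
move=> a A B; apply/matrixP => p q; rewrite !mxE.
case: ifP => _; first by ring.
case: ifP => _; first by ring.
by [].
Qed.

HB.instance Definition _ m i c s :=
  GRing.isLinear.Build R 'M[R]_(m, n) 'M[R]_(m, n) _ (@rot m i c s) (@rot_is_linear m i c s).

(** This is the product of the complex numbers c + is and c' + is', whence also the inverse in
    [rotK]. *)
Lemma rot_comp m i c s c' s' (A : 'M[R]_(m, n)) :
  rot i c' s' (rot i c s A) = rot i (c * c' - s * s') (c * s' + s * c') A.
Proof.
apply/matrixP => p q; rewrite !mxE eqxx hi_lo eqxx.
case: ifP => E1; first by ring.
case: ifP => E2; first by ring.
by rewrite E1 E2.
Qed.

Lemma rot1 m i (A : 'M[R]_(m, n)) : rot i 1 0 A = A.
Proof.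
apply/matrixP => p q; rewrite !mxE.
case: eqP => [->|_]; first by ring.
by case: eqP => [->|_] //; ring.
Qed.

Lemma rotK m i c s (A : 'M[R]_(m, n)) : c ^+ 2 + s ^+ 2 != 0 ->
  rot i (c / (c ^+ 2 + s ^+ 2)) (- s / (c ^+ 2 + s ^+ 2)) (rot i c s A) = A.
Proof.
move=> N0; rewrite rot_comp -[RHS](rot1 i); congr (rot _ _ _ _); by field.
Qed.

Lemma rotVK m i c s (A : 'M[R]_(m, n)) : c ^+ 2 + s ^+ 2 != 0 ->
  rot i c s (rot i (c / (c ^+ 2 + s ^+ 2)) (- s / (c ^+ 2 + s ^+ 2)) A) = A.
Proof.
move=> N0; rewrite rot_comp -[RHS](rot1 i); congr (rot _ _ _ _); by field.
Qed.

Definition actV i c s V : {vspace 'rV[R]_n} := (linfun (@rot 1 i c s) @: V)%VS.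

Lemma mem_actV i c s V v : v \in V -> rot i c s v \in actV i c s V.
Proof. by move=> vV; apply/memv_imgP; exists v => //; rewrite lfunE. Qed.

Lemma actVP i c s V v : v \in actV i c s V -> exists2 u, u \in V & v = rot i c s u.
Proof. by move=> /memv_imgP[u uV ->]; exists u => //; rewrite lfunE. Qed.

Lemma dim_actV i c s V : c ^+ 2 + s ^+ 2 != 0 -> \dim (actV i c s V) = \dim V.
Proof.
move=> N0; apply: limg_dim_eq; suff -> : lker (linfun (@rot 1 i c s)) = 0%VS by rewrite capv0.
apply/eqP/lker0P => u v; rewrite !lfunE /= => E.
by rewrite -(rotK i u N0) E rotK.
Qed.

Lemma actV_id i V : actV i 1 0 V = V.
Proof.
apply/vspaceP => v; apply/idP/idP => [/actVP[u uV ->]|vV]; first by rewrite rot1.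
by rewrite -(rot1 i v) mem_actV.
Qed.

Lemma actV_comp i c s c' s' V :
  actV i c' s' (actV i c s V) = actV i (c * c' - s * s') (c * s' + s * c') V.
Proof.
apply/vspaceP => v; apply/idP/idP.
  by move=> /actVP[u /actVP[u' uV ->] ->]; rewrite rot_comp mem_actV.
by move=> /actVP[u uV ->]; rewrite -rot_comp !mem_actV.
Qed.

Lemma actVK i c s V : c ^+ 2 + s ^+ 2 != 0 ->
  actV i (c / (c ^+ 2 + s ^+ 2)) (- s / (c ^+ 2 + s ^+ 2)) (actV i c s V) = V.
Proof. by move=> N0; rewrite actV_comp -[RHS](actV_id i); congr (actV _ _ _ _); field. Qed.

Lemma actVVK i c s V : c ^+ 2 + s ^+ 2 != 0 ->
  actV i c s (actV i (c / (c ^+ 2 + s ^+ 2)) (- s / (c ^+ 2 + s ^+ 2)) V) = V.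
Proof. by move=> N0; rewrite actV_comp -[RHS](actV_id i); congr (actV _ _ _ _); field. Qed.

Lemma rowspan_rot k i c s (A : 'M[R]_(k, n)) :
  rowspan (rot i c s A) = actV i c s (rowspan A).
Proof.
rewrite /rowspan /actV limg_span; congr span.
rewrite -map_comp; apply: eq_map => p /=; rewrite lfunE /=.
by apply/rowP => q; rewrite !mxE.
Qed.

End Rotation.

Section Pivots.
Variables (R : realType) (n : nat).
Implicit Types (V : {vspace 'rV[R]_n}) (i : 'I_n.-1) (c s : R) (v : 'rV[R]_n).

Lemma mem_flag j v : v \in flag R n j <-> forall p : 'I_n, (j <= p)%N -> v 0 p = 0.
Proof.
split=> [|h].
  move=> /(coord_span (X := in_tuple _)) -> p jp; rewrite summxE big1 // => l _.
  rewrite mxE; apply/eqP; rewrite mulf_eq0; apply/orP; right; apply/eqP.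
  have : (in_tuple [seq delta_mx 0 j0 | j0 : 'I_n <- enum 'I_n & (j0 < j)%N])`_l \in
      [seq (delta_mx 0 j0 : 'rV[R]_n) | j0 : 'I_n <- enum 'I_n & (j0 < j)%N].
    by apply: mem_nth; exact: ltn_ord.
  case/mapP => q; rewrite mem_filter => /andP[qj _] ->.
  rewrite mxE eqxx /=; case: eqP => // E; move: qj; rewrite -E => qj; lia.
rewrite (row_sum_delta v); apply: memv_suml => p _.
case: (ltnP p j) => pj; last by rewrite h // scale0r mem0v.
apply/memvZ/memv_span/map_f; by rewrite mem_filter pj mem_enum.
Qed.

Definition dj V j := \dim (V :&: flag R n j)%VS.

(** The index set in [schubert_cell]; by [pivotP] it consists of the positions of the last nonzero
    entries of vectors of V. *)
Definition pivot V : {set 'I_n} := [set p : 'I_n | (dj V p < dj V p.+1)%N]%SET.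

Lemma flagS j j' : (j <= j')%N -> (flag R n j <= flag R n j')%VS.
Proof.
move=> jj; apply/subvP => v /mem_flag h; apply/mem_flag => p jp; apply: h.
exact: leq_trans jp.
Qed.

Lemma dj_mono V j j' : (j <= j')%N -> (dj V j <= dj V j')%N.
Proof. by move=> jj; apply/dimvS/capvS => //; exact: flagS. Qed.

Lemma pivotP V (p : 'I_n) : reflect
  (exists v, [/\ v \in V, v 0 p != 0 & forall q : 'I_n, (p < q)%N -> v 0 q = 0])
  (p \in pivot V).
Proof.
have sub : (V :&: flag R n p <= V :&: flag R n p.+1)%VS by apply/capvS => //; exact: flagS.
apply: (iffP idP); rewrite inE.
  move=> h; have : ~~ (V :&: flag R n p.+1 <= V :&: flag R n p)%VS.
    by apply: contraL h => /dimvS; rewrite -leqNgt.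
  move=> /subvPn[v]; rewrite memv_cap => /andP[vV /mem_flag vf] nv.
  exists v; split => //.
  apply: contra nv => /eqP vp; rewrite memv_cap vV; apply/mem_flag => q.
  by rewrite leq_eqVlt => /orP[/eqP pq|/vf//]; rewrite -(val_inj pq).
move=> [v [vV vp vq]]; rewrite ltn_neqAle dimvS // andbT; apply/negP => E.
have : (V :&: flag R n p)%VS == (V :&: flag R n p.+1)%VS by rewrite eqEdim sub -/(dj V p) -/(dj V p.+1) (eqP E) leqnn.
move=> /eqP eV; have : v \in (V :&: flag R n p.+1)%VS.
  by rewrite memv_cap vV; apply/mem_flag => q /vq.
by rewrite -eV memv_cap => /andP[_ /mem_flag/(_ p (leqnn _)) v0]; rewrite v0 eqxx in vp.
Qed.

Lemma dj0 V : dj V 0 = 0%N.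
Proof.
apply/eqP; rewrite dimv_eq0 -subv0; apply/subvP => v.
rewrite memv_cap memv0 => /andP[_ /mem_flag h]; apply/eqP/rowP => p.
by rewrite h // mxE.
Qed.

Lemma djn V : dj V n = \dim V.
Proof.
rewrite /dj; suff -> : flag R n n = fullv by rewrite capvf.
apply/eqP; rewrite eqEsubv subvf; apply/subvP => v _.
by apply/mem_flag => p; rewrite leqNgt ltn_ord.
Qed.

Lemma djS V j : (dj V j.+1 <= (dj V j).+1)%N.
Proof.
have [jn|nj] := ltnP j n; last first.
  apply: leqW; apply/dimvS/capvS => //; apply/subvP => v _; apply/mem_flag => p.
  by move=> jp; have := ltn_ord p; lia.
pose p := Ordinal jn.
have [pp|/negbTE np] := boolP (p \in pivot V); last first.
  by apply: leqW; move: np; rewrite inE => /negbT; rewrite -leqNgt.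
case/pivotP: pp => v [vV vp vq].
have : (V :&: flag R n j.+1 <= V :&: flag R n j + <[v]>)%VS.
  apply/subvP => u; rewrite memv_cap => /andP[uV /mem_flag uf].
  rewrite -(subrK ((u 0 p / v 0 p) *: v) u); apply: memv_add; last by rewrite memvZ ?memv_line.
  rewrite memv_cap rpredB ?rpredZ //=; apply/mem_flag => q.
  rewrite !mxE leq_eqVlt => /orP[/eqP pq|jq].
    by have -> : q = p by [apply: val_inj]; rewrite divfK // subrr.
  by rewrite (uf q jq) (vq q jq) mulr0 subr0.
move=> /dimvS h; apply: (leq_trans h); apply: (leq_trans (dimv_add_leqif _ _)).
by rewrite addnC dim_vline; case: (v != 0) => //; rewrite add0n leqnSn.
Qed.

Definition below (P : {set 'I_n}) j := #|[set p in P | (p < j)%N]|.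

Lemma belowS (P : {set 'I_n}) (p : 'I_n) : below P p.+1 = (below P p + (p \in P))%N.
Proof.
rewrite /below; case: (boolP (p \in P)) => pP.
  have -> : [set p0 in P | (p0 < p.+1)%N] = (p |: [set p0 in P | (p0 < p)%N])%SET.
    apply/setP => q; rewrite !inE ltnS leq_eqVlt -val_eqE.
    by case: eqP => //= E; rewrite andbT (val_inj E) pP.
  by rewrite cardsU1 inE ltnn andbF addn1.
rewrite addn0; apply: eq_card => q; rewrite !inE ltnS leq_eqVlt.
by case: eqP => //= E; rewrite (val_inj E) (negbTE pP).
Qed.

Lemma below0 P : below P 0 = 0%N.
Proof. by rewrite /below; apply: eq_card0 => q; rewrite !inE andbF. Qed.

Lemma belown P : below P n = #|P|.
Proof. by rewrite /below; apply: eq_card => q; rewrite !inE ltn_ord andbT. Qed.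

Lemma dj_below V j : (j <= n)%N -> dj V j = below (pivot V) j.
Proof.
elim: j => [|j IH] jn; first by rewrite dj0 below0.
rewrite (belowS _ (Ordinal jn)) -IH; last exact: ltnW.
rewrite inE /=; have := djS V j; have := @dj_mono V j j.+1 (leqnSn j).
by case: ltnP => /=; lia.
Qed.

Lemma card_pivot V : #|pivot V| = \dim V.
Proof. by rewrite -belown -dj_below // djn. Qed.

End Pivots.

(** * Effect of a rotation on the pivots *)

Section PivotRotation.
Variables (R : realType) (n : nat).
Implicit Types (V : {vspace 'rV[R]_n}) (i : 'I_n.-1) (c s : R) (v : 'rV[R]_n)
  (P : {set 'I_n}).

Lemma rot_off i c s v (q : 'I_n) : q != lo i -> q != hi i -> rot i c s v 0 q = v 0 q.
Proof. by move=> /negbTE ql /negbTE qh; rewrite mxE ql qh. Qed.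
Lemma rot_lo i c s v : rot i c s v 0 (lo i) = v 0 (lo i) * c - v 0 (hi i) * s.
Proof. by rewrite mxE eqxx. Qed.
Lemma rot_hi i c s v : rot i c s v 0 (hi i) = v 0 (lo i) * s + v 0 (hi i) * c.
Proof. by rewrite mxE hi_lo eqxx. Qed.

Lemma pivot_off_sub i c s V (q : 'I_n) : q != lo i -> q != hi i ->
  q \in pivot V -> q \in pivot (actV i c s V).
Proof.
move=> ql qh /pivotP[v [vV vq vr]]; apply/pivotP; exists (rot i c s v); split.
- exact: mem_actV.
- by rewrite rot_off.
move=> r qr; have nq : q != lo i :> nat by [].
have [E|rl] := eqVneq r (lo i).
  by rewrite E rot_lo !vr ?mul0r ?subrr //= -?E //; rewrite E /= in qr; lia.
have [E|rh] := eqVneq r (hi i).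
  have lq : (q < lo i)%N by rewrite E /= in qr; move: nq => /=; lia.
  by rewrite E rot_hi !vr ?mul0r ?addr0 // -E.
by rewrite rot_off // vr.
Qed.

Lemma pivot_off i c s V (q : 'I_n) : c ^+ 2 + s ^+ 2 != 0 -> q != lo i -> q != hi i ->
  (q \in pivot (actV i c s V)) = (q \in pivot V).
Proof.
move=> N0 ql qh; apply/idP/idP; last exact: pivot_off_sub.
by move=> /(pivot_off_sub (c / (c ^+ 2 + s ^+ 2)) (- s / (c ^+ 2 + s ^+ 2)) ql qh); rewrite actVK.
Qed.

Lemma pivot_count i c s V : c ^+ 2 + s ^+ 2 != 0 ->
  ((lo i \in pivot (actV i c s V)) + (hi i \in pivot (actV i c s V)) =
   (lo i \in pivot V) + (hi i \in pivot V))%N.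
Proof.
move=> N0; have := card_pivot (actV i c s V); rewrite dim_actV // -card_pivot.
rewrite (cardsD1 (lo i)) (cardsD1 (hi i) (_ :\ _)) [in RHS](cardsD1 (lo i)).
rewrite [in X in _ = X](cardsD1 (hi i) (_ :\ _)) !in_setD1 hi_lo /=.
have -> : pivot (actV i c s V) :\ lo i :\ hi i = pivot V :\ lo i :\ hi i.
  apply/setP => q; rewrite !in_setD1.
  by have [//|qh] := eqVneq q (hi i); have [//|ql] := eqVneq q (lo i); rewrite pivot_off.
by rewrite !addnA => /addIn.
Qed.

Definition swapset i P : {set 'I_n} := [set srefl i p | p in P].

Lemma in_swapset i P q : (q \in swapset i P) = (srefl i q \in P).
Proof.
apply/imsetP/idP => [[p pP ->]|h]; first by rewrite sreflE tpermK.
by exists (srefl i q) => //; rewrite sreflE tpermK.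
Qed.

Lemma srefl_lo i : srefl i (lo i) = hi i. Proof. by rewrite sreflE tpermL. Qed.
Lemma srefl_hi i : srefl i (hi i) = lo i. Proof. by rewrite sreflE tpermR. Qed.
Lemma srefl_off i q : q != lo i -> q != hi i -> srefl i q = q.
Proof. by move=> ql qh; rewrite sreflE tpermD // eq_sym. Qed.

Lemma pivot_same i c s V : c ^+ 2 + s ^+ 2 != 0 ->
  (lo i \in pivot (actV i c s V)) = (lo i \in pivot V) ->
  pivot (actV i c s V) = pivot V.
Proof.
move=> N0 El; have := pivot_count i V N0; rewrite El => /addnI Eh.
apply/setP => q; have [->|ql] := eqVneq q (lo i); first exact: El.
have [->|qh] := eqVneq q (hi i); last exact: pivot_off.
by move: Eh; case: (_ \in _); case: (_ \in _).
Qed.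

Lemma pivot_cases i c s V : c ^+ 2 + s ^+ 2 != 0 ->
  pivot (actV i c s V) = pivot V \/
  ((lo i \in pivot V) != (hi i \in pivot V) /\
   pivot (actV i c s V) = swapset i (pivot V)).
Proof.
move=> N0; have C := pivot_count i V N0.
case: (boolP ((lo i \in pivot (actV i c s V)) == (lo i \in pivot V))) => [/eqP E|E].
  by left; exact: pivot_same.
right; split; first by move: C E; do 4!case: (_ \in _).
apply/setP => q; rewrite in_swapset.
have [->|ql] := eqVneq q (lo i).
  by rewrite srefl_lo; move: C E; do 4!case: (_ \in _).
have [->|qh] := eqVneq q (hi i); last by rewrite srefl_off // pivot_off.
by rewrite srefl_hi; move: C E; do 4!case: (_ \in _).
Qed.

Lemma pivot_zero V v (p : 'I_n) : v \in V -> p \notin pivot V ->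
  (forall q : 'I_n, (p < q)%N -> v 0 q = 0) -> v 0 p = 0.
Proof.
by move=> vV np vq; apply: contraNeq np => vp; apply/pivotP; exists v.
Qed.

Lemma gt_hi i (q : 'I_n) : (hi i < q)%N -> (q != lo i) * (q != hi i) * (lo i < q)%N.
Proof.
rewrite /= => h; split; last by rewrite /=; lia.
by split; rewrite -val_eqE /=; apply/eqP => E; rewrite E in h; lia.
Qed.

(** Otherwise the rotated space has a vector whose last nonzero entry is at [lo i]. Its preimage u
    vanishes beyond [hi i], and at [hi i] since this is no pivot of V; the rotated entry at [hi i]
    is then s times u at [lo i], so u vanishes there as well. *)
Lemma pivot_up i c s V : c ^+ 2 + s ^+ 2 != 0 -> s != 0 ->
  lo i \in pivot V -> hi i \notin pivot V ->
  pivot (actV i c s V) = swapset i (pivot V).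
Proof.
move=> N0 s0 lV hV; have [E|[]//] := pivot_cases i V N0.
have /pivotP[v [/actVP[u uV ->] vl vq]] : lo i \in pivot (actV i c s V) by rewrite E.
have uh0 (q : 'I_n) : (hi i < q)%N -> u 0 q = 0.
  move=> hq; have gq := gt_hi hq; have := vq q; rewrite rot_off ?gq //; exact.
have uh : u 0 (hi i) = 0 by exact: pivot_zero hV uh0.
have := vq (hi i) (leqnn _); rewrite rot_hi uh mul0r addr0 => /eqP.
rewrite mulf_eq0 (negbTE s0) orbF => /eqP ul.
by move: vl; rewrite rot_lo ul uh !mul0r subrr eqxx.
Qed.

(* A rational half circle from (1, 0) to (-1, 0) around the origin, used in
   place of (cos, sin): spans do not see the norm of a rotation. *)
Definition cc (t : R) := 1 - 2 * t.
Definition ss (t : R) := t * (1 - t).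

Lemma ccss_neq0 t : cc t ^+ 2 + ss t ^+ 2 != 0.
Proof.
rewrite paddr_eq0 ?sqr_ge0 // !sqrf_eq0 /cc /ss mulf_eq0; apply/negP.
move=> /andP[/eqP c0 /orP[/eqP t0|/eqP t1]]; lra.
Qed.

Lemma ss_gt0 t : 0 < t < 1 -> 0 < ss t.
Proof. by move=> /andP[? ?]; rewrite /ss mulr_gt0 // subr_gt0. Qed.

Lemma cc_ss_surj (x y : R) : y != 0 -> exists2 t, 0 < t < 1 & ss t * x = cc t * y.
Proof.
move=> y0; pose m := x / y; pose r := Num.sqrt (m ^+ 2 + 4).
have r2 : r ^+ 2 = m ^+ 2 + 4 by rewrite sqr_sqrtr // addr_ge0 // sqr_ge0.
have r0 : 0 <= r by exact: sqrtr_ge0.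
have rm : `|m| < r.
  rewrite -(@ltr_pXn2r _ 2) // ?nnegrE // r2 real_normK ?num_real //; lra.
have D2 : 2 < m + 2 + r by move: rm; rewrite ltr_norml => /andP[? ?]; lra.
have D0 : m + 2 + r != 0 by rewrite gt_eqF //; lra.
(* With m = x / y the equation reads m t^2 - (m + 2) t + 1 = 0, of discriminant m^2 + 4. The root is
   written with the square root in the denominator, which also covers m = 0. *)
exists (2 / (m + 2 + r)).
  by rewrite divr_gt0 ?ltr_pdivrMr ?mul1r //=; lra.
have -> : x = m * y by rewrite /m divfK.
rewrite mulrA; congr (_ * y); rewrite /ss /cc.
apply: (mulIf (x := (m + 2 + r) ^+ 2)); first by rewrite expf_neq0.
have -> : 2 / (m + 2 + r) * (1 - 2 / (m + 2 + r)) * m * (m + 2 + r) ^+ 2 =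
  2 * (m + r) * m by field.
have -> : (1 - 2 * (2 / (m + 2 + r))) * (m + 2 + r) ^+ 2 =
  (m + r - 2) * (m + 2 + r) by field.
by move: r2; rewrite !expr2 => r2; lra.
Qed.

Lemma ccss_inj t t' : 0 < t < 1 -> 0 < t' < 1 -> cc t * ss t' = cc t' * ss t -> t = t'.
Proof.
rewrite /cc /ss => /andP[t0 t1] /andP[t0' t1'] E.
(* Up to sign this is the difference of the two sides of [E]; the second factor is positive on the
   open interval. *)
have : (t - t') * (t * t' + (1 - t) * (1 - t')) = 0 by lra.
move/eqP; rewrite mulf_eq0 => /orP[/eqP|/eqP] H; first lra.
have := mulr_gt0 t0 t0'; have : 0 < (1 - t) * (1 - t') by apply: mulr_gt0; lra.
lra.
Qed.

(** The parameter t is chosen so that turning back clears the entry at [hi i] of a vector ending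
    there. Its last entry moves to [lo i], and counting pivots excludes [hi i]. *)
Lemma pivot_down i V : lo i \notin pivot V -> hi i \in pivot V ->
  exists2 t, 0 < t < 1 & exists2 W, V = actV i (cc t) (ss t) W &
    (lo i \in pivot W) && (hi i \notin pivot W).
Proof.
move=> lV /pivotP[v [vV vh vq]].
have [t t01 E] := cc_ss_surj (v 0 (lo i)) vh; exists t => //.
have N0 := ccss_neq0 t; set c := cc t in E N0 *; set s := ss t in E N0 *.
pose W := actV i (c / (c ^+ 2 + s ^+ 2)) (- s / (c ^+ 2 + s ^+ 2)) V.
have EV : V = actV i c s W by rewrite /W actVVK.
exists W => //.
pose u := rot i (c / (c ^+ 2 + s ^+ 2)) (- s / (c ^+ 2 + s ^+ 2)) v.
have uW : u \in W by exact: mem_actV.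
have uh : u 0 (hi i) = 0.
  rewrite rot_hi; have -> : v 0 (lo i) * (- s / (c ^+ 2 + s ^+ 2)) +
    v 0 (hi i) * (c / (c ^+ 2 + s ^+ 2)) = (c * v 0 (hi i) - s * v 0 (lo i)) / (c ^+ 2 + s ^+ 2) by field.
  by rewrite E subrr mul0r.
have ul : u 0 (lo i) != 0.
  apply: contra vh => /eqP ul.
  have : rot i c s u = v by rewrite /u rotVK.
  by move=> /(congr1 (fun v => v 0 (hi i))); rewrite rot_hi ul uh !mul0r addr0 => <-.
have lW : lo i \in pivot W.
  apply/pivotP; exists u; split => // q lq.
  have [->//|qh] := eqVneq q (hi i).
  have hq : (hi i < q)%N by rewrite ltn_neqAle eq_sym qh.
  by rewrite rot_off ?(gt_hi hq) // vq.
rewrite lW /=; apply/negP => hW; have := pivot_count i W N0.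
by rewrite -EV lW hW (negbTE lV); case: (_ \in _).
Qed.

(** Two rotated vectors ending at [hi i] are combined so that this entry cancels. As [lo i] is no
    pivot of V, the entry there cancels too, which says that both parameters have the same slope. *)
Lemma pivot_down_uniq i t t' W W' : 0 < t < 1 -> 0 < t' < 1 ->
  lo i \in pivot W -> hi i \notin pivot W ->
  lo i \in pivot W' -> hi i \notin pivot W' ->
  actV i (cc t) (ss t) W = actV i (cc t') (ss t') W' -> t = t' /\ W = W'.
Proof.
move=> t01 t01' lW hW lW' hW' E.
have N0 := ccss_neq0 t; have N0' := ccss_neq0 t'.
suff tt : t = t'.
  by split => //; rewrite -(actVK i W N0) E -tt actVK // tt.
set V := actV i (cc t) (ss t) W in E.
have lV : lo i \notin pivot V.
  by rewrite /V pivot_up // ?in_swapset ?srefl_lo // gt_eqF // ss_gt0.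
case/pivotP: lW => w [wW wl wq]; case/pivotP: lW' => w' [wW' wl' wq'].
have wV : rot i (cc t) (ss t) w \in V by exact: mem_actV.
have wV' : rot i (cc t') (ss t') w' \in V by rewrite E; exact: mem_actV.
pose v := (w' 0 (lo i) * ss t') *: rot i (cc t) (ss t) w -
  (w 0 (lo i) * ss t) *: rot i (cc t') (ss t') w'.
have vV : v \in V by rewrite rpredB // rpredZ.
have wh : w 0 (hi i) = 0 by apply: wq => /=.
have wh' : w' 0 (hi i) = 0 by apply: wq' => /=.
have vq (q : 'I_n) : (lo i < q)%N -> v 0 q = 0.
  move=> lq; have [->|qh] := eqVneq q (hi i).
    by rewrite [LHS]mxE [X in X + _]mxE [X in _ + X]mxE [X in _ - X]mxE !rot_hi wh wh'; ring.
  have hq : (hi i < q)%N by rewrite ltn_neqAle eq_sym qh.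
  rewrite [LHS]mxE [X in X + _]mxE [X in _ + X]mxE [X in _ - X]mxE.
  by rewrite !rot_off ?(gt_hi hq) // (wq q lq) (wq' q lq) !mulr0 subrr.
have := pivot_zero vV lV vq.
rewrite [LHS]mxE [X in X + _]mxE [X in _ + X]mxE [X in _ - X]mxE !rot_lo wh wh' => H.
apply: ccss_inj => //; apply/eqP; rewrite -subr_eq0; apply/eqP.
apply: (mulIf (mulf_neq0 wl wl')); rewrite mul0r -[RHS]H; ring.
Qed.

End PivotRotation.

(** * Words in simple reflections and their cube maps *)

Section Words.
Variables (R : realType) (k n : nat).
Hypothesis kn : (k <= n)%N.
Notation pt := (nat -> R).
Implicit Types (V W : {vspace 'rV[R]_n}) (i : 'I_n.-1) (P : {set 'I_n})
  (w : seq 'I_n.-1) (u : pt).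

Definition P0 : {set 'I_n} := [set p : 'I_n | (p < k)%N]%SET.

Lemma card_P0 : #|P0| = k.
Proof.
have -> : P0 = [set widen_ord kn q | q : 'I_k]%SET.
  apply/setP => p; rewrite inE; apply/idP/imsetP => [pk|[q _ ->]]; last exact: (ltn_ord q).
  by exists (Ordinal pk) => //; apply: val_inj.
by rewrite card_imset ?card_ord // => p q /(congr1 val) /= /val_inj.
Qed.

Lemma below_P0 j : (j <= k)%N -> below P0 j = j.
Proof.
move=> jk; have jn := leq_trans jk kn.
have -> : below P0 j = #|[set widen_ord jn q | q : 'I_j]%SET|.
  apply: eq_card => p; rewrite !inE; apply/andP/imsetP => [[pk pj]|[q _ ->]].
    by exists (Ordinal pj) => //; apply: val_inj.
  by split; rewrite /= ?(ltn_ord q) // (leq_trans (ltn_ord q)).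
by rewrite card_imset ?card_ord // => p q /(congr1 val) /= /val_inj.
Qed.

Definition base : {vspace 'rV[R]_n} := rowspan (pid_mx k : 'M[R]_(k, n)).

Lemma dim_flag_le j : (\dim (flag R n j) <= below [set: 'I_n]%SET j)%N.
Proof.
apply: leq_trans (dim_span _) _; rewrite size_map.
rewrite -(card_uniqP (filter_uniq _ (enum_uniq _))); apply/eq_leq/eq_card => p.
by rewrite mem_filter mem_enum !inE andbT.
Qed.

Lemma pivot_P0 V : pivot V = P0 -> V = flag R n k.
Proof.
move=> E; have dV : \dim V = k by rewrite -card_pivot E card_P0.
have : dj V k = k by rewrite dj_below // E below_P0.
have sV : (V :&: flag R n k <= V)%VS by exact: capvSl.
rewrite /dj => dVk.
have : (V :&: flag R n k)%VS == V by rewrite eqEdim sV dVk dV leqnn.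
move=> /eqP EV; have sF : (V <= flag R n k)%VS by rewrite -EV capvSr.
apply/eqP; rewrite eqEdim sF dV; apply: leq_trans (dim_flag_le k) _.
rewrite /below; have -> : [set p in [set: 'I_n]%SET | (p < k)%N]%SET = P0.
  by apply/setP => p; rewrite !inE.
by rewrite card_P0.
Qed.

Lemma dim_rowspan_le (A : 'M[R]_(k, n)) : (\dim (rowspan A) <= k)%N.
Proof. by apply: leq_trans (dim_span _) _; rewrite size_map size_enum_ord. Qed.

Lemma pivot_base : pivot base = P0.
Proof.
apply/eqP; rewrite eq_sym eqEcard card_P0 card_pivot dim_rowspan_le andbT.
apply/fintype.subsetP => p; rewrite inE => pk; apply/pivotP.
exists (row (Ordinal pk) (pid_mx k)); split.
- by apply: memv_span; apply/mapP; exists (Ordinal pk) => //; rewrite mem_enum.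
- by rewrite !mxE /= eqxx pk oner_eq0.
by move=> q pq; rewrite !mxE /= ltn_eqF.
Qed.

Lemma dim_base : \dim base = k.
Proof. by rewrite -card_pivot pivot_base card_P0. Qed.

Definition sh u : pt := fun j => u j.+1.

Fixpoint PhiM w u : 'M[R]_(k, n) :=
  if w is i :: w' then rot i (cc (u 0%N)) (ss (u 0%N)) (PhiM w' (sh u)) else pid_mx k.

Definition PhiV w u := rowspan (PhiM w u).

Lemma PhiV_cons i w u :
  PhiV (i :: w) u = actV i (cc (u 0%N)) (ss (u 0%N)) (PhiV w (sh u)).
Proof. exact: rowspan_rot. Qed.

Lemma dim_PhiV w u : \dim (PhiV w u) == k.
Proof.
elim: w u => [|i w IH] u; first by rewrite -[PhiV _ _]/base dim_base.
by rewrite PhiV_cons dim_actV // ccss_neq0.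
Qed.

Definition Phi w u : Gr R k n := exist (fun V : {vspace 'rV[R]_n} => \dim V == k) _ (dim_PhiV w u).

(* The head of a word acts last; [red] says that every letter moves an
   element up, so that [wt] grows with every letter. *)
Definition endset w : {set 'I_n} := foldr (@swapset n) P0 w.

Fixpoint red w : bool :=
  if w is i :: w' then [&& red w', lo i \in endset w' & hi i \notin endset w'] else true.

(** For the pivot set of a cell this is its dimension plus the constant [wt P0]. *)
Definition wt P : nat := (\sum_(p in P) p)%N.

Lemma srefl_inj i : injective (srefl i).
Proof. exact: perm_inj. Qed.

Lemma swapsetK i P : swapset i (swapset i P) = P.
Proof. by apply/setP => q; rewrite !in_swapset sreflE tpermK. Qed.

Lemma card_swapset i P : #|swapset i P| = #|P|.
Proof. by rewrite card_imset //; exact: srefl_inj. Qed.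

Lemma card_endset w : #|endset w| = k.
Proof. by elim: w => [|i w IH] /=; rewrite ?card_P0 // card_swapset. Qed.

Lemma wt_swapset_le i P : (wt (swapset i P) <= (wt P).+1)%N.
Proof.
rewrite /wt big_imset /=; last by move=> p q _ _; exact: srefl_inj.
have [lP|lP] := boolP (lo i \in P); last first.
  apply: leqW; apply: leq_sum => p pP.
  have pl : p != lo i by apply: contraNneq lP => <-.
  have [->|ph] := eqVneq p (hi i); first by rewrite srefl_hi leqW.
  by rewrite srefl_off.
rewrite (bigD1 (lo i)) //= [in leqRHS](bigD1 (lo i)) //= srefl_lo -addSn leq_add2l.
apply: leq_sum => p /andP[pP pl].
have [->|ph] := eqVneq p (hi i); first by rewrite srefl_hi leqW.
by rewrite srefl_off.
Qed.

Lemma wt_swapset_up i P : lo i \in P -> hi i \notin P -> wt (swapset i P) = (wt P).+1.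
Proof.
move=> lP hP; rewrite /wt big_imset /=; last by move=> p q _ _; exact: srefl_inj.
rewrite (bigD1 (lo i)) //= [in RHS](bigD1 (lo i)) //= srefl_lo -addSn; congr addn.
apply: eq_bigr => p /andP[pP pl].
have [E|ph] := eqVneq p (hi i); first by rewrite -E pP in hP.
by rewrite srefl_off.
Qed.

Lemma wt_red w : red w -> wt (endset w) = (wt P0 + size w)%N.
Proof.
elim: w => [|i w IH] /=; first by rewrite addn0.
by move=> /and3P[rw lw hw]; rewrite wt_swapset_up // IH // addnS.
Qed.

Definition ocube (d : nat) u := forall j, (j < d)%N -> 0 < u j < 1.

Lemma ocube_sh d u : ocube d.+1 u -> ocube d (sh u).
Proof. by move=> h j jd; apply: h. Qed.

Lemma cube_sh d u : cube d.+1 u -> cube d (sh u).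
Proof. by move=> h j jd; apply: h. Qed.

Lemma pivot_red w u : red w -> ocube (size w) u -> pivot (PhiV w u) = endset w.
Proof.
elim: w u => [|i w IH] u /=; first by move=> _ _; exact: pivot_base.
move=> /and3P[rw lw hw] ou; have E := IH _ rw (ocube_sh ou).
rewrite PhiV_cons pivot_up ?ccss_neq0 ?E //.
by rewrite gt_eqF // ss_gt0 // ou.
Qed.

Lemma Phi_inj w u u' : red w -> ocube (size w) u -> ocube (size w) u' ->
  PhiV w u = PhiV w u' -> forall j, (j < size w)%N -> u j = u' j.
Proof.
elim: w u u' => [|i w IH] u u' //= /and3P[rw lw hw] ou ou'.
rewrite !PhiV_cons => E.
have [] := pivot_down_uniq (ou 0%N isT) (ou' 0%N isT) _ _ _ _ E;
  rewrite ?(pivot_red rw (ocube_sh ou)) ?(pivot_red rw (ocube_sh ou')) //.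
move=> u0 Ew [|j] //= jd.
exact: (IH _ _ rw (ocube_sh ou) (ocube_sh ou') Ew).
Qed.

Definition ucons (t : R) u : pt := fun j => if j is j'.+1 then u j' else t.

Lemma Phi_surj w V : red w -> pivot V = endset w ->
  exists2 u, ocube (size w) u & V = PhiV w u.
Proof.
elim: w V => [|i w IH] V /=.
  move=> _ /pivot_P0 ->; exists (fun=> 0) => //.
  by rewrite -[PhiV _ _]/base (pivot_P0 pivot_base).
move=> /and3P[rw lw hw] E.
have lV : lo i \notin pivot V by rewrite E in_swapset srefl_lo.
have hV : hi i \in pivot V by rewrite E in_swapset srefl_hi.
have [t t01 [W EV /andP[lW hW]]] := pivot_down lV hV.
have EW : pivot W = endset w.
  rewrite -[LHS](swapsetK i) -(@pivot_up _ _ _ (cc t) (ss t)) ?ccss_neq0 //.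
    by rewrite -EV E swapsetK.
  by rewrite gt_eqF // ss_gt0.
have [u ou Eu] := IH W rw EW; exists (ucons t u).
  by move=> [|j] jd //=; apply: ou.
by rewrite PhiV_cons EV Eu.
Qed.

Lemma below_le P j j' : (j <= j')%N -> (below P j <= below P j')%N.
Proof.
move=> jj; apply: subset_leq_card; apply/fintype.subsetP => p; rewrite !inE.
by move=> /andP[-> /= pj]; exact: leq_trans jj.
Qed.

Lemma below_swapset i P j : j != (lo i).+1 -> below (swapset i P) j = below P j.
Proof.
move=> ji; rewrite /below -[RHS](card_imset _ (@srefl_inj i)).
apply: eq_card => p; rewrite [RHS](in_swapset i _ p) [LHS]inE [RHS]inE.
have -> : (p \in swapset i P) && (p < j)%N = (p \in swapset i P) && (srefl i p < j)%N.
  congr andb; have [->|pl] := eqVneq p (lo i).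
    by rewrite srefl_lo /=; apply/idP/idP; move: ji => /= ? ?; lia.
  have [->|ph] := eqVneq p (hi i); last by rewrite srefl_off.
  by rewrite srefl_hi /=; apply/idP/idP; move: ji => /= ? ?; lia.
by rewrite in_swapset.
Qed.

(** One half of the description of cell closures: in the closed cell, pivots only move down. A
    letter changes the counts only at (lo i).+1, where the count of [endset] falls to its value at
    [lo i]; there the monotonicity of [below] is enough. *)
Lemma below_endset w u j : red w -> (below (endset w) j <= below (pivot (PhiV w u)) j)%N.
Proof.
elim: w u j => [|i w IH] u j /=.
  by move=> _; rewrite -[PhiV _ _]/base pivot_base.
move=> /and3P[rw lw hw]; rewrite PhiV_cons.
set Q := pivot (actV _ _ _ _).
have EQ l : l != (lo i).+1 -> below Q l = below (pivot (PhiV w (sh u))) l.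
  move=> li; rewrite /Q.
  have [->//|[_ ->]] := pivot_cases i (PhiV w (sh u)) (ccss_neq0 (u 0%N)).
  exact: below_swapset.
have [->|ji] := eqVneq j (lo i).+1; last by rewrite below_swapset // EQ // IH.
have -> : below (swapset i (endset w)) (lo i).+1 = below (endset w) (lo i).
  rewrite belowS in_swapset srefl_lo (negbTE hw) addn0 below_swapset //.
  by rewrite ltn_eqF.
apply: leq_trans (below_le _ (leqnSn _)).
by rewrite EQ ?IH // ltn_eqF.
Qed.

Lemma red_exists P : #|P| = k -> exists2 w, red w & endset w = P.
Proof.
elim: {P}(wt P) {-2}P (leqnn (wt P)) => [|m IH] P.
  move=> wP cP; exists [::] => //=; apply/eqP; rewrite eq_sym eqEcard cP card_P0 leqnn andbT.
  apply/fintype.subsetP => p pP; rewrite inE.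
  have p0 : val p = 0%N.
    by apply/eqP; rewrite -leqn0 (leq_trans _ wP) // /wt (bigD1 p) //= leq_addr.
  by rewrite p0 -cP; apply/card_gt0P; exists p.
move=> wP cP; have [->|nP] := eqVneq P P0; first by exists [::].
have [q qP qk] : exists2 q, q \notin P & (q < k)%N.
  apply: contrapT => H; case/negP: nP; rewrite eq_sym eqEcard cP card_P0 leqnn andbT.
  apply/fintype.subsetP => q; rewrite inE => qk; apply/negPn/negP => qP.
  by apply: H; exists q.
have [p pP pk] : exists2 p, p \in P & (q < p)%N.
  apply: contrapT => H; suff : (#|P| < k)%N by rewrite cP ltnn.
  rewrite -card_P0; apply: proper_card; apply/properP; split.
    apply/fintype.subsetP => p pP; rewrite inE; apply: leq_ltn_trans qk.
    by rewrite leqNgt; apply/negP => qp; apply: H; exists p.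
  by exists q => //; rewrite inE.
(* The least element h of P above the gap q can be lowered by one: its predecessor is q or is
   excluded by minimality. *)
have exP : exists l, [exists p : 'I_n, [&& p \in P, (q < p)%N & l == p :> nat]].
  by exists (p : nat); apply/existsP; exists p; rewrite pP pk eqxx.
have [l /existsP[h /and3P[hP qh /eqP Eh]] lmin] := ex_minnP exP.
have hn := ltn_ord h.
have lt_i : (h.-1 < n.-1)%N by lia.
pose i := Ordinal lt_i.
have Ehi : hi i = h by apply: val_inj => /=; lia.
have lP : lo i \notin P.
  apply/negP => lP; have [E|lq] := eqVneq (val (lo i)) (val q).
    by case/negP: qP; rewrite -(val_inj E).
  have := lmin (lo i); have -> : [exists p0 : 'I_n, [&& p0 \in P, (q < p0)%N & val (lo i) == p0 :> nat]].
    apply/existsP; exists (lo i); rewrite lP eqxx andbT /=; move: lq => /=; lia.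
  by move=> /(_ isT); rewrite Eh /=; lia.
have ls : lo i \in swapset i P by rewrite in_swapset srefl_lo Ehi.
have hs : hi i \notin swapset i P by rewrite in_swapset srefl_hi.
have [|//|w rw Ew] := IH (swapset i P).
- by have := wt_swapset_up ls hs; rewrite swapsetK => E; rewrite E ltnS in wP.
- by rewrite card_swapset.
by exists (i :: w); rewrite /= ?Ew ?swapsetK // rw ls hs.
Qed.

End Words.

(** * Sign changes and flips of cube coordinates *)

Section Signs.
Variables (R : realType) (n : nat).
Notation pt := (nat -> R).
Implicit Types (V : {vspace 'rV[R]_n}) (i : 'I_n.-1) (eps : 'I_n -> bool).

Definition sgn m eps (A : 'M[R]_(m, n)) : 'M[R]_(m, n) :=
  \matrix_(p, q) ((-1) ^+ eps q * A p q).

Lemma sgn_is_linear m eps : linear (@sgn m eps).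
Proof. by move=> a A B; apply/matrixP => p q; rewrite !mxE; ring. Qed.

HB.instance Definition _ m eps :=
  GRing.isLinear.Build R 'M[R]_(m, n) 'M[R]_(m, n) _ (@sgn m eps) (@sgn_is_linear m eps).

Lemma sgnK m eps (A : 'M[R]_(m, n)) : sgn eps (sgn eps A) = A.
Proof. by apply/matrixP => p q; rewrite !mxE mulrA -expr2 sqrr_sign mul1r. Qed.

Definition sgnV eps V : {vspace 'rV[R]_n} := (linfun (@sgn 1 eps) @: V)%VS.

Lemma sgnVP eps V v : (v \in sgnV eps V) = (sgn eps v \in V).
Proof.
apply/memv_imgP/idP => [[u uV ->]|vV]; first by rewrite lfunE /= sgnK.
by exists (sgn eps v) => //; rewrite lfunE /= sgnK.
Qed.

Lemma sgnV_flag eps j : sgnV eps (flag R n j) = flag R n j.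
Proof.
have sub : (sgnV eps (flag R n j) <= flag R n j)%VS.
  apply/subvP => v; rewrite sgnVP => /mem_flag h; apply/mem_flag => p /h.
  by rewrite mxE => /eqP; rewrite mulf_eq0 signr_eq0 => /eqP.
apply/eqP; rewrite eqEsubv sub /=; apply/subvP => v vf.
by rewrite sgnVP; apply: (subvP sub); rewrite sgnVP sgnK.
Qed.

Definition eswap i eps : 'I_n -> bool := fun p => eps (srefl i p).

Lemma eswap_id i eps : eps (lo i) = eps (hi i) -> eswap i eps = eps.
Proof.
move=> E; apply/funext => p; rewrite /eswap.
have [->|pl] := eqVneq p (lo i); first by rewrite srefl_lo.
have [->|ph] := eqVneq p (hi i); first by rewrite srefl_hi.
by rewrite srefl_off.
Qed.

Lemma sgn_rot_eq m i c s eps (A : 'M[R]_(m, n)) : eps (lo i) = eps (hi i) ->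
  sgn eps (rot i c s A) = rot i c s (sgn (eswap i eps) A).
Proof.
move=> E; rewrite eswap_id //; apply/matrixP => p q; rewrite !mxE.
have [->|ql] := eqVneq q (lo i); first by rewrite E; ring.
have [->|qh] := eqVneq q (hi i); first by rewrite E; ring.
by [].
Qed.

(** Keeping the signs in place would negate s and leave the half circle. Exchanging the two unequal
    signs contributes another -1 on the plane, so that c is negated instead, which amounts to
    replacing t by 1 - t. *)
Lemma sgn_rot_neq m i c s eps (A : 'M[R]_(m, n)) : eps (lo i) != eps (hi i) ->
  sgn eps (rot i c s A) = rot i (- c) s (sgn (eswap i eps) A).
Proof.
move=> E; apply/matrixP => p q; rewrite !mxE /eswap srefl_lo srefl_hi.
have [->|ql] := eqVneq q (lo i).
  by move: E; case: (eps (lo i)); case: (eps (hi i)) => // _; rewrite ?expr1 ?expr0; ring.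
have [->|qh] := eqVneq q (hi i).
  by move: E; case: (eps (lo i)); case: (eps (hi i)) => // _; rewrite ?expr1 ?expr0; ring.
by rewrite srefl_off.
Qed.

Lemma sgnV_act i c s eps V c' :
  (forall v : 'rV[R]_n, sgn eps (rot i c s v) = rot i c' s (sgn (eswap i eps) v)) ->
  sgnV eps (actV i c s V) = actV i c' s (sgnV (eswap i eps) V).
Proof.
move=> H; apply/vspaceP => v; apply/idP/idP.
  rewrite sgnVP => /actVP[u uV E]; rewrite -[v](sgnK eps) E H.
  by apply: mem_actV; rewrite sgnVP sgnK.
move=> /actVP[u]; rewrite sgnVP => uV ->; rewrite sgnVP.
by rewrite -[u](sgnK (eswap i eps)) -H sgnK mem_actV.
Qed.

Lemma actV_m1 i V : actV i (-1) 0 V = sgnV (fun p => (p == lo i) || (p == hi i)) V.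
Proof.
have H (v : 'rV[R]_n) : sgn (fun p => (p == lo i) || (p == hi i)) v = rot i (-1) 0 v.
  apply/rowP => q; rewrite !mxE; have [->|ql] := eqVneq q (lo i); first by rewrite expr1; ring.
  by have [->|qh] := eqVneq q (hi i); rewrite ?expr1 ?expr0; ring.
apply/vspaceP => v; rewrite sgnVP; apply/idP/idP => [/actVP[u uV ->]|].
  by rewrite -H sgnK.
by move=> /(mem_actV i (-1) 0); rewrite -H sgnK.
Qed.

Lemma pivot_s0 i c V : c != 0 -> pivot (actV i c 0 V) = pivot V.
Proof.
move=> c0; have N0 : c ^+ 2 + 0 ^+ 2 != 0 by rewrite expr0n addr0 expf_neq0.
have sub (c' : R) (W : {vspace 'rV[R]_n}) p : c' != 0 -> p \in pivot W -> p \in pivot (actV i c' 0 W).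
  move=> c0' /pivotP[v [vW vp vq]]; apply/pivotP; exists (rot i c' 0 v).
  have E q : rot i c' 0 v 0 q = v 0 q * (if (q == lo i) || (q == hi i) then c' else 1).
    rewrite mxE; have [->|_] := eqVneq q (lo i); first by rewrite /=; ring.
    by have [->|_] := eqVneq q (hi i); rewrite /=; ring.
  split; first exact: mem_actV.
    by rewrite E mulf_neq0 //; case: ifP => // _; exact: oner_neq0.
  by move=> q /vq; rewrite E => ->; rewrite mul0r.
apply/setP => p; apply/idP/idP; last exact: sub.
have := sub (c / (c ^+ 2 + 0 ^+ 2)) (actV i c 0 V) p.
have -> : actV i (c / (c ^+ 2 + 0 ^+ 2)) 0 (actV i c 0 V) = V.
  by rewrite -[RHS](actVK i V N0) oppr0 mul0r.
by apply; rewrite mulf_neq0 // invr_eq0.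
Qed.

End Signs.

Section Flips.
Variables (R : realType) (k n : nat).
Hypothesis kn : (k <= n)%N.
Notation pt := (nat -> R).
Notation PhiV := (@PhiV R k n).
Implicit Types (V : {vspace 'rV[R]_n}) (i : 'I_n.-1) (eps : 'I_n -> bool)
  (w : seq 'I_n.-1) (u : pt).

Definition flipu (bs : seq bool) u : pt := fun j => if nth false bs j then 1 - u j else u j.

Fixpoint flipb w eps : seq bool :=
  if w is i :: w' then (eps (lo i) != eps (hi i)) :: flipb w' (eswap i eps) else [::].

Lemma size_flipb w eps : size (flipb w eps) = size w.
Proof. by elim: w eps => //= i w IH eps; rewrite IH. Qed.

(** Having passed all letters, the signs act on a coordinate subspace, which they preserve. *)
Lemma sgnV_Phi w eps u : sgnV eps (PhiV w u) = PhiV w (flipu (flipb w eps) u).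
Proof.
elim: w eps u => [|i w IH] eps u.
  rewrite -[PhiV _ _]/(base R k n) -[PhiV _ (flipu _ _)]/(base R k n).
  by rewrite (pivot_P0 kn (pivot_base R kn)) sgnV_flag.
rewrite !PhiV_cons -[sh (flipu _ _)]/(flipu (flipb w (eswap i eps)) (sh u)).
have [E|E] := eqVneq (eps (lo i)) (eps (hi i)).
  rewrite (@sgnV_act _ _ _ _ _ _ _ (cc (u 0%N))); last by move=> v; exact: sgn_rot_eq.
  by rewrite IH /flipu /= E eqxx.
rewrite (@sgnV_act _ _ _ _ _ _ _ (- cc (u 0%N))); last by move=> v; exact: sgn_rot_neq.
have -> : flipu (flipb (i :: w) eps) u 0%N = 1 - u 0%N by rewrite /flipu /= E.
have -> : cc (1 - u 0%N) = - cc (u 0%N) by rewrite /cc; ring.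
have -> : ss (1 - u 0%N) = ss (u 0%N) by rewrite /ss; ring.
by rewrite IH.
Qed.

Lemma cube_flipu d bs u : cube d u -> cube d (flipu bs u).
Proof.
by move=> h j /h /andP[? ?]; rewrite /flipu; case: (nth _ _ _); apply/andP; split; lra.
Qed.

Definition Sset w V := exists2 u, cube (size w) u & V = PhiV w u.

Lemma Sset_sgnV w eps V : Sset w V -> Sset w (sgnV eps V).
Proof.
move=> [u cu ->]; rewrite sgnV_Phi; exists (flipu (flipb w eps) u) => //.
exact: cube_flipu.
Qed.

Lemma cc0 : cc 0 = 1 :> R. Proof. by rewrite /cc mulr0 subr0. Qed.
Lemma ss0 : ss 0 = 0 :> R. Proof. by rewrite /ss mul0r. Qed.
Lemma cc1 : cc 1 = -1 :> R. Proof. by rewrite /cc; ring. Qed.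
Lemma ss1 : ss 1 = 0 :> R. Proof. by rewrite /ss subrr mulr0. Qed.

(** At parameter 1 a sign change remains; the flips that absorb it map the closed cube to itself. *)
Lemma Phi_face w u j : cube (size w) u -> (j < size w)%N -> u j = 0 \/ u j = 1 ->
  Sset (delat j w) (PhiV w u).
Proof.
elim: w u j => // i w IH u [|j] cu jw uj.
  rewrite PhiV_cons /delat /= drop0.
  have S : Sset w (PhiV w (sh u)) by exists (sh u) => //; exact: cube_sh.
  by case: uj => ->; rewrite ?cc0 ?ss0 ?cc1 ?ss1 ?actV_id ?actV_m1 //; exact: Sset_sgnV.
have [u' cu' Eu'] := IH (sh u) j (cube_sh cu) jw uj.
exists (ucons (u 0%N) u'); last by rewrite !PhiV_cons Eu'.
by move=> [|l] //= lw; [exact: cu|exact: cu'].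
Qed.

Lemma Sset_delat w j V : (j < size w)%N -> Sset (delat j w) V -> Sset w V.
Proof.
elim: w j V => // i w IH [|j] V jw [u cu ->].
  move: cu; rewrite /delat /= drop0 => cu; exists (ucons 0 u).
    by move=> [|l] //= lw; [rewrite lexx ler01|exact: cu].
  by rewrite PhiV_cons /= cc0 ss0 actV_id.
have [|u' cu' Eu'] := IH j (PhiV (delat j w) (sh u)) jw.
  by exists (sh u) => //; apply: cube_sh.
exists (ucons (u 0%N) u'); last by rewrite !PhiV_cons Eu'.
by move=> [|l] //= lw; [exact: cu|exact: cu'].
Qed.

(** For a point of the cube, the dimension of the open face containing it. *)
Definition inside d u : nat := (\sum_(j < d) ((u j != 0%R) && (u j != 1%R)))%N.

(** A letter with parameter 0 or 1 acts as the identity or by signs and preserves the pivots; any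
    other letter raises the weight by at most one. *)
Lemma wt_pivot_inside w u :
  (wt (pivot (PhiV w u)) <= wt (P0 k n) + inside (size w) u)%N.
Proof.
elim: w u => [|i w IH] u.
  by rewrite -[PhiV _ _]/(base R k n) pivot_base // leq_addr.
rewrite PhiV_cons /inside /= big_ord_recl -[(\sum_(j < _) _)%N]/(inside (size w) (sh u)).
have H := IH (sh u).
have [u0|u0] := eqVneq (u 0%N) 0; first by rewrite u0 cc0 ss0 actV_id.
have [u1|u1] := eqVneq (u 0%N) 1.
  by rewrite u1 cc1 ss1 pivot_s0 // oppr_eq0 oner_eq0.
rewrite add1n addnS.
have [->|[_ ->]] := pivot_cases i (PhiV w (sh u)) (ccss_neq0 (u 0%N)).
  exact: leqW.
by apply: leq_trans (wt_swapset_le _ _) _; rewrite ltnS.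
Qed.

Lemma inside_le d u : (inside d u <= d)%N.
Proof.
rewrite -[leqRHS](card_ord d) -sum1_card; apply: leq_sum => j _.
exact: leq_b1.
Qed.

Lemma wt_pivot_Phi w u : (wt (pivot (PhiV w u)) <= wt (P0 k n) + size w)%N.
Proof. by apply: leq_trans (wt_pivot_inside w u) _; rewrite leq_add2l inside_le. Qed.

Lemma inside_bd d u : cubebd d u -> (inside d u < d)%N.
Proof.
move=> [_ [j jd uj]].
rewrite /inside (bigD1 (Ordinal jd)) //= -[X in (_ < X)%N](card_ord d) -sum1_card.
rewrite [X in (_ < X)%N](bigD1 (Ordinal jd)) //= add1n ltnS.
have -> : (u j != 0) && (u j != 1) = false by case: uj => ->; rewrite eqxx ?andbF.
by rewrite add0n; apply: leq_sum => l _; exact: leq_b1.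
Qed.

Lemma inside_ins d j e u : e = 0 \/ e = 1 -> (j <= d)%N ->
  inside d.+1 (ins j e u) = inside d u.
Proof.
move=> e01 jd; have jd' : (j < d.+1)%N by [].
rewrite /inside (bigD1_ord (Ordinal jd')) //= {1 2}/ins ltnn eqxx.
have -> : (e != 0) && (e != 1) = false by case: e01 => ->; rewrite eqxx ?andbF.
rewrite add0n; apply: eq_bigr => l _.
suff -> : ins j e u (fintype.lift (Ordinal jd') l) = u l by [].
rewrite /= /ins /bump; case: (leqP j l) => jl; rewrite ?add1n ?add0n ?jl //.
have -> : (l.+1 < j)%N = false by apply/negbTE; rewrite -leqNgt ltnW.
by rewrite gtn_eqF.
Qed.

End Flips.

(** * Topology of the Grassmannian *)

Section MatrixContinuity.
Variables (R : realType) (T : topologicalType).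

Lemma continuous_at_mx m n (M : T -> 'M[R]_(m, n)) x :
  (forall i j, {for x, continuous (fun y => M y i j)}) -> {for x, continuous M}.
Proof.
move=> h U [P Px PU].
have : \forall y \near x, forall ij : 'I_m * 'I_n, P ij.1 ij.2 (M y ij.1 ij.2).
  by apply: filter_forall => -[i j]; exact: (h i j _ (Px i j)).
by apply: filterS => y hy; apply: PU => i j; exact: (hy (i, j)).
Qed.

Lemma continuous_mx m n (M : T -> 'M[R]_(m, n)) :
  (forall i j, continuous (fun x => M x i j)) -> continuous M.
Proof. by move=> h x; apply: continuous_at_mx => i j; exact: h. Qed.

Lemma continuous_prodR (I : Type) (r : seq I) (F : I -> T -> R) :
  (forall i, continuous (F i)) -> continuous (fun x => \prod_(i <- r) F i x).
Proof.
move=> h; elim: r => [|i r IH].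
  by under eq_fun do rewrite big_nil; exact: cst_continuous.
under eq_fun do rewrite big_cons.
exact: contM.
Qed.

Lemma continuous_det m (M : T -> 'M[R]_m) :
  (forall i j, continuous (fun x => M x i j)) -> continuous (fun x => \det (M x)).
Proof.
move=> h; rewrite /determinant; apply: continuous_sumR => s.
apply: contM; first exact: cst_continuous.
by apply: continuous_prodR => i; exact: h.
Qed.

Lemma continuous_mulmx m n p (M : T -> 'M[R]_(m, n)) (N : T -> 'M[R]_(n, p)) :
  (forall i j, continuous (fun x => M x i j)) -> (forall i j, continuous (fun x => N x i j)) ->
  forall i j, continuous (fun x => (M x *m N x) i j).
Proof.
move=> hM hN i j; under eq_fun do rewrite mxE.
by apply: continuous_sumR => l; exact: contM.
Qed.

Lemma continuous_adj m (M : T -> 'M[R]_m) :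
  (forall i j, continuous (fun x => M x i j)) ->
  forall i j, continuous (fun x => (\adj (M x)) i j).
Proof.
move=> h i j; under eq_fun do rewrite mxE /cofactor.
apply: contM; first exact: cst_continuous.
apply: continuous_det => a b; under eq_fun do rewrite !mxE.
exact: h.
Qed.

End MatrixContinuity.

Section GrassmannianTopology.
Variables (R : realType) (k n : nat).
Hypothesis kn : (k <= n)%N.
Notation pt := (nat -> R).
Local Notation Gr := (Gr R k n).

Lemma gr_openE (U : set Gr) : open U = gr_open U.
Proof. by []. Qed.

Lemma PhiM_continuous w (T : topologicalType) (f : T -> pt) :
  (forall i, continuous (fun x => f x i)) ->
  forall p q, continuous (fun x => @PhiM R k n w (f x) p q).
Proof.
elim: w f => [|i w IH] f hf p q /=; first exact: cst_continuous.
have hc : continuous (fun x => cc (f x 0%N)).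
  apply: contB; first exact: cst_continuous.
  by apply: contM; [exact: cst_continuous|exact: hf].
have hs : continuous (fun x => ss (f x 0%N)).
  by apply: contM; [|apply: contB; first exact: cst_continuous]; exact: hf.
have hM q' : continuous (fun x => @PhiM R k n w (sh (f x)) p q').
  by apply: (IH (fun x => sh (f x))) => j; exact: hf.
pose M x := @PhiM R k n w (sh (f x)).
have [->|ql] := eqVneq q (lo i).
  have -> : (fun x => rot i (cc (f x 0%N)) (ss (f x 0%N)) (M x) p (lo i)) =
      (fun x => M x p (lo i) * cc (f x 0%N) - M x p (hi i) * ss (f x 0%N)).
    by apply/funext => x; rewrite mxE eqxx.
  by apply: contB; apply: contM.
have [->|qh] := eqVneq q (hi i).
  have -> : (fun x => rot i (cc (f x 0%N)) (ss (f x 0%N)) (M x) p (hi i)) =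
      (fun x => M x p (lo i) * ss (f x 0%N) + M x p (hi i) * cc (f x 0%N)).
    by apply/funext => x; rewrite mxE hi_lo eqxx.
  by apply: contD; apply: contM.
have -> : (fun x => rot i (cc (f x 0%N)) (ss (f x 0%N)) (M x) p q) = (fun x => M x p q).
  by apply/funext => x; rewrite mxE (negbTE ql) (negbTE qh).
exact: hM.
Qed.

Lemma Phi_ccont w : ccont (@Phi R k n kn w).
Proof.
move=> T f hf; apply/continuousP => U; rewrite gr_openE => -[Z oZ hZ].
have -> : (fun x => Phi kn w (f x)) @^-1` U = (fun x => @PhiM R k n w (f x)) @^-1` Z.
  by apply/seteqP; split => x /=; rewrite (hZ (PhiM k w (f x)) (Phi kn w (f x))).
apply: open_comp => // x _; apply: continuous_mx => p q.
exact: PhiM_continuous.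
Qed.

Definition gram (A : 'M[R]_(k, n)) := A *m A^T.

(** The orthogonal projection A^T (A A^T)^-1 A onto the row space. The adjugate makes its entries
    polynomials divided by one determinant. It depends on the row space only and so transfers
    separation from matrices to the Grassmannian. *)
Definition projmx (A : 'M[R]_(k, n)) : 'M[R]_n :=
  (\det (gram A))^-1 *: (A^T *m (\adj (gram A) *m A)).

Lemma mem_rowspan (A : 'M[R]_(k, n)) v : (exists x : 'rV_k, v = x *m A) <-> v \in rowspan A.
Proof.
rewrite /rowspan span_def big_map big_enum; split.
  move=> [x ->]; rewrite mulmx_sum_row; apply: memv_sumr => p _.
  by rewrite memvZ ?memv_line.
move=> /memv_sumP[g hg ->].
have hx p : exists a : R, g p = a *: row p A by have /vlineP[a ->] := hg p isT; exists a.
have [x hx'] := choice hx; exists (\row_p x p).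
by rewrite mulmx_sum_row; apply: eq_bigr => p _; rewrite hx' mxE.
Qed.

(** A kernel vector x of the Gram matrix has |xA|^2 = 0, so xA = 0 expresses one row through the
    others. *)
Lemma gram_unit (A : 'M[R]_(k, n)) : \dim (rowspan A) = k -> \det (gram A) != 0.
Proof.
move=> dA; apply/det0P => -[x x0 xG].
have xA : x *m A = 0.
  have : x *m A *m (x *m A)^T = 0 by rewrite trmx_mul !mulmxA -(mulmxA x A) xG mul0mx.
  move=> /(congr1 (fun M : 'M[R]_1 => M 0 0)); rewrite mxE [RHS]mxE => S0.
  apply/rowP => q; rewrite [RHS]mxE; apply/eqP; rewrite -sqrf_eq0 expr2.
  have S1 : \sum_j (x *m A) 0 j * (x *m A) 0 j = 0.
    by rewrite -[RHS]S0; apply: eq_bigr => j _; rewrite [(x *m A)^T _ _]mxE.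
  have /eqP := S1; rewrite psumr_eq0 => [|j _]; last by rewrite -expr2 sqr_ge0.
  by move=> /allP/(_ q); rewrite mem_index_enum => /(_ isT).
have [p xp] : exists p, x 0 p != 0.
  apply: contrapT => H; case/negP: x0; apply/eqP/rowP => p; rewrite mxE.
  by apply/eqP/negPn/negP => xp; apply: H; exists p.
have : (rowspan A <= <<[seq row q A | q <- enum 'I_k & q != p]>>)%VS.
  apply/span_subvP => _ /mapP[q _ ->].
  have [->|qp] := eqVneq q p; last first.
    by apply/memv_span/map_f; rewrite mem_filter qp mem_enum.
  have E : row p A = \sum_(q | q != p) (- (x 0 q / x 0 p)) *: row q A.
    apply: (scalerI xp); have := xA; rewrite mulmx_sum_row (bigD1 p) //= => /eqP.
    rewrite addr_eq0 => /eqP ->; rewrite scaler_sumr -sumrN; apply: eq_bigr => r _.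
    by rewrite scalerA mulrN mulrCA divff // mulr1 scaleNr.
  rewrite E; apply: memv_suml => r rp; apply/memvZ/memv_span/map_f.
  by rewrite mem_filter rp mem_enum.
move=> /dimvS; rewrite dA => /leq_trans/(_ (dim_span _)); rewrite size_map size_filter => h.
have c1 := count_predC (fun q => q != p) (enum 'I_k); rewrite size_enum_ord in c1.
have c2 : (0 < count (predC (fun q => q != p)) (enum 'I_k))%N.
  by rewrite -has_count; apply/hasP; exists p; rewrite ?mem_enum //= eqxx.
suff : (k < k)%N by rewrite ltnn.
rewrite -[X in (_ < X)%N]c1; apply: leq_ltn_trans h _.
by rewrite -[X in (X < _)%N]addn0 ltn_add2l.
Qed.

Lemma projmx_id (A : 'M[R]_(k, n)) v : \dim (rowspan A) = k ->
  v \in rowspan A -> v *m projmx A = v.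
Proof.
move=> dA /mem_rowspan[x ->]; rewrite /projmx -scalemxAr !mulmxA -(mulmxA x A).
rewrite -/(gram A) -(mulmxA x) mul_mx_adj -scalemx1 -scalemxAr mulmx1 -scalemxAl.
by rewrite scalerA mulVf ?scale1r // gram_unit.
Qed.

Lemma mul_projmx (A : 'M[R]_(k, n)) (v : 'rV[R]_n) : v *m projmx A \in rowspan A.
Proof.
apply/mem_rowspan; exists ((\det (gram A))^-1 *: (v *m A^T *m \adj (gram A))).
by rewrite /projmx -scalemxAr -scalemxAl !mulmxA.
Qed.

Lemma trmx_projmx (A : 'M[R]_(k, n)) : (projmx A)^T = projmx A.
Proof.
rewrite /projmx linearZ /=; congr (_ *: _).
rewrite !trmx_mul trmxK -mulmxA; congr (_ *m (_ *m _)).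
by rewrite trmx_adj /gram trmx_mul trmxK.
Qed.

(** For projections P and P' onto the same space PP' = P and P'P = P'; by symmetry of both,
    transposing the first gives P'P = P. *)
Lemma projmx_rowspan (A A' : 'M[R]_(k, n)) : \dim (rowspan A) = k ->
  rowspan A = rowspan A' -> projmx A = projmx A'.
Proof.
move=> dA E; have dA' : \dim (rowspan A') = k by rewrite -E.
have E1 : projmx A *m projmx A' = projmx A.
  apply/row_matrixP => p; rewrite row_mul projmx_id // -E.
  by rewrite rowE; exact: mul_projmx.
have E2 : projmx A' *m projmx A = projmx A'.
  apply/row_matrixP => p; rewrite row_mul projmx_id // E.
  by rewrite rowE; exact: mul_projmx.
by rewrite -[LHS]trmx_projmx -E1 trmx_mul !trmx_projmx E2.
Qed.

Lemma rowspan_projmx (A A' : 'M[R]_(k, n)) :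
  \dim (rowspan A) = k -> \dim (rowspan A') = k ->
  projmx A = projmx A' -> rowspan A = rowspan A'.
Proof.
move=> dA dA' E; apply/vspaceP => v; apply/idP/idP => h.
  by rewrite -(projmx_id dA h) E mul_projmx.
by rewrite -(projmx_id dA' h) -E mul_projmx.
Qed.

Lemma dim_Gr (V : Gr) : \dim (val V) = k.
Proof. exact/eqP/(valP V). Qed.

Lemma rowspan_exists (V : Gr) : exists A : 'M[R]_(k, n), val V = rowspan A.
Proof.
have dV := dim_Gr V.
exists (\matrix_p (vbasis (val V))`_p).
rewrite /rowspan -[LHS](span_basis (vbasisP (val V))); congr span.
apply: (@eq_from_nth _ 0); rewrite size_tuple.
  by rewrite size_map size_enum_ord dV.
move=> p pd; have pk : (p < k)%N by rewrite -dV.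
rewrite (nth_map (Ordinal pk)) ?size_enum_ord // rowK; congr nth.
by rewrite -[p in RHS]/(nat_of_ord (Ordinal pk)) nth_ord_enum.
Qed.

Lemma continuous_at_projmx (A : 'M[R]_(k, n)) : \det (gram A) != 0 ->
  {for A, continuous projmx}.
Proof.
move=> g0; have cid i j : continuous (fun A : 'M[R]_(k, n) => A i j) by exact: coord_continuous.
have ctr i j : continuous (fun A : 'M[R]_(k, n) => A^T i j).
  have -> : (fun A : 'M[R]_(k, n) => A^T i j) = (fun A => A j i) by apply/funext => B; rewrite mxE.
  exact: coord_continuous.
have cg i j : continuous (fun A => gram A i j) by exact: (@continuous_mulmx R 'M[R]_(k, n)).
have cd : continuous (fun A => \det (gram A)) by exact: continuous_det.
have cN i j : continuous (fun A : 'M[R]_(k, n) => (A^T *m (\adj (gram A) *m A)) i j).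
  apply: (@continuous_mulmx R 'M[R]_(k, n)) => // a b.
  by apply: (@continuous_mulmx R 'M[R]_(k, n)) => // a' b'; exact: continuous_adj.
apply: continuous_at_mx => i j.
have -> : (fun B => projmx B i j) =
    (fun B => (\det (gram B))^-1 * (B^T *m (\adj (gram B) *m B)) i j).
  by apply/funext => B; rewrite mxE.
exact: (cvgM (cvgV g0 (cd A)) (cN i j A)).
Qed.

Lemma gr_open_projmx (Z : set 'M[R]_n) : open Z ->
  open ([set V | exists2 A, val V = rowspan A & Z (projmx A)] : set Gr).
Proof.
move=> oZ; rewrite gr_openE.
(* The determinant condition holds for all matrices of rank k, and cuts out the open set on which
   [projmx] is continuous. *)
exists [set A | \det (gram A) != 0 /\ Z (projmx A)].
  rewrite openE => A [g0 ZA].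
  have : \forall B \near A, Z (projmx B).
    by apply: (continuous_at_projmx g0); exact: open_nbhs_nbhs.
  have : \forall B \near A, \det (gram B) != 0.
    have cd : continuous (fun A => \det (gram A)).
      apply: continuous_det => i j; apply: (@continuous_mulmx R 'M[R]_(k, n)) => a b.
        exact: coord_continuous.
      have -> : (fun A : 'M[R]_(k, n) => A^T a b) = (fun A => A b a).
        by apply/funext => B; rewrite mxE.
      exact: coord_continuous.
    by apply: (cd A [set x | x != 0]); apply: open_nbhs_nbhs; split => //; exact: open_neq.
  by move=> h1 h2; apply: filterS2 h1 h2.
move=> A V VA; have dA : \dim (rowspan A) = k by rewrite -VA; exact: dim_Gr.
split=> [[g0 ZA]|[A' VA' ZA']]; first by exists A.
split; first exact: gram_unit.
by rewrite (projmx_rowspan dA (A' := A')) // -VA.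
Qed.

(** Distinct subspaces have distinct projections, which are separated in the normed space of
    matrices. *)
Lemma gr_hausdorff : hausdorff_space Gr.
Proof.
rewrite open_hausdorff => V1 V2 V12.
have [A1 E1] := rowspan_exists V1; have [A2 E2] := rowspan_exists V2.
have d1 : \dim (rowspan A1) = k by rewrite -E1; exact: dim_Gr.
have d2 : \dim (rowspan A2) = k by rewrite -E2; exact: dim_Gr.
have P12 : projmx A1 != projmx A2.
  apply: contra V12 => /eqP /(rowspan_projmx d1 d2) E; apply/eqP/val_inj.
  by rewrite E1 E2.
have := @norm_hausdorff R 'M[R]_n.
rewrite open_hausdorff => /(_ _ _ P12); case=> -[Z1 Z2] [Z1A Z2A] [q1 q2 /eqP Z12].
exists ([set V | exists2 A, val V = rowspan A & Z1 (projmx A)],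
        [set V | exists2 A, val V = rowspan A & Z2 (projmx A)]) => /=.
  by split; apply/mem_set; [exists A1 => //; exact/set_mem|exists A2 => //; exact/set_mem].
split; [exact: gr_open_projmx|exact: gr_open_projmx|].
apply/eqP/seteqP; split => // V [[B1 EB1 ZB1] [B2 EB2 ZB2]].
have dB : \dim (rowspan B1) = k by rewrite -EB1; exact: dim_Gr.
have EB : projmx B1 = projmx B2 by apply: projmx_rowspan => //; rewrite -EB1.
have : (Z1 `&` Z2) (projmx B1) by split => //; rewrite EB.
by rewrite Z12.
Qed.

End GrassmannianTopology.

(** * Closed cells as images of cubes, and their colouring *)

Section CellClosure.
Variables (R : realType) (k n : nat).
Hypothesis kn : (k <= n)%N.
Notation pt := (nat -> R).
Local Notation Gr := (Gr R k n).
Local Notation Phi := (@Phi R k n kn).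
Local Notation endset := (endset k).
Local Notation red := (@red k n).
Implicit Types (w : seq 'I_n.-1) (u : pt).

Definition cellP (P : {set 'I_n}) : set Gr := [set V | pivot (val V) = P].

Lemma Phi_ext w u u' : (forall j, (j < size w)%N -> u j = u' j) -> Phi w u = Phi w u'.
Proof.
move=> h; apply: val_inj; elim: w u u' h => // i w IH u u' h.
rewrite [LHS]PhiV_cons [RHS]PhiV_cons (h 0%N) //; congr (actV _ _ _ _).
by apply: IH => j jw; apply: h.
Qed.

Definition trunc d u : 'rV[R]_d.+1 := \row_i (if (i < d)%N then u i else 0).

Lemma vec_trunc d u j : (j < d)%N -> vec (trunc d u) j = u j.
Proof.
by move=> jd; rewrite /vec ltnS ltnW // mxE inordK ?jd // ltnS ltnW.
Qed.

Lemma vecR_continuous d i : continuous (fun x : 'rV[R]_d.+1 => vec x i).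
Proof.
rewrite /vec; case: (ltnP i d.+1) => _; last exact: cst_continuous.
exact: coord_continuous.
Qed.

Lemma closed_vec_le d i r : closed [set x : 'rV[R]_d.+1 | vec x i <= r].
Proof.
apply: (@closed_comp _ _ (fun x : 'rV[R]_d.+1 => vec x i) [set y | y <= r]).
  by move=> x _; exact: vecR_continuous.
exact: closed_le.
Qed.

Lemma closed_vec_ge d i r : closed [set x : 'rV[R]_d.+1 | r <= vec x i].
Proof.
apply: (@closed_comp _ _ (fun x : 'rV[R]_d.+1 => vec x i) [set y | r <= y]).
  by move=> x _; exact: vecR_continuous.
exact: closed_ge.
Qed.

Lemma closed_vec_itv d i a b : closed [set x : 'rV[R]_d.+1 | a <= vec x i <= b].
Proof.
have -> : [set x : 'rV[R]_d.+1 | a <= vec x i <= b] =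
    [set x | a <= vec x i] `&` [set x | vec x i <= b].
  by apply/seteqP; split => x /=; [move=> /andP[]|move=> [-> ->]].
by apply: closedI; [exact: closed_vec_ge|exact: closed_vec_le].
Qed.

Lemma closed_all_lt (T : topologicalType) d (Q : nat -> set T) : (forall i, closed (Q i)) ->
  closed [set x | forall i, (i < d)%N -> Q i x].
Proof.
move=> h; have -> : [set x | forall i, (i < d)%N -> Q i x] = \bigcap_(i in [set i | (i < d)%N]) Q i by [].
by apply: closed_bigI => i _; exact: h.
Qed.

Lemma closed_ex_lt (T : topologicalType) d (Q : nat -> set T) : (forall i, closed (Q i)) ->
  closed [set x | exists2 i, (i < d)%N & Q i x].
Proof.
move=> h; elim: d => [|d IH].
  have -> : [set x | exists2 i, (i < 0)%N & Q i x] = set0.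
    by apply/seteqP; split => // x [].
  exact: closed0.
have -> : [set x | exists2 i, (i < d.+1)%N & Q i x] =
    [set x | exists2 i, (i < d)%N & Q i x] `|` Q d.
  apply/seteqP; split => x.
    move=> [i]; rewrite ltnS leq_eqVlt => /orP[/eqP -> Qd|id Qi]; [by right|by left; exists i].
  by move=> [[i id Qi]|Qd]; [exists i => //; exact: ltnW|exists d].
by apply: closedU.
Qed.

Definition local (d : nat) (E : pt -> Prop) :=
  forall u u', (forall j, (j < d)%N -> u j = u' j) -> E u -> E u'.

Lemma closed_Phi_img w (E : pt -> Prop) : local (size w) E ->
  closed [set x : 'rV[R]_(size w).+1 | E (vec x)] ->
  closed [set V | exists u, [/\ cube (size w) u, E u & V = Phi w u]].
Proof.
move=> lE cE; set d := size w in lE cE *.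
(* Row vectors have one coordinate more than the cube. [Phi] ignores it, and it is confined to the
   unit interval for compactness. *)
pose K := [set x : 'rV[R]_d.+1 | cube d (vec x)] `&` [set x | E (vec x)] `&`
  [set x | 0 <= vec x d <= 1].
have cK : compact K.
  apply: (@subclosed_compact _ _ [set x : 'rV[R]_d.+1 | forall i, `[0, 1]%classic (x 0 i)]).
  - apply: closedI.
      by apply: closedI => //; apply: closed_all_lt => i; exact: closed_vec_itv.
    exact: closed_vec_itv.
  - by apply: (@rV_compact R d.+1 (fun=> `[0, 1]%classic)) => _; exact: segment_compact.
  - move=> x [[cx _] xd] i; rewrite /= in_itv /=.
    have vx : vec x i = x 0 i.
      by rewrite /vec ltn_ord; congr (x _ _); apply: val_inj; rewrite /= inordK.
    have [id|di] := ltnP i d; first by have := cx i id; rewrite vx.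
    have E' : (i : nat) = d by apply/eqP; rewrite eqn_leq di -ltnS ltn_ord.
    by rewrite -vx E'.
have -> : [set V | exists u, [/\ cube d u, E u & V = Phi w u]] =
    (fun x : 'rV[R]_d.+1 => Phi w (vec x)) @` K.
  apply/seteqP; split => V.
    move=> [u [cu Eu ->]]; exists (trunc d u).
      split; [split|].
      - by move=> i id; rewrite vec_trunc //; exact: cu.
      - by apply: (lE u) => // j jd; rewrite vec_trunc.
      - rewrite /= /vec ltnSn mxE inordK // ltnn; lra.
    by apply: Phi_ext => j jd; rewrite vec_trunc.
  by move=> [x [[cx Ex] _] <-]; exists (vec x).
apply: compact_closed; first exact: gr_hausdorff.
apply: continuous_compact => //; apply: continuous_subspaceT.
exact: (@Phi_ccont R k n kn w _ (fun x : 'rV[R]_d.+1 => vec x) (@vecR_continuous d)).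
Qed.

Lemma wt_ocube w u : cube (size w) u ->
  wt (pivot (PhiV k w u)) = (wt (P0 k n) + size w)%N -> ocube (size w) u.
Proof.
move=> cu E j jw; have /andP[u0 u1] := cu j jw.
have H : ~ (u j = 0 \/ u j = 1).
  move=> uj; have := wt_pivot_inside kn w u; rewrite E leq_add2l leqNgt.
  by rewrite inside_bd //; split => //; exists j.
rewrite !lt_neqAle u0 u1 !andbT; apply/andP; split; apply/eqP => h; apply: H.
  by left.
by right.
Qed.

Lemma pivot_ocube w u : red w -> cube (size w) u -> pivot (PhiV k w u) = endset w ->
  ocube (size w) u.
Proof. by move=> rw cu E; apply: wt_ocube => //; rewrite E wt_red. Qed.

(** The image of the closed cube is compact, hence closed, and contains the cell; conversely each of
    its points is a limit of images of interior points. *)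
Lemma closure_cell w : red w ->
  closure (cellP (endset w)) = [set V | exists2 u, cube (size w) u & V = Phi w u].
Proof.
move=> rw; apply/seteqP; split.
  have -> : [set V | exists2 u, cube (size w) u & V = Phi w u] =
      [set V | exists u, [/\ cube (size w) u, True & V = Phi w u]].
    by apply/seteqP; split => V [u]; [exists u|move=> [cu _ ->]; exists u].
  rewrite closureE; apply: bigcap_inf; split.
    by apply: closed_Phi_img.
  move=> V EV; have [u ou Eu] := Phi_surj kn rw EV; exists u; split => //.
    by move=> j /ou/andP[? ?]; apply/andP; split; exact: ltW.
  exact: val_inj.
move=> _ [u cu ->].
(* The segment from [u] towards the centre of the cube, interior for small t > 0. *)
pose f (t : R) : pt := fun i => u i + t * (1/2 - u i).
have fc i : continuous (fun t => f t i).
  apply: contD; first exact: cst_continuous.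
  by apply: contM; [move=> x; exact: cvg_id|exact: cst_continuous].
have cP := @Phi_ccont R k n kn w _ f fc.
move=> B nB.
have u0 : Phi w (f 0) = Phi w u by apply: Phi_ext => j _; rewrite /f mul0r addr0.
have : \forall t \near 0, B (Phi w (f t)) by apply: cP; rewrite u0.
move=> /nbhs_ballP[e /= e0 he].
pose t := Num.min (e / 2) (1 / 2).
have t0 : 0 < t by rewrite lt_min divr_gt0 // divr_gt0.
have te : t < e by rewrite gt_min; apply/orP; left; rewrite ltr_pdivrMr // mulr_natr mulr2n ltrDl.
have t1 : t <= 1/2 by rewrite ge_min lexx orbT.
exists (Phi w (f t)); split; last first.
  by apply: he; rewrite /ball /= sub0r normrN gtr0_norm.
rewrite /cellP /=; apply: pivot_red => // j jw.
by have /andP[? ?] := cu j jw; rewrite /f; apply/andP; split; nra.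
Qed.

Lemma colour_ext d u u' : (forall j, (j < d)%N -> u j = u' j) -> colour d u = colour d u'.
Proof.
elim: d u u' => //= d IH u u' h; rewrite h //; case: ifP => // _; congr _.+1.
by apply: IH => j jd; exact: h.
Qed.

Lemma core_local d : local d (core d).
Proof. by move=> u u' h cu j jd; rewrite -h //; exact: cu. Qed.

Lemma core_ocube d u : core d u -> ocube d u.
Proof. by move=> h j /h/andP[? ?]; apply/andP; split; lra. Qed.

Lemma Phi_closure w u : red w -> cube (size w) u ->
  closure (cellP (endset w)) (Phi w u).
Proof. by move=> rw cu; rewrite closure_cell //; exists u. Qed.

Lemma Phi_boundary w u : red w -> cubebd (size w) u ->
  (closure (cellP (endset w)) `\` cellP (endset w)) (Phi w u).
Proof.
move=> rw [cu [j jw uj]]; split; first exact: Phi_closure.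
move=> /= E; have /andP[] := pivot_ocube rw cu E jw.
by case: uj => ->; rewrite ltxx.
Qed.

Lemma cubechain_Phi_cycle w : red w ->
  rel_cycle (closure (cellP (endset w))) (closure (cellP (endset w)) `\` cellP (endset w))
    (cubechain (size w) (Phi w)).
Proof.
move=> rw; apply: rel_cycle_cubechain => [||v bv]; first exact: Phi_ccont.
  by move=> v cv; exact: Phi_closure.
exact: Phi_boundary.
Qed.

Section Colouring.
Variables (w : seq 'I_n.-1).
Hypothesis rw : red w.
Let d := size w.

Let rep (V : Gr) := exists u, core d u /\ V = Phi w u.

(** The preimage in the core is picked by choice; it is unique in the coordinates that matter, since
    [Phi] is injective on the open cube. *)
Definition cellcol (V : Gr) : nat :=
  match pselect (rep V) with
  | left h => colour d (projT1 (cid h))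
  | right _ => d.+1
  end.

(* Closed conditions satisfied on the colour classes. No point satisfies all
   of them, hence neither does a simplex of small diameter. *)
Definition cellE (a : nat) (u : pt) : Prop :=
  if (a < d)%N then core d u /\ u a <= 1/2
  else if a == d then core d u /\ (forall i, (i < d)%N -> 1/2 <= u i)
  else exists2 i, (i < d)%N & u i <= 1/4 \/ 3/4 <= u i.

Definition cellD (a : nat) : set Gr :=
  [set V | exists u, [/\ cube d u, cellE a u & V = Phi w u]].

Lemma closed_core : closed [set x : 'rV[R]_d.+1 | core d (vec x)].
Proof. by apply: closed_all_lt => i; exact: closed_vec_itv. Qed.

Lemma cellD_closed a : closed (cellD a).
Proof.
apply: closed_Phi_img.
  move=> u u' h; rewrite /cellE; case: ifP => [ad [cu ua]|_]; last case: ifP => [_ [cu ua]|_].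
  - by split; [exact: core_local cu|rewrite -h].
  - by split; [exact: core_local cu|move=> i id; rewrite -h // ua].
  - by move=> [i id hi]; exists i => //; rewrite -h.
rewrite /cellE; case: (a < d)%N; last case: (a == d).
- by apply: closedI; [exact: closed_core|exact: closed_vec_le].
- apply: closedI; first exact: closed_core.
  by apply: closed_all_lt => i; exact: closed_vec_ge.
- apply: closed_ex_lt => i.
  have -> : (fun x : 'rV[R]_d.+1 => vec x i <= 1/4 \/ 3/4 <= vec x i) =
      [set x | vec x i <= 1/4] `|` [set x | 3/4 <= vec x i] by [].
  by apply: closedU; [exact: closed_vec_le|exact: closed_vec_ge].
Qed.

Lemma cellcol_core u : core d u -> cellcol (Phi w u) = colour d u.
Proof.
move=> cu; rewrite /cellcol; case: pselect => [h|[]]; last by exists u.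
case: (cid h) => u' [cu' E] /=; apply: colour_ext => j jd.
apply/esym; apply: (Phi_inj kn rw (core_ocube cu) (core_ocube cu')) => //.
exact: (congr1 val E).
Qed.

Lemma cellcol_out u : cube d u -> ~ core d u -> cellcol (Phi w u) = d.+1.
Proof.
move=> cu nu; rewrite /cellcol; case: pselect => // -[u' [cu' E]].
case: nu; have E' : PhiV k w u = PhiV k w u' := congr1 val E.
have ou : ocube d u.
  by apply: pivot_ocube => //; rewrite E'; apply: (pivot_red kn rw); exact: core_ocube.
apply: (core_local _ cu') => j jd; apply/esym.
exact: (Phi_inj kn rw ou (core_ocube cu') E').
Qed.

Theorem cell_generator_unit (o : chain R Gr d) m :
  rel_homologous (closure (cellP (endset w)))
    (closure (cellP (endset w)) `\` cellP (endset w)) (cubechain d (Phi w)) (o *~ m) ->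
  m = 1 \/ m = -1.
Proof.
apply: (@cubechain_primitive R Gr cellcol d _ _ cellD).
- by move=> V; rewrite /cellcol; case: pselect => // h; exact: leqW (colour_le _ _).
- move=> V [_ nV]; rewrite /cellcol; case: pselect => // -[u [cu E]].
  by case: nV; rewrite /cellP /= E; apply: (pivot_red kn rw); exact: core_ocube.
- exact: cellD_closed.
- move=> V; rewrite closure_cell // => -[u cu ->].
  have [co|nc] := pselect (core d u).
    rewrite cellcol_core //; exists u; split => //; rewrite /cellE.
    case: ifP => [cd|/negbT]; first by split => //; exact: colour_lt.
    rewrite -leqNgt => dc; have E : colour d u = d by apply/eqP; rewrite eqn_leq colour_le.
    by rewrite E eqxx; split => // i id; apply: ltW; exact: colour_last_gt E i id.
  rewrite cellcol_out //; exists u; split => //; rewrite /cellE ltnNge leqnSn /= gtn_eqF //.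
  have [i id [h|h]] := not_core nc; exists i => //; [left|right]; exact: ltW.
(* A common point would have preimages of three kinds, equal by injectivity on the open cube: one
   with a coordinate i at most 1/4 or at least 3/4, one with all coordinates at least 1/2, and one
   with coordinate i at most 1/2. *)
- move=> V; rewrite closure_cell // => -[u cu EV]; apply: contrapT => H.
  have HD a : (a <= d.+1)%N -> cellD a V.
    by move=> ad; apply: contrapT => nD; apply: H; exists a.
  have [u1 [cu1 E1 EV1]] := HD d.+1 (leqnn _).
  have [u2 [cu2 E2 EV2]] := HD d (leqnSn _).
  move: E1; rewrite /cellE ltnNge leqnSn /= gtn_eqF // => -[i id ui].
  move: E2; rewrite /cellE ltnn eqxx => -[co2 h2].
  have E12 : PhiV k w u1 = PhiV k w u2 by rewrite EV1 in EV2; exact: (congr1 val EV2).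
  have o1 : ocube d u1.
    by apply: pivot_ocube => //; rewrite E12; apply: (pivot_red kn rw); exact: core_ocube.
  have e12 := Phi_inj kn rw o1 (core_ocube co2) E12 id.
  have [u3 [cu3 E3 EV3]] := HD i (leqW (ltnW id)).
  move: E3; rewrite /cellE id => -[co3 u3i].
  have E13 : PhiV k w u1 = PhiV k w u3 by rewrite EV1 in EV3; exact: (congr1 val EV3).
  have e13 := Phi_inj kn rw o1 (core_ocube co3) E13 id.
  by have := h2 i id; case: ui; lra.
- by move=> v _; exact: cellcol_core.
- exact: cellcol_out.
Qed.

End Colouring.

End CellClosure.

(** * Minimal representatives and words *)

Section MinimalRepresentatives.
Variables (k n : nat).
Hypothesis kn : (k <= n)%N.
Implicit Types (u w : 'S_n) (t : seq 'I_n.-1) (P : {set 'I_n}) (i : 'I_n.-1).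
Local Notation P0 := (P0 k n).
Local Notation endset := (endset k).
Local Notation red := (@red k n).

Definition img u : {set 'I_n} := [set u j | j : 'I_n & (j < k)%N]%SET.

Lemma imgE u : img u = [set u j | j in P0]%SET.
Proof.
apply/setP => p; apply/imsetP/imsetP => -[j]; rewrite inE => jk ->;
  by exists j; rewrite ?inE.
Qed.

Lemma mem_img u (j : 'I_n) : (u j \in img u) = (j < k)%N.
Proof. by rewrite imgE mem_imset ?inE //; exact: perm_inj. Qed.

Lemma card_img u : #|img u| = k.
Proof. by rewrite imgE card_imset ?card_P0 //; exact: perm_inj. Qed.

Lemma img1 : img 1%g = P0.
Proof.
rewrite imgE; apply/setP => p; apply/imsetP/idP => [[j jk ->]|pk]; first by rewrite perm1.
by exists p => //; rewrite perm1.
Qed.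

Lemma img_srefl u i : img (u * srefl i)%g = swapset i (img u).
Proof.
apply/setP => p; rewrite in_swapset.
have -> : p = (u * srefl i)%g (u^-1%g (srefl i p)).
  by rewrite permM permKV sreflE tpermK.
by rewrite mem_img permM permKV sreflE !tpermK -[X in X \in img u](permKV u) mem_img.
Qed.

(** The head letter acts last, as in [endset]; the order of multiplication causes the reversal in
    [word_permE]. *)
Definition word_perm t : 'S_n := foldr (fun i u => u * srefl i)%g 1%g t.

Lemma word_permE t : word_perm t = (\prod_(i <- rev t) srefl i)%g.
Proof.
elim: t => [|i t IH] /=; first by rewrite big_nil.
by rewrite rev_cons -cats1 big_cat big_seq1 /= IH.
Qed.

Lemma is_wordP u m : is_word u m <-> exists2 t, size t = m & u = word_perm t.
Proof.
split=> [/existsP[t /eqP ->]|[t <- ->]].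
  by exists (rev t); rewrite ?size_rev ?size_tuple // word_permE revK.
by apply/existsP; exists (rev_tuple (in_tuple t)); rewrite word_permE.
Qed.

Lemma img_word_perm t : img (word_perm t) = endset t.
Proof. by elim: t => [|i t IH] /=; rewrite ?img1 // img_srefl IH. Qed.

Lemma ell_le u m : is_word u m -> (ell u <= m)%N.
Proof. by move=> h; rewrite /ell; case: ex_minnP => l _; exact. Qed.

Lemma ell_word u : exists2 t, size t = ell u & u = word_perm t.
Proof. by apply/is_wordP; rewrite /ell; case: ex_minnP. Qed.

Lemma wt_endset_le t : (wt (endset t) <= wt P0 + size t)%N.
Proof.
elim: t => [|i t IH] /=; first by rewrite addn0.
by apply: leq_trans (wt_swapset_le _ _) _; rewrite addnS ltnS.
Qed.

Lemma wt_swapset_not_up i P : ~~ ((lo i \in P) && (hi i \notin P)) ->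
  (wt (swapset i P) <= wt P)%N.
Proof.
move=> h; have [hP|hP] := boolP (hi i \in P); last first.
  rewrite hP andbT in h.
  suff -> : swapset i P = P by [].
  apply/setP => p; rewrite in_swapset.
  have [->|pl] := eqVneq p (lo i); first by rewrite srefl_lo (negbTE h) (negbTE hP).
  have [->|ph] := eqVneq p (hi i); first by rewrite srefl_hi (negbTE h) (negbTE hP).
  by rewrite srefl_off.
have [lP|lP] := boolP (lo i \in P).
  suff -> : swapset i P = P by [].
  apply/setP => p; rewrite in_swapset.
  have [->|pl] := eqVneq p (lo i); first by rewrite srefl_lo lP hP.
  have [->|ph] := eqVneq p (hi i); first by rewrite srefl_hi lP hP.
  by rewrite srefl_off.
have := @wt_swapset_up _ i (swapset i P); rewrite !in_swapset srefl_lo srefl_hi swapsetK.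
by move=> -> //; exact: leqnSn.
Qed.

Lemma red_of_wt t : wt (endset t) = (wt P0 + size t)%N -> red t.
Proof.
elim: t => //= i t IH E.
have := wt_endset_le t; have := wt_swapset_le i (endset t).
have [up|nup] := boolP ((lo i \in endset t) && (hi i \notin endset t)); last first.
  have := wt_swapset_not_up nup; lia.
by move=> h1 h2; apply/andP; split; [apply: IH; lia|].
Qed.

Definition stab u := forall j : 'I_n, (u j < k)%N = (j < k)%N.

Lemma stab_tperm (x y : 'I_n) : (x < k)%N = (y < k)%N -> stab (tperm x y).
Proof. by move=> xy j; case: tpermP => [->|->|//]. Qed.

Lemma tperm_parabolic (d : nat) (x y : 'I_n) : (x + d.+1)%N = y -> (x < k)%N = (y < k)%N ->
  tperm x y \in parabolic n k.
Proof.
elim: d y => [|d IH] y xy bxy.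
  have lt_i : (x < n.-1)%N by have := ltn_ord y; lia.
  have -> : tperm x y = srefl (Ordinal lt_i).
    by rewrite sreflE; congr tperm; apply: val_inj => //=; lia.
  apply: mem_gen; apply/imsetP; exists (Ordinal lt_i) => //; rewrite inE /=.
  by apply/eqP => E; move: bxy; rewrite -E ltnSn; lia.
have lt_z : (x + d.+1 < n)%N by have := ltn_ord y; lia.
pose z := Ordinal lt_z.
have lt_i : (x + d.+1 < n.-1)%N by have := ltn_ord y; lia.
have sE : srefl (Ordinal lt_i) = tperm z y.
  by rewrite sreflE; congr tperm; apply: val_inj => //=; lia.
have zy : (z < k)%N = (y < k)%N.
  rewrite /=; apply/idP/idP => h; last by lia.
  by rewrite -bxy; lia.
have sP : tperm z y \in parabolic n k.
  rewrite -sE; apply: mem_gen; apply/imsetP; exists (Ordinal lt_i) => //; rewrite inE /=.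
  by apply/eqP => E; move: zy => /=; lia.
have -> : tperm x y = (tperm x z ^ tperm z y)%g.
  by rewrite tpermJ tpermL tpermD // -val_eqE /=; apply/eqP; lia.
by rewrite groupJ // IH // bxy zy.
Qed.

(** Induction on the number of moved points: composing with the transposition of x and u x makes x
    fixed and keeps all fixed points. Both points lie in the same block, so the transposition is in
    the subgroup. *)
Lemma stab_parabolic u : stab u -> u \in parabolic n k.
Proof.
elim: {u}(#|[pred j | u j != j]|) {-2}u (leqnn #|[pred j | u j != j]|) => [|m IH] u.
  rewrite leqn0 => /eqP/card0_eq h _.
  suff -> : u = 1%g by exact: group1.
  by apply/permP => j; rewrite perm1; have := h j; rewrite !inE => /negbFE/eqP.
move=> hm su; have [x ux|fix_u] := pickP [pred j | u j != j]; last first.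
  suff -> : u = 1%g by exact: group1.
  by apply/permP => j; rewrite perm1; have /= := fix_u j; move=> /negbFE/eqP.
rewrite /= in ux; pose v := (u * tperm x (u x))%g.
have bx : (x < k)%N = (u x < k)%N by rewrite su.
have tP : tperm x (u x) \in parabolic n k.
  have [xy|yx|E] := ltngtP x (u x).
  - by apply: (@tperm_parabolic (u x - x).-1) => //; lia.
  - by rewrite tpermC; apply: (@tperm_parabolic (x - u x).-1) => //; lia.
  - by rewrite -(val_inj E) tperm1 group1.
have -> : u = (v * tperm x (u x))%g by rewrite /v -mulgA tperm2 mulg1.
apply: groupM => //; apply: IH; last first.
  by move=> j; rewrite /v permM (stab_tperm bx).
rewrite -ltnS; apply: leq_trans hm; apply: proper_card; apply/properP; split.
  apply/fintype.subsetP => j; rewrite !inE /v permM; apply: contra => /eqP uj.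
  rewrite uj tpermD //; first by apply: contraNneq ux => ->; rewrite uj.
  by apply: contraNneq ux => E; have -> : x = j by [apply: (@perm_inj _ u); rewrite E uj]; rewrite uj.
by exists x; rewrite !inE // /v permM tpermR eqxx.
Qed.

(** A word raises the weight by at most one per letter, which bounds the length from below. A
    reduced word for the set [img w] differs from [w] by an element of the parabolic subgroup, so
    minimality bounds it from above. *)
Lemma ell_minrep w : w \in minrep n k -> (ell w + wt P0)%N = wt (img w).
Proof.
rewrite inE => /forallP minw; have [t rt Et] := red_exists kn (card_img w).
have su : stab (word_perm t * w^-1)%g.
  move=> j; rewrite permM -[RHS](mem_img (word_perm t)) img_word_perm Et.
  by rewrite -[X in _ = (X \in _)](permKV w) mem_img.
have := implyP (minw (word_perm t * w^-1)%g) (stab_parabolic su).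
rewrite mulgKV => h; have hl : (ell w <= size t)%N.
  by apply: leq_trans h _; apply/ell_le/is_wordP; exists t.
have [t' st' Ew] := ell_word w.
have := wt_endset_le t'; rewrite -img_word_perm -Ew st' -Et wt_red //; lia.
Qed.

Lemma minrep_red w : w \in minrep n k -> exists2 t, red t & w = word_perm t.
Proof.
move=> /ell_minrep; have [t st Ew] := ell_word w; exists t => //.
by apply: red_of_wt; rewrite -img_word_perm -Ew st; lia.
Qed.

(** The length is minimised over all permutations with this image, a set stable under the parabolic
    subgroup. *)
Lemma minrep_exists P : #|P| = k -> exists2 w, w \in minrep n k & img w = P.
Proof.
move=> /(red_exists kn)[t _ Et].
have [w /eqP Ew wmin] := @arg_minnP _ (word_perm t) (fun u => img u == P) (@ell n)
  (introT eqP (etrans (img_word_perm t) Et)).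
exists w => //; rewrite inE; apply/forallP => u; apply/implyP => uP; apply: wmin.
apply/eqP; rewrite -[RHS]Ew.
have su : stab u.
  pose G : {set 'S_n} := [set v : 'S_n | [forall j : 'I_n, (v j < k)%N == (j < k)%N]]%SET.
  have inG v : reflect (stab v) (v \in G).
    rewrite inE; apply: (iffP forallP) => h j; first exact: (eqP (h j)).
    by apply/eqP; exact: h.
  have gG : group_set G.
    apply/group_setP; split; first by apply/inG => j; rewrite perm1.
    by move=> x y /inG hx /inG hy; apply/inG => j; rewrite permM hy hx.
  have sub : parabolic n k \subset Group gG.
    rewrite gen_subG; apply/fintype.subsetP => x /imsetP[i]; rewrite inE => ik ->.
    apply/inG; rewrite sreflE; apply: stab_tperm => /=.
    by move/eqP: ik => ik; apply/idP/idP; lia.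
  by apply/inG; exact: (fintype.subsetP sub).
rewrite !imgE; apply/setP => p; apply/imsetP/imsetP => -[j]; rewrite inE => jk ->.
  by exists (u j); rewrite ?inE ?su // permM.
exists (u^-1%g j); first by rewrite inE -su permKV.
by rewrite permM permKV.
Qed.

Definition mono u := forall a b : 'I_n, (a < b)%N -> (b < k)%N || (k <= a)%N -> (u a < u b)%N.

(** An upward letter exchanges two consecutive values, taken on different blocks; no comparison
    within a block changes. *)
Lemma mono_word_perm t : red t -> mono (word_perm t).
Proof.
elim: t => [|i t IH] /=; first by move=> _ a b ab _; rewrite !perm1.
move=> /and3P[rt lt ht] a b ab bab; have h := IH rt a b ab bab.
rewrite !permM; rewrite -img_word_perm in lt ht.
have mi := mem_img (word_perm t).
have [Ea|al] := eqVneq (word_perm t a) (lo i).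
  rewrite Ea srefl_lo; rewrite -Ea mi in lt.
  have [Eb|bh] := eqVneq (word_perm t b) (hi i).
    rewrite -Eb mi in ht; move: bab ht; rewrite -!ltnNge; lia.
  have bl : word_perm t b != lo i by apply: contraTneq h => ->; rewrite Ea ltnn.
  rewrite srefl_off //; move: h bh; rewrite Ea -val_eqE /= => h /eqP bh; lia.
have [Ea|ah] := eqVneq (word_perm t a) (hi i).
  rewrite Ea srefl_hi; rewrite Ea /= in h.
  have bl : word_perm t b != lo i by rewrite -val_eqE /=; apply/eqP; lia.
  have bh : word_perm t b != hi i by rewrite -val_eqE /=; apply/eqP; lia.
  by rewrite srefl_off //=; lia.
rewrite [srefl i (word_perm t a)]srefl_off //.
have [Eb|bl] := eqVneq (word_perm t b) (lo i).
  by rewrite Eb srefl_lo; rewrite Eb /= in h *; lia.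
have [Eb|bh] := eqVneq (word_perm t b) (hi i); last by rewrite srefl_off.
rewrite Eb srefl_hi; rewrite Eb /= in h *.
by move: al; rewrite -val_eqE /= => /eqP; lia.
Qed.

Lemma mono_minrep w : w \in minrep n k -> mono w.
Proof. by move=> /minrep_red[t rt ->]; exact: mono_word_perm. Qed.

Lemma mono_ltE u (B : {set 'I_n}) : mono u -> B = P0 \/ B = ~: P0 ->
  {in B &, forall a b, (u a < u b)%N = (a < b)%N}.
Proof.
move=> mu hB a b aB bB.
have bl (x y : 'I_n) : x \in B -> y \in B -> (x < y)%N -> (u x < u y)%N.
  move=> xB yB xy; apply: mu => //; case: hB xB yB => ->; rewrite !inE -?leqNgt.
    by move=> _ ->.
  by move=> -> _; rewrite orbT.
have [ab|ba|E] := ltngtP a b.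
- exact: bl.
- by apply/negbTE; rewrite -leqNgt ltnW // bl.
- by rewrite (val_inj E) ltnn.
Qed.

Lemma mono_below u (B : {set 'I_n}) j : mono u -> B = P0 \/ B = ~: P0 -> j \in B ->
  below [set u a | a in B]%SET (u j) = below B j.
Proof.
move=> mu hB jB; rewrite /below -[RHS](card_imset _ (@perm_inj _ u)).
apply: eq_card => p; rewrite inE; apply/andP/imsetP => [[/imsetP[a aB ->] uaj]|[a]].
  by exists a => //; rewrite inE aB -(mono_ltE mu hB aB jB).
rewrite inE => /andP[aB aj] ->; rewrite (mono_ltE mu hB aB jB).
by split => //; apply/imsetP; exists a.
Qed.

(** On each block an increasing map is determined by its image: u j has as many elements of the
    image below it as j has in the block. *)
Lemma mono_uniq u v : mono u -> mono v -> img u = img v -> u = v.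
Proof.
move=> mu mv; rewrite !imgE => E.
have H (B : {set 'I_n}) : B = P0 \/ B = ~: P0 -> [set u a | a in B]%SET = [set v a | a in B]%SET ->
    {in B, u =1 v}.
  move=> hB EB j jB; apply: val_inj => /=.
  have b1 := mono_below mu hB jB; have b2 := mono_below mv hB jB.
  have uQ : u j \in [set v a | a in B]%SET by rewrite -EB; apply/imsetP; exists j.
  have vQ : v j \in [set u a | a in B]%SET by rewrite EB; apply/imsetP; exists j.
  have [lt|gt|//] := ltngtP (u j) (v j).
    have := below_le [set v a | a in B]%SET lt; rewrite belowS uQ b2 -EB b1; lia.
  have := below_le [set u a | a in B]%SET gt; rewrite belowS vQ b1 EB b2; lia.
apply/permP => j; have [jP|jP] := boolP (j \in P0); first exact: (H P0 (or_introl erefl) E).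
have aux (z : 'S_n) p : (p \in [set z a | a in ~: P0]%SET) = (p \notin [set z a | a in P0]%SET).
  by rewrite -[p](permKV z) !mem_imset ?finset.in_setC //; exact: perm_inj.
apply: (H (~: P0) (or_intror erefl)); last by rewrite finset.in_setC.
by apply/setP => p; rewrite !aux E.
Qed.

Lemma minrep_uniq u v : u \in minrep n k -> v \in minrep n k -> img u = img v -> u = v.
Proof. by move=> /mono_minrep mu /mono_minrep mv; exact: mono_uniq. Qed.

Lemma minrep_up u v i : u \in minrep n k -> v \in minrep n k ->
  lo i \in img u -> hi i \notin img u -> img v = swapset i (img u) -> v = (u * srefl i)%g.
Proof.
move=> uM vM lu hu E; have [t rt Et] := minrep_red uM.
rewrite Et; apply: mono_uniq; first exact: mono_minrep.
  by apply: (@mono_word_perm (i :: t)); rewrite /= rt -!img_word_perm -Et lu hu.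
by rewrite E img_srefl -Et.
Qed.

Lemma minrep_up_inv u i : u \in minrep n k -> (u * srefl i)%g \in minrep n k ->
  ell (u * srefl i)%g = (ell u).+1 -> lo i \in img u /\ hi i \notin img u.
Proof.
move=> /ell_minrep Eu /ell_minrep; rewrite img_srefl => Ev E; apply/andP.
apply/negPn/negP => /wt_swapset_not_up; lia.
Qed.

End MinimalRepresentatives.

(** * Parity of the added box and of the number of flips *)

Section Parity.
Variables (k n : nat).
Hypothesis kn : (k <= n)%N.
Implicit Types (u w : 'S_n) (t : seq 'I_n.-1) (P : {set 'I_n}) (i : 'I_n.-1).
Local Notation P0 := (P0 k n).

Lemma below_leq P j : (j <= n)%N -> (below P j <= j)%N.
Proof.
elim: j => [|j IH] jn; first by rewrite below0.
rewrite (belowS P (Ordinal jn)) -addn1; apply: leq_add; last exact: leq_b1.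
by apply: IH; exact: ltnW.
Qed.

Lemma below_setT j : (j <= n)%N -> below [set: 'I_n]%SET j = j.
Proof.
elim: j => [|j IH] jn; first by rewrite below0.
by rewrite (belowS _ (Ordinal jn)) /= IH ?finset.in_setT ?addn1 // ltnW.
Qed.

Lemma mono_ge u (j : 'I_n) : mono k u -> (j < k)%N -> (j <= u j)%N.
Proof.
move=> mu jk.
have jP : j \in P0 by rewrite inE.
have := mono_below mu (or_introl erefl) jP; rewrite (below_P0 kn (ltnW jk)).
by move=> <-; apply: below_leq; exact: ltnW.
Qed.

(** The new box lies in row j0, the position of the value i, and in column i - j0. In its parity (k
    - 1 - j0) + (i - j0) the row j0 cancels. *)
Lemma eta_up u i : mono k u -> lo i \in img k u -> hi i \notin img k u ->
  eta k (u * srefl i)%g = (eta k u + ~~ odd (i + k.-1))%N.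
Proof.
move=> mu lu hu; set v := (u * srefl i)%g.
pose j0 := (u^-1)%g (lo i); have uj0 : u j0 = lo i by rewrite permKV.
have j0k : (j0 < k)%N by rewrite -(mem_img k u) uj0.
have j0i : (j0 <= i)%N by have := mono_ge mu j0k; rewrite uj0.
have vj0 : v j0 = i.+1 :> nat by rewrite permM uj0 srefl_lo.
have vj (j : 'I_n) : (j < k)%N -> j != j0 -> v j = u j.
  move=> jk jj; rewrite permM srefl_off //.
    by apply: contra jj => /eqP E; rewrite -(inj_eq (@perm_inj _ u)) uj0 E.
  by apply: contraNneq hu => <-; rewrite mem_img.
have bn : (i - j0 < n)%N by have := ltn_ord (lo i) => /=; lia.
pose x0 : 'I_n * 'I_n := (j0, Ordinal bn).
have Y : young k v = x0 |: young k u.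
  apply/setP => -[j b]; rewrite !inE /= xpair_eqE.
  have [->|jj] := eqVneq j j0.
    rewrite j0k vj0 uj0 -val_eqE /=; apply/idP/idP => h; have := ltn_ord b; lia.
  by case: ltnP => //= jk; rewrite vj.
have nx0 : x0 \notin young k u by rewrite inE /= uj0 /= ltnn andbF.
have par : odd (k.-1 - x0.1 + x0.2) = odd (i + k.-1).
  by rewrite /=; have -> : (i + k.-1 = (k.-1 - j0 + (i - j0)) + j0.*2)%N by [lia];
     rewrite [RHS]oddD odd_double addbF.
rewrite /eta Y -par; case: (boolP (odd _)) => o /=.
  rewrite addn0; apply: eq_card => x; rewrite inE [RHS]inE finset.in_setU1.
  by have [->|//] := eqVneq x x0; rewrite o (negbTE nx0) andbF.
have -> : [set x in x0 |: young k u | ~~ odd (k.-1 - x.1 + x.2)]%SET =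
    x0 |: [set x in young k u | ~~ odd (k.-1 - x.1 + x.2)]%SET.
  apply/setP => x; rewrite inE !finset.in_setU1 [in RHS]inE.
  by have [->|//] := eqVneq x x0; rewrite o.
by rewrite cardsU1 inE (negbTE nx0) /= addnC.
Qed.

(* The number of letters of a word for [P] whose coordinate is flipped by the
   sign changes [eps]: each letter exchanges one pair (element, non-element). *)
Definition crossings P (eps : 'I_n -> bool) : nat :=
  (\sum_(p in P) \sum_(q | (q \notin P) && (q < p)%N) (eps p != eps q))%N.

(** After reindexing by the reflection, the order of a pair (element, non-element) changes only for
    (lo i, hi i), which becomes a new crossing. *)
Lemma crossings_swap i P eps : lo i \in P -> hi i \notin P ->
  crossings (swapset i P) eps = ((eps (lo i) != eps (hi i)) + crossings P (eswap i eps))%N.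
Proof.
move=> lP hP; rewrite /crossings big_imset /=; last by move=> p q _ _; exact: srefl_inj.
have inner p : (\sum_(q | (q \notin swapset i P) && (q < srefl i p)%N) (eps (srefl i p) != eps q) =
    \sum_(q | (q \notin P) && (srefl i q < srefl i p)%N)
       (eswap i eps p != eswap i eps q))%N.
  rewrite (reindex_inj (@srefl_inj n i)) /=; apply: eq_bigl => q.
  by rewrite in_swapset sreflE tpermK.
under eq_bigr => p _ do rewrite inner.
rewrite (bigD1 (lo i)) //= [in RHS](bigD1 (lo i)) //= addnA; congr addn.
  rewrite (bigD1 (hi i)) /=; last by rewrite hP srefl_lo srefl_hi /=.
  have elo : eswap i eps (lo i) = eps (hi i) by rewrite /eswap srefl_lo.
  have ehi : eswap i eps (hi i) = eps (lo i) by rewrite /eswap srefl_hi.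
  rewrite elo ehi eq_sym; congr addn.
  apply: eq_bigl => q; rewrite srefl_lo.
  have [->|ql] := eqVneq q (lo i); first by rewrite lP.
  have [->|qh] := eqVneq q (hi i); first by rewrite andbF hP /= ltnNge leqnSn.
  rewrite andbT srefl_off //; congr andb; apply/idP/idP => /= h; last by lia.
  by move: ql; rewrite -val_eqE /= => /eqP; lia.
apply: eq_bigr => p /andP[pP pl]; apply: eq_bigl => q.
case: (boolP (q \in P)) => //= qP.
have ph : p != hi i by apply: contraNneq hP => <-.
have ql : q != lo i by apply: contraNneq qP => ->.
rewrite [srefl i p]srefl_off //; have [->|qh] := eqVneq q (hi i).
  by rewrite srefl_hi /=; move: pl ph; rewrite -!val_eqE /= => /eqP ? /eqP ?; apply/idP/idP; lia.
by rewrite srefl_off.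
Qed.

Lemma crossings_base eps : crossings P0 eps = 0%N.
Proof.
apply: big1 => p; rewrite inE => pk; apply: big1 => q; rewrite inE -leqNgt => /andP[kq qp].
by move: kq; rewrite leqNgt (ltn_trans qp).
Qed.

Lemma count_flipb t eps : red k t ->
  count id (flipb t eps) = crossings (endset k t) eps.
Proof.
elim: t eps => [|i t IH] eps /=; first by rewrite crossings_base.
by move=> /and3P[rt lt ht]; rewrite crossings_swap // IH.
Qed.

(** Let j be the number of elements below [lo i]. The flipped pairs are [lo i] with the i - j gaps
    below it, and the k - j - 1 elements above [hi i] with the gap [hi i]; together i + k - 1 -
    2j. *)
Lemma odd_crossings P i : #|P| = k -> lo i \in P -> hi i \notin P ->
  odd (crossings P (fun p => (p == lo i) || (p == hi i))) = odd (i + k.-1).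
Proof.
move=> cP lP hP; rewrite /crossings (bigD1 (lo i)) //= eqxx /=.
set j := below P (lo i).
have ji : (j <= i)%N.
  by rewrite /j; apply: (@below_leq P (lo i)); exact: ltnW.
have -> : (\sum_(q | (q \notin P) && (q < i)%N) (true != (q == lo i) || (q == hi i)) = i - j)%N.
  have -> : (i - j = \sum_(q : 'I_n | (q < i)%N) 1 - \sum_(q | (q \in P) && (q < i)%N) 1)%N.
    congr subn; last by rewrite sum1_card /j /below; apply: eq_card => q; rewrite !inE.
    rewrite sum1_card -[LHS](@below_setT (lo i)) ?(ltnW (ltn_ord _)) //.
    by apply: eq_card => q; rewrite !inE.
  rewrite [X in (X - _)%N](bigID (fun q => q \in P)) /=.
  have -> : (\sum_(q : 'I_n | (q < i)%N && (q \in P)) 1 = \sum_(q : 'I_n | (q \in P) && (q < i)%N) 1)%N.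
    by apply: eq_bigl => q; rewrite andbC.
  rewrite addKn; apply: eq_big => [q|q /andP[qP qi]]; first by rewrite andbC.
  by rewrite -!val_eqE /= !ltn_eqF // ltnW.
have -> : (\sum_(p in P | p != lo i) \sum_(q | (q \notin P) && (q < p)%N)
     (((p == lo i) || (p == hi i)) != ((q == lo i) || (q == hi i))) =
   \sum_(p in P | p != lo i) (hi i < p))%N.
  apply: eq_bigr => p /andP[pP /negbTE pl].
  have /negbTE ph : p != hi i by apply: contraNneq hP => <-.
  rewrite pl ph /=; case: ltnP => hp.
    rewrite (bigD1 (hi i)) /=; last by rewrite hP.
    rewrite eqxx orbT big1 // => q /andP[/andP[qP qp] /negbTE qh].
    by have /negbTE -> : q != lo i by [apply: contraNneq qP => ->]; rewrite qh.
  apply: big1 => q /andP[qP qp].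
  have /negbTE -> : q != lo i by apply: contraNneq qP => ->.
  have /negbTE -> // : q != hi i.
  by rewrite -val_eqE /= neq_ltn (leq_trans qp).
have -> : (\sum_(p in P | p != lo i) (hi i < p) = k - j.+1)%N.
  have E1 : (\sum_(p in P | p != lo i) 1 = j + \sum_(p in P | p != lo i) (hi i < p))%N.
    rewrite (bigID (fun p : 'I_n => (p < lo i)%N)) /=; congr addn.
      rewrite /j /below -[RHS]sum1_card; apply: eq_bigl => p; rewrite !inE.
      by case: (p \in P) => //=; case: ltnP; rewrite ?andbF // andbT => h; rewrite -val_eqE /= ltn_eqF.
    rewrite [LHS]big_mkcondr /=; apply: eq_bigr => p /andP[pP pl].
    have ph : p != hi i by apply: contraNneq hP => <-.
    by move: pl ph; rewrite -!val_eqE /= => /eqP pl /eqP ph; do 2!case: ltnP => //=; lia.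
  have E : (k = j.+1 + \sum_(p in P | p != lo i) (hi i < p))%N.
    by rewrite -[LHS]cP -sum1_card (bigD1 (lo i)) //= E1 addSn ?add1n.
  by rewrite {1}E addKn.
have jk : (j.+1 <= k)%N.
  by have := below_le P (ltn_ord (lo i)); rewrite belown cP belowS lP addn1.
have -> : (i + k.-1 = (i - j + (k - j.+1)) + j.*2)%N by lia.
by rewrite [RHS]oddD odd_double addbF.
Qed.

End Parity.

(** * Incidence numbers *)

Section RelativeCochains.
Variables (R : realType) (X : topologicalType).
Notation pt := (nat -> R).
Notation chn d := (chain R X d).
Implicit Types (A B : set X).

Lemma rel_cycleS A A' B B' d (c : chn d) : A `<=` A' -> B `<=` B' ->
  rel_cycle A B c -> rel_cycle A' B' c.
Proof.
case: d c => [|d] c AA BB; first exact: chain_inS.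
by move=> [h1 h2]; split; [exact: chain_inS h1|exact: chain_inS h2].
Qed.

Lemma rel_cycleD A B d (c c' : chn d) : rel_cycle A B c -> rel_cycle A B c' ->
  rel_cycle A B (c + c').
Proof.
case: d c c' => [|d] c c'; first exact: chain_inD.
move=> [h1 h2] [h1' h2']; split; first exact: chain_inD.
by rewrite /bd fgliftD; exact: chain_inD.
Qed.

Lemma rel_cycleN A B d (c : chn d) : rel_cycle A B c -> rel_cycle A B (- c).
Proof.
case: d c => [|d] c; first exact: chain_inN.
move=> [h1 h2]; split; first exact: chain_inN.
by rewrite /bd fgliftN; exact: chain_inN.
Qed.

Lemma rel_cycle_mulz A B d (c : chn d) m : rel_cycle A B c -> rel_cycle A B (c *~ m).
Proof.
case: d c => [|d] c; first exact: chain_in_mulz.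
move=> [h1 h2]; split; first exact: chain_in_mulz.
by rewrite /bd fglift_mulz; exact: chain_in_mulz.
Qed.

Lemma chain_in0 A d : chain_in A (0 : chn d).
Proof. by apply/chain_in_supp; exact: supp0. Qed.

Lemma rel_cycle0 A B d : rel_cycle A B (0 : chn d).
Proof.
case: d => [|d]; first exact: chain_in0.
by split; [exact: chain_in0|rewrite /bd fglift0; exact: chain_in0].
Qed.

Lemma rel_cycle_sum A B d (I : Type) (r : seq I) (F : I -> chn d) :
  (forall i, rel_cycle A B (F i)) -> rel_cycle A B (\sum_(i <- r) F i).
Proof.
by move=> h; apply: (big_ind (rel_cycle A B (d:=d))) => //; [exact: rel_cycle0|exact: rel_cycleD].
Qed.

Variables (A B : set X) (d : nat) (f : chn d -> int).
Hypothesis hf : rel_cochain A B f.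

Lemma rel_cochainD c c' : rel_cycle A B c -> rel_cycle A B c' -> f (c + c') = f c + f c'.
Proof. exact: hf.1. Qed.

Lemma rel_cochain0 : f 0 = 0.
Proof.
have := rel_cochainD (@rel_cycle0 A B d) (@rel_cycle0 A B d).
by rewrite addr0 => /esym/eqP; rewrite -subr_eq0 addrK => /eqP.
Qed.

Lemma rel_cochainN c : rel_cycle A B c -> f (- c) = - f c.
Proof.
move=> hc; apply/eqP; rewrite -addr_eq0 -rel_cochainD ?addNr ?rel_cochain0 //.
exact: rel_cycleN.
Qed.

Lemma rel_cochain_mulz c m : rel_cycle A B c -> f (c *~ m) = f c *~ m.
Proof.
move=> hc; have hn (l : nat) : f (c *+ l) = f c *+ l.
  elim: l => [|l IH]; first by rewrite !mulr0n rel_cochain0.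
  rewrite !mulrS rel_cochainD ?IH //.
  by have := @rel_cycle_mulz A B d c l hc.
case: m => l; rewrite /intmul; first exact: hn.
by rewrite rel_cochainN ?hn //; have := @rel_cycle_mulz A B d c l.+1 hc.
Qed.

Lemma rel_cochain_sum (I : Type) (r : seq I) (F : I -> chn d) :
  (forall i, rel_cycle A B (F i)) -> f (\sum_(i <- r) F i) = \sum_(i <- r) f (F i).
Proof.
move=> h; elim: r => [|i r IH]; first by rewrite !big_nil rel_cochain0.
by rewrite !big_cons rel_cochainD ?IH //; exact: rel_cycle_sum.
Qed.

Lemma rel_cochain_in_B c : chain_in B c -> rel_cycle A B c -> f c = 0.
Proof.
move=> cB hc; rewrite -rel_cochain0; apply: hf.2 => //; first exact: rel_cycle0.
exists 0, c; split => //; first exact: chain_in0.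
by rewrite subr0 /bd fglift0 add0r.
Qed.

Definition flip1 (j : nat) (u : pt) : pt := fun a => if a == j then 1 - u a else u a.

Definition cube_map (e : nat) (Psi : pt -> X) :=
  [/\ ccont Psi, forall v, cube e v -> A (Psi v) & forall v, cubebd e v -> B (Psi v)].

Lemma cube_map_cycle e Psi : cube_map e Psi -> rel_cycle A B (cubechain e Psi).
Proof. by case=> *; exact: rel_cycle_cubechain. Qed.

Lemma cube_flip1 e j u : cube e u -> cube e (flip1 j u).
Proof.
by move=> h a /h/andP[? ?]; rewrite /flip1; case: (a == j) => //; apply/andP; split; lra.
Qed.

Lemma cube_map_flip1 e j Psi : cube_map e Psi -> cube_map e (Psi \o flip1 j).
Proof.
move=> [cP PA PB]; split.
- move=> T g hg; apply: (cP T (fun x => flip1 j (g x))) => a; rewrite /flip1.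
  by case: (a == j) => //; apply: contB => //; exact: cst_continuous.
- by move=> v cv; apply/PA/cube_flip1.
move=> v [cv [a ad va]]; apply: PB; split; first exact: cube_flip1.
exists a => //; rewrite /flip1; case: (a == j) => //.
by case: va => ->; [right|left]; rewrite ?subr0 ?subrr.
Qed.

(* The square map (s, t) |-> t (1 - s) has the sides id, 1 - id, 0 and 0. *)
Definition fold1 (j : nat) (u : pt) : pt :=
  fun a => if (a < j)%N then u a else if a == j then u j.+1 * (1 - u j) else u a.+1.

Lemma fold1_cube e j u : (j < e)%N -> cube e.+1 u -> cube e (fold1 j u).
Proof.
move=> je cu a ae; rewrite /fold1; case: ltnP => aj; first by apply: cu; lia.
case: eqP => _; last by apply: cu.
have /andP[a0 a1] := cu j (leq_trans je (leqnSn e)); have /andP[b0 b1] := cu j.+1 je.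
by apply/andP; split; nra.
Qed.

Lemma fold1_j0 j : fold1 j \o ins j 0 = id.
Proof.
apply/funext => u; apply/funext => a; rewrite /fold1 /ins /= ltnn eqxx.
have -> : (j.+1 < j)%N = false by lia.
have -> : (j.+1 == j) = false by lia.
case: ltnP => aj; first by [].
have [->|aj'] := eqVneq a j; first by rewrite subr0 mulr1.
have -> : (a.+1 < j)%N = false by lia.
by have -> : (a.+1 == j) = false by lia.
Qed.

Lemma fold1_j1 j : fold1 j \o ins j.+1 1 = flip1 j.
Proof.
apply/funext => u; apply/funext => a; rewrite /fold1 /ins /flip1 /= ltnn eqxx ltnSn.
case: ltnP => aj.
  by rewrite ltnS ltnW // ltn_eqF.
have [->|aj'] := eqVneq a j; first by rewrite mul1r.
have -> : (a.+1 < j.+1)%N = false by lia.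
by have -> : (a.+1 == j.+1) = false by lia.
Qed.

Lemma fold1_bd e j l eps u : (j < e)%N -> (l <= e)%N -> eps = 0 \/ eps = 1 -> cube e u ->
  (l = j -> eps = 1) -> (l = j.+1 -> eps = 0) -> cubebd e (fold1 j (ins l eps u)).
Proof.
move=> je le e01 cu lj ljS; split.
  by apply: fold1_cube => //; apply: cube_ins => //; case: e01 => ->; lra.
have insl : ins l eps u l = eps by rewrite /ins ltnn eqxx.
have [E|nlj] := eqVneq l j.
  by exists j => //; left; rewrite /fold1 ltnn eqxx -{2}E insl lj // subrr mulr0.
have [E|nljS] := eqVneq l j.+1.
  by exists j => //; left; rewrite /fold1 ltnn eqxx -E insl ljS // mul0r.
have [l_lt_j|jl] := ltnP l j.
  by exists l; [exact: ltn_trans je|rewrite /fold1 l_lt_j insl].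
exists l.-1; first by lia.
rewrite /fold1; have -> : (l.-1 < j)%N = false by lia.
have -> : (l.-1 == j) = false by lia.
by have -> : l.-1.+1 = l by [lia]; rewrite insl.
Qed.

(** In the boundary of the cube Psi \o fold1 j the sides Psi and Psi \o flip1 j carry the same sign:
    one is a 0-face in direction j, the other a 1-face in direction j + 1. All other sides lie in B,
    so their sum is homologous to 0. *)
Lemma cochain_flip1 j Psi : cube_map d Psi -> (j < d)%N ->
  f (cubechain d (Psi \o flip1 j)) = - f (cubechain d Psi).
Proof.
move=> gP jd; have [cP PA PB] := gP.
have hc := cube_map_cycle gP; have hc' := cube_map_cycle (cube_map_flip1 j gP).
apply/eqP; rewrite -addr_eq0 -rel_cochainD //; apply/eqP.
set x := _ + _; have hx : rel_cycle A B x by exact: rel_cycleD.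
pose Q := Psi \o fold1 j.
have cQ : ccont Q.
  move=> T g hg; apply: (cP T (fun x => fold1 j (g x))) => a; rewrite /fold1.
  case: (ltnP a j) => _ //; case: (a == j) => //.
  by apply: contM => //; apply: contB => //; exact: cst_continuous.
pose s : int := (-1) ^+ j.
have ss1 : s * s = 1 by rewrite /s -expr2 sqrr_sign.
pose F (l : nat) (eps : R) : chn d := cubechain d (Q \o ins l eps).
have FB l eps : (l <= d)%N -> eps = 0 \/ eps = 1 -> (l = j -> eps = 1) -> (l = j.+1 -> eps = 0) ->
    chain_in B (F l eps).
  move=> ld e01 h1 h2; apply: chain_in_cubechain; first exact: ccont_ins.
  by move=> v cv; apply: PB; exact: fold1_bd.
have Fj0 : F j 0 = cubechain d Psi by rewrite /F /Q -compA fold1_j0.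
have Fj1 : F j.+1 1 = cubechain d (Psi \o flip1 j) by rewrite /F /Q -compA fold1_j1.
have [a aB E] : exists2 a, chain_in B a & bd (cubechain d.+1 Q) = a - x *~ s.
  rewrite bd_cubechain.
  have j0 : (j < d.+1)%N by exact: ltnW.
  rewrite (bigD1 (Ordinal j0)) //= (bigD1 (Ordinal (jd : j.+1 < d.+1)%N)) /=; last first.
    by rewrite -val_eqE /= gtn_eqF.
  rewrite -/(F j 1) -/(F j 0) -/(F j.+1 1) -/(F j.+1 0) Fj0 Fj1.
  set r := \sum_(l < _ | _) _.
  have rB : chain_in B r.
    apply: chain_in_sum => l /andP[]; rewrite -!val_eqE /= => /eqP lj /eqP ljS.
    apply: chain_in_mulz; have ld : (l <= d)%N by rewrite -ltnS.
    by apply: chain_inD; [|apply: chain_inN]; apply: FB => //; [right|left].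
  exists (F j 1 *~ s + F j.+1 0 *~ s + r).
    apply: chain_inD => //; apply: chain_inD; apply: chain_in_mulz; apply: FB => //; try lia.
    - by right.
    - by left.
  rewrite exprS mulN1r mulrNz -/s /x !mulrzBl mulrzDl opprB opprD.
  by rewrite !addrA [LHS](AC 5 (1*3*5*4*2))/=.
have Ex : x = bd (- cubechain d.+1 Q *~ s) + a *~ s.
  rewrite mulNrz /bd fgliftN fglift_mulz -/(bd _) E mulrzBl opprB -mulrzA ss1 mulr1z.
  by rewrite subrK.
rewrite -rel_cochain0; apply: hf.2 => //; first exact: rel_cycle0.
exists (- cubechain d.+1 Q *~ s), (a *~ s); split.
- apply: chain_in_mulz; apply: chain_inN; apply: chain_in_cubechain => //.
  by move=> v cv; apply: PA; exact: fold1_cube.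
- exact: chain_in_mulz.
by rewrite subr0.
Qed.

Lemma flipu_rcons bs b : flipu (rcons bs b) =
  if b then (@flipu R bs \o flip1 (size bs)) else @flipu R bs.
Proof.
apply/funext => u; apply/funext => a; rewrite /flipu nth_rcons.
have [ab|ba|->] := ltngtP a (size bs).
- by case: b => //=; rewrite /flip1 ltn_eqF.
- by case: b; rewrite /= ?[nth false bs a]nth_default ?(ltnW ba) // /flip1 gtn_eqF.
- by case: b; rewrite /= nth_default // /flip1 eqxx.
Qed.

Lemma cube_map_flipu e bs Psi : cube_map e Psi -> cube_map e (Psi \o flipu bs).
Proof.
elim/last_ind: bs Psi => [|bs b IH] Psi gP.
  have -> : Psi \o flipu [::] = Psi by apply/funext => u /=; congr Psi; apply/funext => -[].
  by [].
rewrite flipu_rcons; case: b; last exact: IH.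
by rewrite compA; apply: cube_map_flip1; exact: IH.
Qed.

Lemma cochain_flipu bs Psi : cube_map d Psi -> (size bs <= d)%N ->
  f (cubechain d (Psi \o flipu bs)) = (-1) ^+ count id bs * f (cubechain d Psi).
Proof.
elim/last_ind: bs => [|bs b IH] gP sb.
  rewrite expr0 mul1r; congr (f (cubechain d _)).
  by apply/funext => u /=; congr Psi; apply/funext => -[].
rewrite size_rcons in sb; have {}IH := IH gP (ltnW sb).
rewrite flipu_rcons -cats1 count_cat /=; case: b; last by rewrite !addn0 IH.
rewrite compA cochain_flip1 //; last exact: cube_map_flipu.
by rewrite IH addn0 addn1 exprS mulN1r mulNr.
Qed.

End RelativeCochains.

(** * Diagrams differing by one box *)

Section Diagrams.
Variables (k n : nat).
Implicit Types (P Q : {set 'I_n}) (i : 'I_n.-1).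

(** Double counting: p is below exactly n - p of the values l. *)
Lemma sum_below P : (\sum_(l < n.+1) below P l + wt P = #|P| * n)%N.
Proof.
have -> : (\sum_(l < n.+1) below P l = \sum_(p in P) (n - p))%N.
  transitivity (\sum_(l < n.+1) \sum_(p in P) (p < l))%N.
    apply: eq_bigr => l _; rewrite /below -sum1_card big_mkcond [RHS]big_mkcond /=.
    by apply: eq_bigr => p _; rewrite inE; case: (p \in P); case: ltnP.
  rewrite exchange_big /=; apply: eq_bigr => p _.
  transitivity (\sum_(0 <= l < n.+1) (p < l))%N; first by rewrite big_mkord.
  rewrite (@big_cat_nat _ _ _ p.+1) //=; last by rewrite ltnS ltnW.
  rewrite big_nat big1 ?add0n; last by move=> l /andP[_]; rewrite ltnS => lp; rewrite ltnNge lp.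
  rewrite big_nat (eq_bigr (fun=> 1%N)); last by move=> l /andP[pl _]; rewrite pl.
  by rewrite -big_nat sum_nat_const_nat muln1 subSS.
rewrite /wt -big_split /= (eq_bigr (fun=> n)); last first.
  by move=> p _; rewrite subnK // ltnW.
by rewrite sum_nat_const.
Qed.

(** By [sum_below] the gaps between the two counts add up to one. They therefore agree except at a
    single l0, which forces an exchange of the positions l0 - 1 and l0. *)
Lemma cover_swapset P Q : #|P| = #|Q| -> wt Q = (wt P).+1 ->
  (forall l, (below Q l <= below P l)%N) ->
  exists i, [/\ lo i \in P, hi i \notin P & Q = swapset i P].
Proof.
move=> cPQ wPQ bPQ.
have S : (\sum_(l < n.+1) (below P l - below Q l) = 1)%N.
  rewrite sumnB; last by move=> l _; exact: bPQ.
  have e1 := sum_below P; have e2 := sum_below Q; rewrite wPQ in e2.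
  rewrite cPQ -e2 addnS -addSn in e1; rewrite (addIn e1).
  by rewrite subSn // subnn.
have [l0 hl0] : exists l : 'I_n.+1, (below P l - below Q l)%N != 0%N.
  apply: contrapT => H; move: S; rewrite big1 // => l _; apply/eqP/negPn/negP => h.
  by apply: H; exists l.
have others (l : nat) : (l <= n)%N -> l != l0 -> below P l = below Q l.
  move=> ln ll; move: S; rewrite (bigD1 l0) //= (bigD1 (Ordinal (ln : l < n.+1)%N)) //=.
  have := bPQ l; move: hl0; lia.
have atl0 : below P l0 = (below Q l0).+1.
  move: S; rewrite (bigD1 l0) //=; have := bPQ l0; move: hl0; lia.
have l0n : (l0 < n)%N.
  rewrite ltn_neqAle -ltnS ltn_ord andbT; apply/eqP => E.
  by move: atl0; rewrite E !belown cPQ; lia.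
have l00 : (0 < l0)%N.
  by rewrite lt0n; apply/eqP => E; move: atl0; rewrite E !below0.
have lt_i : (l0.-1 < n.-1)%N by lia.
pose i := Ordinal lt_i.
have Eh : hi i = l0 :> nat by rewrite /=; lia.
have El : (lo i).+1 = l0 :> nat by rewrite /=; lia.
have inE' (p : 'I_n) : p != lo i -> p != hi i -> (p \in P) = (p \in Q).
  rewrite -!val_eqE => /= pl ph.
  have := belowS P p; have := belowS Q p.
  rewrite (others p.+1 (ltn_ord _)); last by apply/eqP; move: pl => /eqP; lia.
  rewrite (others p (ltnW (ltn_ord _))); last by apply/eqP; move: ph => /eqP; lia.
  by move=> -> /addnI; case: (_ \in _); case: (_ \in _).
have [lP lQ] : lo i \in P /\ lo i \notin Q.
  have := belowS P (lo i); have := belowS Q (lo i); rewrite El atl0 (others (lo i) (ltnW (ltn_ord _))); last by rewrite -El ltn_eqF.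
  by move=> ->; case: (_ \in _); case: (_ \in _) => //=; lia.
have [hP hQ] : hi i \notin P /\ hi i \in Q.
  have := belowS P (hi i); have := belowS Q (hi i); rewrite (others (hi i).+1 (ltn_ord _)); last by rewrite -Eh gtn_eqF.
  rewrite Eh.
  by rewrite atl0 => ->; case: (_ \in _); case: (_ \in _) => //=; lia.
exists i; split => //.
apply/setP => p; rewrite in_swapset.
have [->|pl] := eqVneq p (lo i); first by rewrite srefl_lo (negbTE lQ) (negbTE hP).
have [->|ph] := eqVneq p (hi i); first by rewrite srefl_hi hQ lP.
by rewrite srefl_off // inE'.
Qed.

End Diagrams.

Section Incidence.
Variables (R : realType) (k n : nat).
Hypothesis kn : (k <= n)%N.
Notation pt := (nat -> R).
Local Notation Gr := (Gr R k n).
Local Notation Phi := (@Phi R k n kn).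
Local Notation endset := (endset k).
Local Notation red := (@red k n).
Local Notation img := (img k).
Local Notation skel := (@skel_lt R k n).
Implicit Types (t : seq 'I_n.-1) (u : pt) (v w : 'S_n).

Lemma schubert_cellE w : @schubert_cell R k n w = cellP (img w).
Proof. by []. Qed.

Lemma skelE d V : skel d V <-> (wt (pivot (val V)) < wt (P0 k n) + d)%N.
Proof.
split=> [[w [wM wd /= wV]]|h].
  have E : pivot (val V) = img w by exact: wV.
  by rewrite E -(ell_minrep kn wM) addnC ltn_add2l.
have [w wM Ew] := minrep_exists kn (etrans (card_pivot (val V)) (eqP (valP V))).
exists w; split; [exact: wM| |by rewrite schubert_cellE].
by rewrite -(ltn_add2r (wt (P0 k n))) (ell_minrep kn wM) Ew addnC.
Qed.

Lemma skelS d d' : (d <= d')%N -> skel d `<=` skel d'.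
Proof. move=> dd V /skelE h; apply/skelE; apply: leq_trans h _; by rewrite leq_add2l. Qed.

Lemma closure_cell_skel t : red t ->
  closure (cellP (endset t)) `<=` skel (size t).+1.
Proof.
move=> rt; rewrite (closure_cell R kn) // => V [u cu ->]; apply/skelE.
by rewrite addnS ltnS (wt_pivot_Phi kn).
Qed.

Lemma boundary_cell_skel t : red t ->
  closure (cellP (endset t)) `\` cellP (endset t) `<=` skel (size t).
Proof.
move=> rt V [/[dup] clV]; rewrite (closure_cell R kn) // => -[u cu EV] nV; apply/skelE.
rewrite ltn_neqAle; apply/andP; split; last by rewrite EV (wt_pivot_Phi kn).
apply/negP => /eqP wV; apply: nV; rewrite /cellP /= EV; apply: (pivot_red kn rt).
by apply: (wt_ocube kn) => //; move: wV; rewrite EV.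
Qed.

(** At the first letter, from the tail, that does not move the set up, the weight of the open cell
    does not grow. Boundary points are already one short, and later letters cannot make up the
    deficit. *)
Lemma not_red_wt t u : ~~ red t -> cube (size t) u ->
  (wt (pivot (PhiV k t u)) < wt (P0 k n) + size t)%N.
Proof.
elim: t u => // i t IH u nr cu; rewrite PhiV_cons /= addnS ltnS.
have N0 := ccss_neq0 (u 0%N); have cu' := cube_sh cu.
have [rt|nrt] := boolP (red t); last first.
  have h := IH _ nrt cu'; have [->|[_ ->]] := pivot_cases i (PhiV k t (sh u)) N0; first exact: ltnW.
  by apply: leq_trans (wt_swapset_le _ _) _; exact: h.
have nup : ~~ ((lo i \in endset t) && (hi i \notin endset t)).
  by move: nr; rewrite /= rt.
have [E|E] := pselect (pivot (PhiV k t (sh u)) = endset t).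
  rewrite -wt_red //; have [->|[_ ->]] := pivot_cases i (PhiV k t (sh u)) N0; rewrite E //.
  exact: wt_swapset_not_up.
have h : (wt (pivot (PhiV k t (sh u))) < wt (P0 k n) + size t)%N.
  have : (closure (cellP (endset t)) `\` cellP (endset t)) (Phi t (sh u)).
    by split => //; rewrite (closure_cell R kn) //; exists (sh u).
  by move=> /(boundary_cell_skel rt)/skelE.
have [->|[_ ->]] := pivot_cases i (PhiV k t (sh u)) N0; first exact: ltnW.
by apply: leq_trans (wt_swapset_le _ _) _; exact: h.
Qed.

Variables (o : forall w : 'S_n, chain R Gr (ell w))
  (sigma : 'S_n -> forall d : nat, chain R Gr d -> int).
Hypothesis ho : cell_orientation o.
Hypothesis hsigma : dual_cochains o sigma.

Local Notation closed_cell w := (closure (cellP (img w))).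
Local Notation bd_cell w := (closure (cellP (img w)) `\` cellP (img w)).

Lemma sigma_cochain v d : v \in minrep n k -> d = ell v ->
  rel_cochain (skel d.+1) (skel d) (@sigma v d).
Proof. by move=> vM ->; have [] := hsigma vM. Qed.

Lemma minrep_word w : w \in minrep n k ->
  exists t, [/\ red t, endset t = img w & size t = ell w].
Proof.
move=> wM; have [t rt Et] := red_exists kn (card_img kn w); exists t; split => //.
by have := ell_minrep kn wM; rewrite -Et wt_red //; lia.
Qed.

(** The homology from [c] to a multiple of [o w] persists in the pair of skeleta, where [sigma v] is
    a cochain and duality gives its value on [o w]. *)
Lemma sigma_cell v w (c : chain R Gr (ell w)) : v \in minrep n k -> w \in minrep n k ->
  ell v = ell w -> rel_cycle (closed_cell w) (bd_cell w) c ->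
  exists m : int, rel_homologous (closed_cell w) (bd_cell w) c (o w *~ m) /\
    sigma v c = (w == v)%:R * m.
Proof.
move=> vM wM evw hc; have [t [rt Et st]] := minrep_word wM.
have [ow gw] := ho wM; have [m hm] := gw c hc; exists m; split => //.
have YS : closed_cell w `<=` skel (ell w).+1 by rewrite -Et -st; exact: closure_cell_skel.
have BS : bd_cell w `<=` skel (ell w) by rewrite -Et -st; exact: boundary_cell_skel.
have sv := sigma_cochain vM (esym evw).
have hcS : rel_cycle (skel (ell w).+1) (skel (ell w)) c by exact: rel_cycleS hc.
have oS : rel_cycle (skel (ell w).+1) (skel (ell w)) (o w) by exact: rel_cycleS ow.
have -> : sigma v c = sigma v (o w *~ m).
  by apply: sv.2 => //; [exact: rel_cycle_mulz|exact: rel_homologousS hm].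
rewrite (rel_cochain_mulz sv _ oS); have [_ ->] // := hsigma vM.
by rewrite mulrzz.
Qed.

(** The dimension [d] is a variable with equations, since chains of dimensions [size t], [ell v] and
    [ell w] have different types. *)
Lemma sigma_closed_cell d t v (Psi : pt -> Gr) : red t -> size t = d -> v \in minrep n k -> ell v = d ->
  ccont Psi -> (forall x, cube d x -> closure (cellP (endset t)) (Psi x)) ->
  (forall x, cubebd d x -> (closure (cellP (endset t)) `\` cellP (endset t)) (Psi x)) ->
  endset t <> img v -> sigma v (cubechain d Psi) = 0.
Proof.
move=> rt st vM ev cP PA PB nE.
have [w wM Ew] := minrep_exists kn (card_endset kn t).
have ew : ell w = d.
  by have := ell_minrep kn wM; rewrite Ew wt_red //; lia.
subst d; rewrite -ew in ev cP PA PB *.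
have hc : rel_cycle (closed_cell w) (bd_cell w) (cubechain (ell w) Psi).
  by rewrite Ew; exact: rel_cycle_cubechain.
have [m [_ ->]] := sigma_cell vM wM ev hc.
by case: eqP => [E|_]; [case: nE; rewrite -Ew E|rewrite mul0r].
Qed.

Lemma sigma_Phi d t v : red t -> size t = d -> v \in minrep n k -> endset t = img v ->
  sigma v (cubechain d (Phi t)) = 1 \/ sigma v (cubechain d (Phi t)) = -1.
Proof.
move=> rt st vM Et.
have ev : ell v = d by have := ell_minrep kn vM; rewrite -Et wt_red //; lia.
subst d; have gen (d : nat) (c : chain R Gr d) m : d = size t ->
    rel_homologous (closed_cell v) (bd_cell v) (cubechain d (Phi t)) (c *~ m) -> m = 1 \/ m = -1.
  by move=> Ed; subst d; rewrite -Et; exact: cell_generator_unit.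
rewrite -ev; have hc : rel_cycle (closed_cell v) (bd_cell v) (cubechain (ell v) (Phi t)).
  by rewrite ev -Et; exact: cubechain_Phi_cycle.
have [m [hm ->]] := sigma_cell vM vM erefl hc.
by rewrite eqxx mul1r; exact: gen hm.
Qed.

Lemma sigma_skel d v (c : chain R Gr d) : v \in minrep n k -> ell v = d ->
  chain_in (skel d) c -> rel_cycle (skel d.+1) (skel d) c -> sigma v c = 0.
Proof. by move=> vM /esym ev cB hc; exact: (rel_cochain_in_B (sigma_cochain vM ev)). Qed.

(** If [t] is reduced, the cube is a relative cycle of a cell other than that of [v]; if not, the
    whole cube lies in the lower skeleton. *)
Lemma sigma_vanish d t v (Psi : pt -> Gr) : size t = d -> v \in minrep n k -> ell v = d -> ccont Psi ->
  (forall x, cube d x -> Sset k t (val (Psi x))) ->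
  (forall x, cubebd d x -> skel d (Psi x)) ->
  (red t -> endset t <> img v) -> sigma v (cubechain d Psi) = 0.
Proof.
move=> st vM ev cP PS PB nE; subst d.
have PC x : cube (size t) x -> exists2 u, cube (size t) u & Psi x = Phi t u.
  by move=> /PS[u cu E]; exists u => //; exact: val_inj.
have [rt|nrt] := boolP (red t).
  apply: (sigma_closed_cell rt) => //; last exact: nE.
    by move=> x /PC[u cu ->]; rewrite (closure_cell R kn) //; exists u.
  move=> x bx; split; first by have /PC[u cu ->] := bx.1; rewrite (closure_cell R kn) //; exists u.
  by move=> /= E; have /skelE := PB x bx; rewrite E wt_red // ltnn.
have PB' x : cube (size t) x -> skel (size t) (Psi x).
  by move=> /PC[u cu ->]; apply/skelE; exact: not_red_wt.
apply: sigma_skel => //; first exact: chain_in_cubechain.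
apply: rel_cycle_cubechain => // x cx; exact/skelS/PB'.
Qed.

Lemma cube_map_face e t j eps : size t = e.+1 -> (j <= e)%N -> eps = 0 \/ eps = 1 ->
  cube_map (skel e.+1) (skel e) e (Phi t \o ins j eps).
Proof.
move=> st je e01; have inS x : inside e.+1 (ins j eps x) = inside e x by exact: inside_ins.
split.
- by apply: ccont_ins; exact: Phi_ccont.
- move=> x cx; apply/skelE; rewrite addnS ltnS.
  have := wt_pivot_inside kn t (ins j eps x); rewrite st inS => /leq_trans; apply.
  by rewrite leq_add2l inside_le.
- move=> x bx; apply/skelE.
  have := wt_pivot_inside kn t (ins j eps x); rewrite st inS => /leq_ltn_trans; apply.
  by rewrite ltn_add2l inside_bd.
Qed.

Lemma sigma_face e t v j eps : size t = e.+1 -> v \in minrep n k -> ell v = e -> (j <= e)%N ->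
  eps = 0 \/ eps = 1 -> (red (delat j t) -> endset (delat j t) <> img v) ->
  sigma v (cubechain e (Phi t \o ins j eps)) = 0.
Proof.
move=> st vM ev je e01; have [g1 g2 g3] := cube_map_face st je e01.
apply: sigma_vanish => //.
  by rewrite size_cat size_take size_drop st ltnS je; lia.
move=> x cx; apply: (Phi_face kn); rewrite ?st //.
  by apply: cube_ins => //; case: e01 => ->; lra.
by rewrite /ins ltnn eqxx.
Qed.

Lemma sigma_bd e t v : size t = e.+1 -> v \in minrep n k -> ell v = e ->
  sigma v (bd (cubechain e.+1 (Phi t))) =
  \sum_(j < e.+1) (sigma v (cubechain e (Phi t \o ins j 1)) -
                   sigma v (cubechain e (Phi t \o ins j 0))) *~ (-1) ^+ j.
Proof.
move=> st vM ev; have sv := sigma_cochain vM (esym ev).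
have cyc (j : 'I_e.+1) eps : eps = 0 \/ eps = 1 ->
    rel_cycle (skel e.+1) (skel e) (cubechain e (Phi t \o ins j eps)).
  by move=> e01; apply: cube_map_cycle; apply: cube_map_face; rewrite // -ltnS.
have cyc1 j := cyc j 1 (or_intror erefl); have cyc0 j := cyc j 0 (or_introl erefl).
rewrite bd_cubechain (rel_cochain_sum sv); last first.
  by move=> j; apply: rel_cycle_mulz; apply: rel_cycleD; last exact: rel_cycleN.
apply: eq_bigr => j _; rewrite (rel_cochain_mulz sv); last first.
  by apply: rel_cycleD; last exact: rel_cycleN.
by rewrite (rel_cochainD sv) ?(rel_cochainN sv) //; exact: rel_cycleN.
Qed.

Variable inc : 'S_n -> 'S_n -> int.
Hypothesis hinc : incidence_numbers sigma inc.

(** Evaluating the coboundary formula on the cube of w' isolates one incidence number: the cube lies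
    in a single closed cell, so the other summands vanish. *)
Lemma inc_bd w w' t : w \in minrep n k -> w' \in minrep n k -> ell w' = (ell w).+1 ->
  red t -> endset t = img w' ->
  exists2 s : int, s = 1 \/ s = -1 &
    sigma w (bd (cubechain (ell w).+1 (Phi t))) = inc w w' * s.
Proof.
move=> wM wM' ew rt Et; set e := ell w in ew *.
have st : size t = e.+1 by have := ell_minrep kn wM'; rewrite -Et wt_red //; lia.
exists (sigma w' (cubechain e.+1 (Phi t))); first exact: sigma_Phi.
have cyc : rel_cycle (skel e.+2) (skel e.+1) (cubechain e.+1 (Phi t)).
  have := cubechain_Phi_cycle R kn rt; rewrite -st; apply: rel_cycleS.
    exact: closure_cell_skel.
  exact: boundary_cell_skel.
have := hinc wM cyc; rewrite /coboundary => ->.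
rewrite (bigD1 w') /=; last by rewrite wM' ew eqxx.
rewrite big1 ?addr0 // => v /andP[/andP[vM /eqP ev] vw].
rewrite (@sigma_closed_cell e.+1 t v) ?mulr0 //.
- exact: Phi_ccont.
- by move=> x; rewrite -st; exact: Phi_closure.
- by move=> x; rewrite -st; exact: Phi_boundary.
- rewrite Et => E; case/eqP: vw; exact: (minrep_uniq kn vM wM' (esym E)).
Qed.

Lemma inc_not_adjacent w w' : w \in minrep n k -> w' \in minrep n k -> ell w' = (ell w).+1 ->
  ~ (exists i, w' = (w * srefl i)%g) -> inc w w' = 0.
Proof.
move=> wM wM' ew nadj; have [t [rt Et st]] := minrep_word wM'.
have [s s1 E] := inc_bd wM wM' ew rt Et.
have : inc w w' * s = 0.
  have st' : size t = (ell w).+1 by rewrite st ew.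
  rewrite -E (sigma_bd st' wM erefl) big1 // => j _.
  (* Otherwise the centre [u0] of the shortened cube would be a point of the cell of w in the closed
     cell of w'. Then [below_endset] compares the diagrams, which differ by one box, and w' would be
     adjacent to w. *)
  have nE : red (delat j t) -> endset (delat j t) <> img w.
    move=> rd Ed; apply: nadj.
    have jt : (j < size t)%N by rewrite st'.
    have sd' : size (delat j t) = ell w.
      by rewrite size_cat size_take size_drop jt st'; have := ltn_ord j; lia.
    pose u0 : pt := fun=> 1/2.
    have ou0 : ocube (size (delat j t)) u0 by move=> l _; rewrite /u0; apply/andP; split; lra.
    have pu0 : pivot (PhiV k (delat j t) u0) = img w by rewrite (pivot_red kn).
    have : Sset k (delat j t) (PhiV k (delat j t) u0).
      by exists u0 => // l /ou0/andP[? ?]; apply/andP; split; exact: ltW.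
    move=> /(Sset_delat jt)[u cu Eu].
    have [||l|i [li hi' Ei]] := @cover_swapset n (img w) (img w').
    - by rewrite !card_img.
    - by rewrite -!(ell_minrep kn) // ew addSn.
    - by rewrite -pu0 Eu -Et; exact: below_endset.
    by exists i; exact: (minrep_up kn wM wM' li hi' Ei).
  have F eps' : eps' = 0 \/ eps' = 1 -> sigma w (cubechain (ell w) (Phi t \o ins j eps')) = 0.
    by move=> e01; apply: (sigma_face st') => //; rewrite -ltnS.
  by rewrite (F 1 (or_intror erefl)) (F 0 (or_introl erefl)) subrr mul0rz.
by case: s1 => ->; rewrite ?mulr1 ?mulrN1 // => /eqP; rewrite oppr_eq0 => /eqP.
Qed.

Lemma inc_adjacent w w' i : w \in minrep n k -> w' \in minrep n k -> ell w' = (ell w).+1 ->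
  w' = (w * srefl i)%g ->
  if odd (i + k.-1) then inc w w' = 2 \/ inc w w' = -2 else inc w w' = 0.
Proof.
move=> wM wM' ew Ew'; have [t [rt Et st]] := minrep_word wM.
have [li hi'] : lo i \in img w /\ hi i \notin img w.
  by apply: (minrep_up_inv kn) => //; rewrite -Ew'.
have rit : red (i :: t) by rewrite /= rt Et li hi'.
have Eit : endset (i :: t) = img w' by rewrite Ew' img_srefl // /= Et.
have [s s1 E] := inc_bd wM wM' ew rit Eit.
have sv := sigma_cochain wM erefl.
have [a Ea1 Ea] : exists2 a : int, a = 1 \/ a = -1 & sigma w (cubechain (ell w) (Phi t)) = a.
  by eexists; last reflexivity; exact: sigma_Phi.
move: E; rewrite sigma_bd //=; last by rewrite st.
rewrite big_ord_recl expr0 mulr1z big1 ?addr0; last first.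
  move=> j _.
  (* These faces keep the leading letter i, so their set does not contain [lo i], whereas [img w]
     does. *)
  have nE : red (delat (fintype.lift ord0 j) (i :: t)) ->
      endset (delat (fintype.lift ord0 j) (i :: t)) <> img w.
    by rewrite /delat /= => /and3P[_ _ hX] Ed; move: li; rewrite -Ed in_swapset srefl_lo (negbTE hX).
  have F eps' : eps' = 0 \/ eps' = 1 ->
      sigma w (cubechain (ell w) (Phi (i :: t) \o ins (fintype.lift ord0 j) eps')) = 0.
    by move=> e01; apply: sigma_face => //=; rewrite ?st // -ltnS ltn_ord.
  by rewrite (F 1 (or_intror erefl)) (F 0 (or_introl erefl)) subrr mul0rz.
have -> : Phi (i :: t) \o ins 0 0 = Phi t.
  apply/funext => x; apply: val_inj; rewrite [LHS]PhiV_cons.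
  by rewrite /ins /= cc0 ss0 actV_id.
pose eps (p : 'I_n) := (p == lo i) || (p == hi i).
have -> : Phi (i :: t) \o ins 0 1 = Phi t \o flipu (flipb t eps).
  apply/funext => x; apply: val_inj; rewrite [LHS]PhiV_cons.
  rewrite /ins /= cc1 ss1 actV_m1 -/eps.
  exact: (sgnV_Phi kn).
have gt : cube_map (skel (ell w).+1) (skel (ell w)) (ell w) (Phi t).
  rewrite -st; split; first exact: Phi_ccont.
    by move=> x cx; apply/(closure_cell_skel rt)/Phi_closure.
  by move=> x bx; apply/(boundary_cell_skel rt)/Phi_boundary.
rewrite (cochain_flipu sv gt) ?size_flipb ?st // Ea.
rewrite -signr_odd (count_flipb kn _ rt) Et (odd_crossings kn) ?card_img //.
by case: (odd _); case: s1 => ->; case: Ea1 => ->; rewrite ?expr1 ?expr0 => H; lia.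
Qed.

Theorem incidence_weak_edge w w' : w \in minrep n k -> w' \in minrep n k ->
  ell w' = (ell w).+1 ->
  (weak_edge k w w' -> inc w w' = 2 \/ inc w w' = - 2) /\
  (~ weak_edge k w w' -> inc w w' = 0).
Proof.
move=> wM wM' ew.
have [[i Ei]|nadj] := pselect (exists i, w' = (w * srefl i)%g); last first.
  by split=> [[]//|_]; exact: inc_not_adjacent.
have := inc_adjacent wM wM' ew Ei.
have [li hi'] : lo i \in img w /\ hi i \notin img w.
  by apply: (minrep_up_inv kn) => //; rewrite -Ei.
have := eta_up kn (mono_minrep kn wM) li hi'; rewrite -Ei => Eeta.
case: (odd _) Eeta => /= Eeta H; split => //.
- by move=> nE; case: nE; split; [exists i|rewrite Eeta addn0].
- by move=> [_ E]; move: Eeta; rewrite -E => /eqP; rewrite addn1 -[X in X == _]addn0 -addn1 eqn_add2l.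
Qed.

End Incidence.

Theorem theorem3p2 (R : realType) (k n : nat) (hk : (1 <= k <= n.-1)%N)
    (o : forall w : 'S_n, chain R (Gr R k n) (ell w))
    (sigma : 'S_n -> forall d : nat, chain R (Gr R k n) d -> int)
    (inc : 'S_n -> 'S_n -> int)
    (ho : cell_orientation o)
    (hsigma : dual_cochains o sigma)
    (hinc : incidence_numbers sigma inc) :
  (forall w w' : 'S_n, w \in minrep n k -> w' \in minrep n k ->
     ell w' = (ell w).+1 ->
     (weak_edge k w w' -> inc w w' = 2 \/ inc w w' = - 2) /\
     (~ weak_edge k w w' -> inc w w' = 0)) /\
  (forall w w' : 'S_n, graph_G k w w' <-> incidence_graph k inc w w').
Proof.
have kn : (k <= n)%N by case/andP: hk => _ /leq_trans; apply; exact: leq_pred.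
have main := incidence_weak_edge kn ho hsigma hinc.
split=> // w w'; split=> [[wM wM' ew /(main w w' wM wM' ew).1 h]|[wM wM' ew h]]; split => //.
apply: contrapT => /(main w w' wM wM' ew).2 E; move: h; rewrite E; lia.
Qed.
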